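(* Let $n\ge2$ and let $S\subset C(\mathbb S_{\mathbb C}^{n-1})$ be a finite-dimensional subspace. Then the following assertions are equivalent: (1) $S$ is $\mathcal U_n$-invariant. (2) $S$ is $\mathcal U_n$-accessible. (3) There exists a finite set $F\subset\mathbb N_0^2$ such that $S=\bigoplus_{(p,q)\in F}\mathcal H_{p,q}(\mathbb S_{\mathbb C}^{n-1})$.
   Context: Complex scalars. $\mathbb S_{\mathbb C}^{n-1}=\{z\in\mathbb C^n:\|z\|_2=1\}$ with normalized rotation-invariant measure $\sigma_n$; the unitary group $\mathcal U_n$ acts by $U\bullet z=Uz$. $\mathcal H_{p,q}(\mathbb S_{\mathbb C}^{n-1})$ is the space of restrictions to $\mathbb S_{\mathbb C}^{n-1}$ of polynomials on $\mathbb C^n$ in $z,\overline z$ that are bihomogeneous of degree $p$ in $z$ and degree $q$ in $\overline z$ (i.e. $P(\lambda z)=\lambda^p\overline\lambda^{\,q}P(z)$, $\lambda\in\mathbb C$) and harmonic, i.e. annihilated by $\sum_{j=1}^n\partial_{z_j}\partial_{\overline z_j}$. Put $(L_Uf)(z)=f(U^{-1}z)$ for $U\in\mathcal U_n$. $S$ is $\mathcal U_n$-invariant if $L_U(S)\subset S$ for all $U$. A (bounded linear) projection $Q\colon C(\mathbb S_{\mathbb C}^{n-1})\to S$ is equivariant if $QL_U=L_UQ$ for all $U$. A finite-dimensional $\mathcal U_n$-invariant subspace $S$ is $\mathcal U_n$-accessible if every equivariant projection $Q\colon C(\mathbb S_{\mathbb C}^{n-1})\to S$ coincides with the restriction to $C(\mathbb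 S_{\mathbb C}^{n-1})$ of the orthogonal projection $L_2(\mathbb S_{\mathbb C}^{n-1},\sigma_n)\to S$. *)

(* Defs.v *)
From HB Require Import structures.
From mathcomp Require Import all_boot all_order all_algebra finmap.
From mathcomp Require Import all_classical all_reals all_analysis.
From mathcomp Require Import complex.
(* The notations of mpoly clash with those of mathcomp-analysis. *)
From mathcomp Require Import -(notations) mpoly.

Set Implicit Arguments.
Unset Strict Implicit.
Unset Printing Implicit Defensive.

Import Order.TTheory GRing.Theory Num.Theory numFieldNormedType.Exports.

Local Open Scope classical_set_scope.
Local Open Scope ring_scope.

#[warnings="-redundant-canonical-projection"]
HB.instance Definition _ (R : realType) := NormedModule.copy R[i] R[i]^o.

Section continuous_lmodule.
Context {X : topologicalType} {K : numFieldType} {V : normedModType K}.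
Local Notation CXV := (continuousType X V).
Implicit Types (f g h : CXV) (a b : K).

Let continuous0 : continuous (fun _ : X => 0 : V).
Proof. by move=> x; exact: cvg_cst. Qed.

Let continuousN f : continuous (fun x => - f x).
Proof. by move=> x; apply: cvgN; exact: cts_fun. Qed.

Let continuousD f g : continuous (fun x => f x + g x).
Proof. by move=> x; apply: cvgD; exact: cts_fun. Qed.

Let continuousZ a f : continuous (fun x => a *: f x).
Proof. by move=> x; apply: cvgZr; exact: cts_fun. Qed.

Definition cts_zero : CXV := mkcts continuous0.
Definition cts_opp f : CXV := mkcts (@continuousN f).
Definition cts_add f g : CXV := mkcts (@continuousD f g).
Definition cts_scale a f : CXV := mkcts (@continuousZ a f).

Let cts_addA : associative cts_add.
Proof. by move=> f g h; apply/continuousEP => x; exact: addrA. Qed.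

Let cts_addC : commutative cts_add.
Proof. by move=> f g; apply/continuousEP => x; exact: addrC. Qed.

Let cts_add0 : left_id cts_zero cts_add.
Proof. by move=> f; apply/continuousEP => x; exact: add0r. Qed.

Let cts_addN : left_inverse cts_zero cts_opp cts_add.
Proof. by move=> f; apply/continuousEP => x; exact: addNr. Qed.

HB.instance Definition _ :=
  GRing.isZmodule.Build CXV cts_addA cts_addC cts_add0 cts_addN.

Let cts_scaleA a b f : cts_scale a (cts_scale b f) = cts_scale (a * b) f.
Proof. by apply/continuousEP => x; exact: scalerA. Qed.

Let cts_scale1 : left_id 1 cts_scale.
Proof. by move=> f; apply/continuousEP => x; exact: scale1r. Qed.

Let cts_scaleDr : right_distributive cts_scale +%R.
Proof. by move=> a f g; apply/continuousEP => x; exact: scalerDr. Qed.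

Let cts_scaleDl f : {morph cts_scale^~ f : a b / a + b}.
Proof. by move=> a b; apply/continuousEP => x; exact: scalerDl. Qed.

HB.instance Definition _ := GRing.Zmodule_isLmodule.Build K CXV
  cts_scaleA cts_scale1 cts_scaleDr cts_scaleDl.

End continuous_lmodule.

Section complex_sphere.
Variable R : realType.
Local Notation C := R[i].

Definition l2norm n (z : 'cV[C]_n) : C := sqrtC (\sum_j `|z j ord0| ^+ 2).

(* The unit sphere of C^(n.+1): the ambient dimension is a successor because *)
(* measurable types have to be inhabited.                                    *)
Definition csphere (n : nat) : Type :=
  set_type [set z : 'cV[C]_n.+1 | l2norm z = 1].

Variable n : nat.
Local Notation S := (csphere n).

HB.instance Definition _ := Topological.on S.

Lemma csphereP (z : S) : l2norm (\val z) = 1.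
Proof. exact: (set_valP z). Qed.

Definition mk_csphere (z : 'cV[C]_n.+1) (hz : l2norm z = 1) : S :=
  exist _ z (mem_set hz).

Lemma l2norm_delta : l2norm (delta_mx ord0 ord0 : 'cV[C]_n.+1) = 1.
Proof.
rewrite /l2norm (bigD1 ord0) //= mxE !eqxx /= normr1 expr1n big1 ?addr0 ?sqrtC1//.
by move=> i /negPf i0; rewrite mxE i0 /= normr0 expr0n.
Qed.

HB.instance Definition _ := isPointed.Build S (mk_csphere l2norm_delta).

HB.instance Definition _ := Measurable.copy S
  (g_sigma_algebraType (@open S)).

Definition unitary_group := {U : 'M[C]_n.+1 | U \is unitarymx}.

Lemma invmx_unitary_subproof (U : unitary_group) :
  invmx (val U) \is unitarymx.
Proof. by rewrite invmx_unitary ?trmxC_unitary; exact: valP U. Qed.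

Definition unitary_inv (U : unitary_group) : unitary_group :=
  exist _ (invmx (val U)) (invmx_unitary_subproof U).

Lemma l2norm_unitary (U : unitary_group) (z : 'cV[C]_n.+1) :
  l2norm (val U *m z) = l2norm z.
Proof.
have E (w : 'cV[C]_n.+1) :
    \sum_j `|w j ord0| ^+ 2 = (map_mx Num.conj w^T *m w) ord0 ord0.
  rewrite mxE; apply: eq_bigr => j _.
  by rewrite !mxE normCK mulrC.
rewrite /l2norm !E; congr (sqrtC (fun_of_matrix _ _ _)).
have /unitarymxP/mulmx1C UU := valP U.
rewrite trmx_mul map_mxM -mulmxA (mulmxA _ (val U)).
by rewrite UU mul1mx.
Qed.

Lemma unitary_act_subproof (U : unitary_group) (z : S) :
  l2norm (val U *m \val z) = 1.
Proof. by rewrite l2norm_unitary csphereP. Qed.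

Definition unitary_act (U : unitary_group) (z : S) : S :=
  mk_csphere (unitary_act_subproof U z).

Lemma continuous_unitary_act (U : unitary_group) : continuous (unitary_act U).
Proof.
suff : continuous (fun z : S => \val (unitary_act U z) : 'cV[C]_n.+1).
  exact: (@continuous_comp_initial _ S 'cV[C]_n.+1
            (set_val : S -> 'cV[C]_n.+1) (unitary_act U)).
move=> z A [P hP PA].
suff hz : \forall y \near z, forall i j, P i j ((val U *m \val y) i j).
  by apply: (@filterS _ (nbhs z) _ _ _ _ hz) => y hy; exact: PA.
apply: (@filter_forall _ _ _ (nbhs z)) => i.
apply: (@filter_forall _ _ _ (nbhs z)) => j.
suff contUz : {for z, continuous (fun y : S => (val U *m \val y) i j)}.
  exact: contUz (hP i j).
have -> : (fun y : S => (val U *m \val y) i j) =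
    (fun y : S => \sum_k val U i k * (\val y : 'cV[C]_n.+1) k j).
  by apply/funext => y; rewrite mxE.
apply: (@cvg_big C _ +%R 0 _ (@add_continuous C) S (nbhs z)) => k _.
apply: (@cvgM C S (nbhs z) _ (fun=> _)); first exact: cvg_cst.
exact: (continuous_comp (@initial_continuous S 'cV[C]_n.+1 set_val z)
         (@coord_continuous C _ _ k j _)).
Qed.

Local Notation CS := (continuousType S C).

Definition ltrans (U : unitary_group) (f : CS) : CS :=
  mkcts (fun z => continuous_comp (@continuous_unitary_act (unitary_inv U) z)
                    (@cts_fun _ _ f (unitary_act (unitary_inv U) z))).

Definition fin_dim_subspace (A : set CS) : Prop :=
  exists (m : nat) (b : 'I_m -> CS),
    A = range (fun c : 'I_m -> C => \sum_i c i *: b i).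

Definition unitary_invariant (A : set CS) : Prop :=
  forall (U : unitary_group) (f : CS), A f -> A (ltrans U f).

Definition supnorm (f : CS) : R := sup (range (fun z => complex.Re `|f z|)).

Definition bounded_op (Q : CS -> CS) : Prop :=
  exists M : R, forall f, supnorm (Q f) <= M * supnorm f.

Definition projection_onto (A : set CS) (Q : {linear CS -> CS}) : Prop :=
  [/\ bounded_op Q, forall f, A (Q f) & forall f, A f -> Q f = f].

Definition equivariant (Q : CS -> CS) : Prop :=
  forall U f, Q (ltrans U f) = ltrans U (Q f).

(* The unitary group being compact and transitive on the sphere, there is    *)
(* exactly one such probability measure, the normalized surface measure.     *)
Definition rotation_invariant (sigma : probability S R) : Prop :=
  forall (U : unitary_group) (B : set S),
    measurable B -> sigma (unitary_act U @^-1` B) = sigma B.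

Section l2.
Variable sigma : probability S R.

Definition cintegral (f : S -> C) : C :=
  ((\int[sigma]_z complex.Re (f z)) +i* (\int[sigma]_z complex.Im (f z)))%C.

Definition l2dot (f g : S -> C) : C := cintegral (fun z => f z * (g z)^*).

(* For a square-integrable f, g is the value at f of the orthogonal          *)
(* projection from L^2(sigma) onto A.                                        *)
Definition l2_projection (A : set CS) (f : S -> C) (g : CS) : Prop :=
  A g /\ forall h : CS, A h -> l2dot (fun z => f z - g z) h = 0.

Definition unitary_accessible (A : set CS) : Prop :=
  [/\ fin_dim_subspace A, unitary_invariant A &
      forall Q : {linear CS -> CS},
        projection_onto A Q -> equivariant Q ->
        forall f : CS, l2_projection A f (Q f)].

End l2.

(* A polynomial in z and its conjugate is encoded by a polynomial in twice as *)
(* many variables: the first n.+1 variables stand for the z_j and the last   *)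
(* n.+1 ones for their conjugates, so that the Wirtinger derivatives become  *)
(* the formal partial derivatives.                                           *)
Local Notation zpoly := (mpoly (n.+1 + n.+1) C).

Definition zeval (P : zpoly) (z : 'cV[C]_n.+1) : C :=
  meval (fun k : 'I_(n.+1 + n.+1) =>
           match fintype.split k with
           | inl j => z j ord0
           | inr j => (z j ord0)^*
           end) P.

Definition bihomogeneous (p q : nat) (P : zpoly) : Prop :=
  forall (a : C) (z : 'cV[C]_n.+1),
    zeval P (a *: z) = a ^+ p * a^* ^+ q * zeval P z.

Definition zharmonic (P : zpoly) : Prop :=
  \sum_(j < n.+1)
    mderiv (lshift n.+1 j) (mderiv (rshift n.+1 j) P) = 0.

Definition Hpq (pq : nat * nat) : set CS :=
  [set f | exists P : zpoly, [/\ bihomogeneous pq.1 pq.2 P, zharmonic P &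
                                 forall z : S, f z = zeval P (\val z)]].

Definition direct_sum (F : {fset nat * nat}) (H : nat * nat -> set CS)
    (A : set CS) : Prop :=
  A = [set f | exists h : nat * nat -> CS,
         (forall pq, pq \in F -> H pq (h pq)) /\ f = \sum_(pq <- F) h pq] /\
  (forall h : nat * nat -> CS, (forall pq, pq \in F -> H pq (h pq)) ->
     \sum_(pq <- F) h pq = 0 -> forall pq, pq \in F -> h pq = 0).

End complex_sphere.

Notation CS R n := (continuousType (csphere R n) R[i]).

(* Main.v *)
From HB Require Import structures.
Require Import Defs.
From mathcomp Require Import all_boot all_order all_algebra finmap.
From mathcomp Require Import ring zify.
From mathcomp Require mpoly.

(* On polynomials of bidegree (p, q) one has Δ r² = r² Δ + (p + q + N), so    *)
(* that every polynomial is, by an explicit formula, a harmonic one plus a    *)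
(* multiple of r². A linear functional on polynomials that is invariant under *)
(* the stabilizer of a pole e and kills r² * f for all f is determined on     *)
(* bidegree (p, q) by its value at z_0^p \bar z_0^q: the diagonal matrices    *)
(* fixing e kill the monomials whose exponents of z_j and \bar z_j differ for *)
(* some j > 0, the rotations in the (i, j)-planes relate the remaining        *)
(* values, and r² provides the last relation. Applied to f |-> (Q f)(e), this *)
(* shows that an equivariant operator Q acts on each H_(p,q) as a scalar.     *)
(* Polynomials are dense in the continuous functions, by convolution with     *)
(* powers of (1 + Re <z, w>) / 2. Hence an equivariant bounded projection     *)
(* onto A and the orthogonal projection onto A, which both act on             *)
(* H_(p,q) as 1 if H_(p,q) lies in A and as 0 otherwise, agree, and an        *)
(* invariant A is the sum of the H_(p,q) that it contains.                    *)

Set Implicit Arguments.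
Unset Strict Implicit.
Unset Printing Implicit Defensive.

Import Order.TTheory GRing.Theory Num.Theory.
Local Open Scope ring_scope.

(** * Harmonic polynomials in [z] and its conjugate *)

(** The engine is a concrete form of Schur's lemma. On harmonic polynomials of bidegree (p, q), a
    linear functional invariant under the stabilizer of a pole is a multiple of evaluation at the
    pole ([zonal_proportional]). For an equivariant operator [Q], the functional [f |-> (Q f)(pole)]
    is of this kind, and transitivity of the unitary group carries the resulting identity from the
    pole to every point: [Q] is a scalar on each H_(p,q) ([equivariant_Hpq_scalar]). So if [Q] takes
    its values in a subspace [A], then either H_(p,q) lies in [A] or [Q] kills it ([Hpq_dichotomy]).

    The uniqueness of the functional is a computation with monomials. Composing with the harmonic
    projection yields an invariant functional that kills the multiples of r². Diagonal unitaries,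
    infinitesimal plane rotations and the relation r² ~ 0 then reduce every monomial to the powers
    of the pole coordinate and its conjugate ([zonal_functional_eq0]). The zonal harmonic obtained
    from these powers does not vanish at the pole ([polar_harmonic_neq0]), which is where a second
    coordinate, that is [n > 0], enters.

    To pass to all continuous functions, note that r² = 1 on the sphere, so polynomials restrict to
    sums of elements of the H_(p,q) ([subspace_zrestrict]), and these restrictions are uniformly
    dense ([zpoly_dense]). A functional bounded in the sup norm and zero on every H_(p,q) is
    therefore zero ([functional_eq0]).

    Both substantial implications are instances of this principle. For accessibility, with [h] in
    [A], the functional is [g |-> <g - Q g, h>]. For the decomposition, let [B] be the sum of the
    H_(p,q) contained in [A], and take [g |-> <g, f - P_B f>] for [f] in [A]. The sum is finite and
    direct because distinct H_(p,q) are orthogonal, which follows from the dichotomy for the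
    orthogonal projection onto one of them and from the fact that no H_(p,q) lies in another
    ([Hpq_subset_eq]). *)

Section MpolyDerivations.
Import mpoly.

Lemma mpoly_gen_ind (n : nat) (R : comNzRingType) (P : {mpoly R[n]} -> Prop) :
  (forall c, P c%:MP) -> (forall i, P 'X_i) ->
  (forall f g, P f -> P g -> P (f + g)) ->
  (forall f g, P f -> P g -> P (f * g)) -> forall f, P f.
Proof.
move=> PC PX PD PM f; rewrite (mpolyE f).
apply: (big_ind P); [by rewrite -mpolyC0; exact: PC | exact: PD |].
move=> m _.
rewrite -mul_mpolyC; apply: (PM); [exact: PC|rewrite mpolyXE_id].
apply: (big_ind P); [by rewrite -mpolyC1; exact: PC | exact: PM |].
move=> k _.
elim: (m k) => [|e IH]; first by rewrite expr0 -mpolyC1; exact: PC.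
by rewrite exprS; apply: (PM).
Qed.

Lemma mpoly_rmorph_eq (n : nat) (R A : comNzRingType)
    (u v : {rmorphism {mpoly R[n]} -> A}) :
  (forall c, u c%:MP = v c%:MP) -> (forall k, u 'X_k = v 'X_k) -> u =1 v.
Proof.
move=> uvC uvX; elim/mpoly_gen_ind => [//|//|f g Hf Hg|f g Hf Hg].
  by rewrite !rmorphD Hf Hg.
by rewrite !rmorphM Hf Hg.
Qed.

(** Both sides are derivations along [s], so agreement on constants and variables suffices. This is
    the chain rule used for lines, curves and unitary substitutions. *)
Lemma mpoly_derivationE (n : nat) (R : comNzRingType) (A : comNzRingType)
    (s : {rmorphism {mpoly R[n]} -> A}) (d : {additive {mpoly R[n]} -> A}) :
  (forall f g, d (f * g) = s f * d g + d f * s g) ->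
  (forall c, d c%:MP = 0) ->
  forall f, d f = \sum_k s (mderiv k f) * d 'X_k.
Proof.
move=> dM dC; apply: mpoly_gen_ind => [c|i|f g Hf Hg|f g Hf Hg].
- by rewrite dC big1 // => k _; rewrite mderivC rmorph0 mul0r.
- rewrite (bigD1 i) //= mderivX big1 => [|k ki].
    by rewrite mnm1E eqxx scale1r -[X in (X - _)%MM]add0m addmK mpolyX0 rmorph1 mul1r addr0.
  by rewrite mderivX mnm1E eq_sym (negPf ki) scale0r rmorph0 mul0r.
- rewrite raddfD Hf Hg -big_split /=; apply: eq_bigr => k _.
  by rewrite mderivD rmorphD mulrDl.
- rewrite dM Hf Hg mulr_sumr mulr_suml -big_split /=; apply: eq_bigr => k _.
  by rewrite mderivM rmorphD !rmorphM; ring.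
Qed.

(** Taking the coefficient of degree 1 satisfies the Leibniz rule along evaluation at 0, so the
    chain rule applies. *)
Lemma coef1_rmorphE (n : nat) (R A : comNzRingType)
    (c : {rmorphism {mpoly R[n]} -> {poly A}}) :
  (forall a, (c a%:MP)`_1 = 0) ->
  forall f, (c f)`_1 = \sum_k (c (mderiv k f)).[0] * (c 'X_k)`_1.
Proof.
move=> cC f; pose s : {rmorphism {mpoly R[n]} -> A} := horner_eval 0 \o c.
pose D : {additive {mpoly R[n]} -> A} := coefp 1 \o c.
rewrite -[LHS]/(D f) (@mpoly_derivationE _ _ _ s D) // => g h /=.
rewrite rmorphM coefM !big_ord_recl big_ord0 /= addr0.
by rewrite /horner_eval !horner_coef0.
Qed.

End MpolyDerivations.

Section Harmonic.
Import mpoly.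
Variables (C : numClosedFieldType) (N : nat).
Local Notation zpoly := {mpoly C[N + N]}.
Implicit Types (f g h : zpoly) (x y : C).

Definition zl (j : 'I_N) : zpoly := 'X_(lshift N j).
Definition zr (j : 'I_N) : zpoly := 'X_(rshift N j).
Definition laplacian f : zpoly :=
  \sum_(j < N) mderiv (lshift N j) (mderiv (rshift N j) f).
Definition sqnorm_mpoly : zpoly := \sum_(j < N) zl j * zr j.
Definition eulerl f : zpoly := \sum_(j < N) zl j * mderiv (lshift N j) f.
Definition eulerr f : zpoly := \sum_(j < N) zr j * mderiv (rshift N j) f.

Local Notation "'Δ'" := laplacian.
Local Notation r2 := sqnorm_mpoly.

Lemma laplacian_is_linear : linear laplacian.
Proof.
move=> a f g; rewrite /laplacian scaler_sumr -big_split /=.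
by apply: eq_bigr => j _; rewrite !linearP.
Qed.
HB.instance Definition _ :=
  GRing.isLinear.Build C zpoly zpoly _ laplacian laplacian_is_linear.

Lemma eulerl_is_linear : linear eulerl.
Proof.
move=> a f g; rewrite /eulerl scaler_sumr -big_split /=.
by apply: eq_bigr => j _; rewrite linearP /= mulrDr scalerAr.
Qed.
HB.instance Definition _ :=
  GRing.isLinear.Build C zpoly zpoly _ eulerl eulerl_is_linear.

Lemma eulerr_is_linear : linear eulerr.
Proof.
move=> a f g; rewrite /eulerr scaler_sumr -big_split /=.
by apply: eq_bigr => j _; rewrite linearP /= mulrDr scalerAr.
Qed.
HB.instance Definition _ :=
  GRing.isLinear.Build C zpoly zpoly _ eulerr eulerr_is_linear.

Lemma mderivXU n (i j : 'I_n) : mderiv i ('X_j : {mpoly C[n]}) = (i == j)%:R.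
Proof.
rewrite mderivX mnm1E eq_sym; case: eqVneq => [->|_]; last by rewrite scale0r.
by rewrite scale1r -[X in (X - _)%MM]add0m addmK mpolyX0.
Qed.

Lemma mderivl_zl i j : mderiv (lshift N i) (zl j) = (i == j)%:R.
Proof. by rewrite mderivXU (inj_eq (@lshift_inj _ _)). Qed.
Lemma mderivr_zr i j : mderiv (rshift N i) (zr j) = (i == j)%:R.
Proof. by rewrite mderivXU (inj_eq (@rshift_inj _ _)). Qed.
Lemma mderivl_zr i j : mderiv (lshift N i) (zr j) = 0.
Proof. by rewrite mderivXU eq_lrshift. Qed.
Lemma mderivr_zl i j : mderiv (rshift N i) (zl j) = 0.
Proof. by rewrite mderivXU eq_rlshift. Qed.

Lemma mderivl_sqnorm j : mderiv (lshift N j) r2 = zr j.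
Proof.
rewrite /r2 raddf_sum (bigD1 j) //= big1 => [|i ij]; rewrite mderivM mderivl_zl mderivl_zr.
  by rewrite eqxx mul1r mulr0 !addr0.
by rewrite eq_sym (negPf ij) mul0r mulr0 addr0.
Qed.

Lemma mderivr_sqnorm j : mderiv (rshift N j) r2 = zl j.
Proof.
rewrite /r2 raddf_sum (bigD1 j) //= big1 => [|i ij]; rewrite mderivM mderivr_zl mderivr_zr.
  by rewrite eqxx mulr1 mul0r add0r addr0.
by rewrite eq_sym (negPf ij) mul0r mulr0 addr0.
Qed.

(** The cross terms of the Leibniz rule are the two Euler operators, and each coordinate contributes
    one more [f] from the mixed second derivative of r². *)
Lemma laplacian_sqnormM f :
  Δ (r2 * f) = r2 * Δ f + (eulerl f + eulerr f + N%:R *: f).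
Proof.
have -> : N%:R *: f = \sum_(j < N) f.
  by rewrite sumr_const card_ord scaler_nat.
rewrite /laplacian /eulerl /eulerr mulr_sumr -!big_split /=.
apply: eq_bigr => j _; rewrite mderivM mderivr_sqnorm mderivD !mderivM.
by rewrite mderivl_sqnorm mderivl_zl eqxx /=; ring.
Qed.

Lemma eulerlM f g : eulerl (f * g) = eulerl f * g + f * eulerl g.
Proof.
rewrite /eulerl mulr_suml mulr_sumr -big_split /=.
by apply: eq_bigr => j _; rewrite mderivM; ring.
Qed.
Lemma eulerrM f g : eulerr (f * g) = eulerr f * g + f * eulerr g.
Proof.
rewrite /eulerr mulr_suml mulr_sumr -big_split /=.
by apply: eq_bigr => j _; rewrite mderivM; ring.
Qed.

Lemma eulerl_sqnorm : eulerl r2 = r2.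
Proof. by rewrite /eulerl; under eq_bigr do rewrite mderivl_sqnorm. Qed.
Lemma eulerr_sqnorm : eulerr r2 = r2.
Proof.
by rewrite /eulerr /r2; apply: eq_bigr => j _; rewrite mderivr_sqnorm mulrC.
Qed.

Lemma eulerl_mderivl i f :
  eulerl (mderiv (lshift N i) f) = mderiv (lshift N i) (eulerl f) - mderiv (lshift N i) f.
Proof.
apply/eqP; rewrite eq_sym subr_eq; apply/eqP.
rewrite /eulerl raddf_sum /= (bigD1 i) //= [in RHS](bigD1 i) //=.
rewrite mderivM mderivl_zl eqxx mul1r [RHS]addrC addrA; congr (_ + _).
apply: eq_bigr => j ji; rewrite mderivM mderivl_zl eq_sym (negPf ji) mul0r add0r.
by rewrite mderiv_comm.
Qed.

Lemma eulerl_mderivr i f :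
  eulerl (mderiv (rshift N i) f) = mderiv (rshift N i) (eulerl f).
Proof.
rewrite /eulerl raddf_sum /=; apply: eq_bigr => j _.
by rewrite mderivM mderivr_zl mul0r add0r mderiv_comm.
Qed.

Lemma eulerr_mderivl i f :
  eulerr (mderiv (lshift N i) f) = mderiv (lshift N i) (eulerr f).
Proof.
rewrite /eulerr raddf_sum /=; apply: eq_bigr => j _.
by rewrite mderivM mderivl_zr mul0r add0r mderiv_comm.
Qed.

Lemma eulerr_mderivr i f :
  eulerr (mderiv (rshift N i) f) = mderiv (rshift N i) (eulerr f) - mderiv (rshift N i) f.
Proof.
apply/eqP; rewrite eq_sym subr_eq; apply/eqP.
rewrite /eulerr raddf_sum /= (bigD1 i) //= [in RHS](bigD1 i) //=.
rewrite mderivM mderivr_zr eqxx mul1r [RHS]addrC addrA; congr (_ + _).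
apply: eq_bigr => j ji; rewrite mderivM mderivr_zr eq_sym (negPf ji) mul0r add0r.
by rewrite mderiv_comm.
Qed.

Lemma eulerl_laplacian f : eulerl (Δ f) = Δ (eulerl f) - Δ f.
Proof.
rewrite /laplacian raddf_sum -sumrB /=; apply: eq_bigr => j _.
by rewrite eulerl_mderivl eulerl_mderivr.
Qed.

Lemma eulerr_laplacian f : eulerr (Δ f) = Δ (eulerr f) - Δ f.
Proof.
rewrite /laplacian raddf_sum -sumrB /=; apply: eq_bigr => j _.
by rewrite eulerr_mderivl eulerr_mderivr raddfB.
Qed.

(** The eigenvalues are in [C], not in [nat], so that [Δ] lowers them by 1 without truncation; a
    negative one forces [f = 0] ([bidegree_eq0]). *)
Definition bidegree x y f := eulerl f = x *: f /\ eulerr f = y *: f.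

Lemma bidegree_laplacian x y f :
  bidegree x y f -> bidegree (x - 1) (y - 1) (Δ f).
Proof.
case=> fx fy; split; [rewrite eulerl_laplacian fx|rewrite eulerr_laplacian fy];
  by rewrite linearZ scalerBl scale1r.
Qed.

Lemma bidegree_sqnorm x y f :
  bidegree x y f -> bidegree (x + 1) (y + 1) (r2 * f).
Proof.
case=> fx fy; split.
  by rewrite eulerlM eulerl_sqnorm fx scalerDl scale1r -scalerAr addrC.
by rewrite eulerrM eulerr_sqnorm fy scalerDl scale1r -scalerAr addrC.
Qed.

Lemma bidegreeD x y f g : bidegree x y f -> bidegree x y g -> bidegree x y (f + g).
Proof. by move=> [fx fy] [gx gy]; split; rewrite raddfD scalerDr /= ?fx ?fy ?gx ?gy. Qed.

Lemma bidegreeZ x y a f : bidegree x y f -> bidegree x y (a *: f).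
Proof. by move=> [fx fy]; split; rewrite linearZ /= ?fx ?fy !scalerA mulrC. Qed.

Lemma bidegreeB x y f g : bidegree x y f -> bidegree x y g -> bidegree x y (f - g).
Proof. by move=> hf hg; rewrite -scaleN1r; apply: bidegreeD => //; apply: bidegreeZ. Qed.

Lemma bidegree0 x y : bidegree x y 0.
Proof. by split; rewrite raddf0 scaler0. Qed.

Lemma laplacian_sqnorm_bidegree x y f : bidegree x y f ->
  Δ (r2 * f) = r2 * Δ f + (x + y + N%:R) *: f.
Proof. by case=> fx fy; rewrite laplacian_sqnormM fx fy !scalerDl. Qed.

Definition mdegl (m : 'X_{1..N + N}) := (\sum_j m (lshift N j))%N.
Definition mdegr (m : 'X_{1..N + N}) := (\sum_j m (rshift N j))%N.

Lemma mulX_mderivX n (i : 'I_n) (m : 'X_{1..n}) :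
  'X_i * mderiv i 'X_[m] = (m i)%:R *: 'X_[m] :> {mpoly C[n]}.
Proof.
rewrite mderivX; case: (eqVneq (m i) 0%N) => [->|mi]; first by rewrite !scale0r mulr0.
rewrite -scalerAr -mpolyXD addmC submK //.
by rewrite lep1mP.
Qed.

Lemma bidegreeX m : bidegree (mdegl m)%:R (mdegr m)%:R 'X_[m].
Proof.
have El j : zl j * mderiv (lshift N j) 'X_[m] = (m (lshift N j))%:R *: 'X_[m].
  exact: mulX_mderivX.
have Er j : zr j * mderiv (rshift N j) 'X_[m] = (m (rshift N j))%:R *: 'X_[m].
  exact: mulX_mderivX.
split.
  by rewrite /eulerl (eq_bigr _ (fun j _ => El j)) -scaler_suml natr_sum.
by rewrite /eulerr (eq_bigr _ (fun j _ => Er j)) -scaler_suml natr_sum.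
Qed.

Lemma mcoeff_eulerl f m : (eulerl f)@_m = (mdegl m)%:R * f@_m.
Proof.
elim/mpolyind: f => [|c k p _ _ IH].
  by rewrite (raddf0 eulerl) mcoeff0 mulr0.
rewrite (linearD eulerl) (linearZ_LR eulerl) /= (bidegreeX k).1 !mcoeffD !mcoeffZ IH mcoeffX.
by case: eqVneq => [->|_] /=; ring.
Qed.

Lemma mcoeff_eulerr f m : (eulerr f)@_m = (mdegr m)%:R * f@_m.
Proof.
elim/mpolyind: f => [|c k p _ _ IH].
  by rewrite (raddf0 eulerr) mcoeff0 mulr0.
rewrite (linearD eulerr) (linearZ_LR eulerr) /= (bidegreeX k).2 !mcoeffD !mcoeffZ IH mcoeffX.
by case: eqVneq => [->|_] /=; ring.
Qed.

Lemma bidegree_mcoeff x y f m : bidegree x y f -> f@_m != 0 ->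
  x = (mdegl m)%:R /\ y = (mdegr m)%:R.
Proof.
move=> [fx fy] fm; split; apply: (mulIf fm).
  by rewrite -mcoeff_eulerl fx mcoeffZ.
by rewrite -mcoeff_eulerr fy mcoeffZ.
Qed.

Lemma bidegree_eq0 x y f : bidegree x y f -> ~~ ((0 <= x) && (0 <= y)) -> f = 0.
Proof.
move=> fxy xy; apply/mpolyP => m; rewrite mcoeff0; apply/eqP.
apply: contraNT xy => fm; have [-> ->] := bidegree_mcoeff fxy fm.
by rewrite !ler0n.
Qed.

Lemma mdeg_mdeglr m : mdeg m = (mdegl m + mdegr m)%N.
Proof. by rewrite mdegE big_split_ord. Qed.

End Harmonic.

(** * The explicit harmonic projection on bihomogeneous polynomials *)

Module HarmonicProjection.
Section HarmonicProjection.
Import mpoly.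
Variables (C : numClosedFieldType) (N : nat).
Local Notation zpoly := {mpoly C[N + N]}.
Implicit Types (f g h : zpoly) (x y : C).
Local Notation "'Δ'" := (@laplacian C N).
Local Notation r2 := (@sqnorm_mpoly C N).

(* Inverts [r2 * Δ + s] on polynomials of total degree [e], by recursion on  *)
(* the order of nilpotency of [Δ].                                           *)
Fixpoint shifted_inverse (k s e : nat) f : zpoly :=
  if k is k'.+1 then
    s%:R^-1 *: (f - r2 * shifted_inverse k' (s + (e - 2) + N) (e - 2) (Δ f))
  else s%:R^-1 *: f.

Lemma shifted_inverse_is_linear k s e : linear (shifted_inverse k s e).
Proof.
elim: k s e => [|k IH] s e a f g /=.
  by rewrite scalerDr !scalerA mulrC.
rewrite (linearP Δ) IH mulrDr -scalerAr opprD addrACA -scalerBr.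
by rewrite scalerDr !scalerA mulrC.
Qed.
HB.instance Definition _ k s e := GRing.isLinear.Build C zpoly zpoly _
  (shifted_inverse k s e) (shifted_inverse_is_linear k s e).

Lemma bidegree_shifted_inverse k s e x y f :
  bidegree x y f -> bidegree x y (shifted_inverse k s e f).
Proof.
elim: k s e x y f => [|k IH] s e x y f fxy /=; apply: bidegreeZ => //.
apply: bidegreeB => //; rewrite -[x](subrK 1) -[y](subrK 1).
by apply: bidegree_sqnorm; apply: IH; exact: bidegree_laplacian.
Qed.

Lemma laplacian_low_degree x y f (e : nat) : bidegree x y f -> x + y = e%:R ->
  (e < 2)%N -> Δ f = 0.
Proof.
move=> fxy xye e2; apply: (bidegree_eq0 (bidegree_laplacian fxy)).
apply/negP => /andP[hx hy]; have : (0 : C) <= (x - 1) + (y - 1) by rewrite addr_ge0.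
have -> : x - 1 + (y - 1) = e%:R - 2%:R by rewrite -xye; ring.
by rewrite subr_ge0 ler_nat leqNgt e2.
Qed.

Lemma pred_degree x y (e : nat) : x + y = e%:R -> (2 <= e)%N ->
  x - 1 + (y - 1) = (e - 2)%:R.
Proof. by move=> xye e2; rewrite natrB // -xye; ring. Qed.

(** If [r2 * Δ g + s g = f] in degree [e], applying [Δ] shows that [Δ g] solves the same kind of
    equation for [Δ f], with shift [s + (e - 2) + N]. The recursion solves that equation and reads
    off [g]. Each level lowers the degree by 2, whence the bound on [e]. *)
Lemma shifted_inverseK k s e x y f : (0 < s)%N -> bidegree x y f ->
  x + y = e%:R -> (e < k.*2.+2)%N ->
  r2 * Δ (shifted_inverse k s e f) + s%:R *: shifted_inverse k s e f = f.
Proof.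
elim: k s e x y f => [|k IH] s e x y f s0 fxy xye ek.
  rewrite /= (linearZ_LR Δ) /= (laplacian_low_degree fxy xye) //.
  by rewrite scaler0 mulr0 add0r scalerA divff ?scale1r // pnatr_eq0 -lt0n.
have sN0 : s%:R != 0 :> C by rewrite pnatr_eq0 -lt0n.
have [e2|e2] := ltnP e 2.
  rewrite /= (laplacian_low_degree fxy xye) // linear0 mulr0 subr0.
  rewrite (linearZ_LR Δ) /= (laplacian_low_degree fxy xye) //.
  by rewrite scaler0 mulr0 add0r scalerA divff ?scale1r.
have Δxy := bidegree_laplacian fxy; have xye' := pred_degree xye e2.
rewrite /=; set h := shifted_inverse _ _ _ _.
have hxy : bidegree (x - 1) (y - 1) h by exact: bidegree_shifted_inverse.
have hE : r2 * Δ h + (s + (e - 2) + N)%:R *: h = Δ f.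
  by apply: (IH _ _ (x - 1) (y - 1)) => //; lia.
rewrite scalerA divff // scale1r (linearZ_LR Δ) /= (linearB Δ) /=.
rewrite (laplacian_sqnorm_bidegree hxy) xye' -natrD.
(* The equation satisfied by [h] says exactly that [h] is the Laplacian of the constructed
   solution. *)
have -> : Δ f - (r2 * Δ h + (e - 2 + N)%:R *: h) = s%:R *: h.
  by rewrite -hE -addnA [(s + _)%:R]natrD scalerDl; ring.
by rewrite scalerA mulVf // scale1r; ring.
Qed.

(** Descent on the degree: [Δ g] satisfies the same equation in degree [e - 2] with a larger shift,
    so [Δ g = 0] and only [s g = 0] remains. *)
Lemma shifted_laplacian_eq0 (s e : nat) x y g : (0 < s)%N -> bidegree x y g ->
  x + y = e%:R -> r2 * Δ g + s%:R *: g = 0 -> g = 0.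
Proof.
elim/ltn_ind: e s x y g => e IH s x y g s0 gxy xye eq0.
have sN0 : s%:R != 0 :> C by rewrite pnatr_eq0 -lt0n.
suff Δg0 : Δ g = 0.
  move: eq0; rewrite Δg0 mulr0 add0r => /eqP.
  by rewrite mscalerI (negPf sN0) => /eqP.
have [e2|e2] := ltnP e 2; first exact: laplacian_low_degree gxy xye e2.
have Δxy := bidegree_laplacian gxy; have xye' := pred_degree xye e2.
apply: (IH _ _ (s + (e - 2 + N))%N _ _ _ _ Δxy xye'); [lia|lia|].
have := congr1 Δ eq0.
rewrite linear0 (linearD Δ) (linearZ_LR Δ) /= (laplacian_sqnorm_bidegree Δxy) xye' -natrD.
by rewrite -addrA -scalerDl -natrD addnC.
Qed.

Lemma laplacian_sqnorm_eq0 (e : nat) x y g : (0 < N)%N -> bidegree x y g ->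
  x + y = e%:R -> Δ (r2 * g) = 0 -> g = 0.
Proof.
move=> N0 gxy xye; rewrite (laplacian_sqnorm_bidegree gxy) xye -natrD.
by apply: (shifted_laplacian_eq0 _ gxy xye); rewrite addn_gt0 N0 orbT.
Qed.

(** In degree [d - 2] the operator [q |-> Δ (r2 * q)] is [r2 * Δ + (d - 2 + N)], so this is the
    solution of [Δ (r2 * q) = Δ f] for [f] of degree [d]. The truncated subtraction is harmless:
    [Δ f = 0] when [d < 2]. *)
Definition harmonic_quotient d f := shifted_inverse d (d - 2 + N) (d - 2) (Δ f).
Definition harmonic_part d f := f - r2 * harmonic_quotient d f.

Lemma harmonic_part_is_linear d : linear (harmonic_part d).
Proof.
move=> a f g; rewrite /harmonic_part /harmonic_quotient (linearP Δ) linearP /=.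
by rewrite mulrDr -scalerAr opprD addrACA scalerBr.
Qed.
HB.instance Definition _ d := GRing.isLinear.Build C zpoly zpoly _
  (harmonic_part d) (harmonic_part_is_linear d).

Lemma bidegree_harmonic_quotient d x y f :
  bidegree x y f -> bidegree (x - 1) (y - 1) (harmonic_quotient d f).
Proof. by move=> fxy; apply: bidegree_shifted_inverse; apply: bidegree_laplacian. Qed.

Lemma bidegree_harmonic_part d x y f :
  bidegree x y f -> bidegree x y (harmonic_part d f).
Proof.
move=> fxy; apply: bidegreeB => //; rewrite -[x](subrK 1) -[y](subrK 1).
by apply: bidegree_sqnorm; apply: bidegree_harmonic_quotient.
Qed.

Lemma harmonic_part_id d f : Δ f = 0 -> harmonic_part d f = f.
Proof.
by move=> f0; rewrite /harmonic_part /harmonic_quotient f0 linear0 mulr0 subr0.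
Qed.

Hypothesis N0 : (0 < N)%N.

Lemma laplacian_harmonic_part d x y f :
  bidegree x y f -> x + y = d%:R -> Δ (harmonic_part d f) = 0.
Proof.
move=> fxy xyd; have [d2|d2] := ltnP d 2.
  have f0 := laplacian_low_degree fxy xyd d2.
  by rewrite (harmonic_part_id _ f0).
rewrite /harmonic_part (linearB Δ) /=.
rewrite (laplacian_sqnorm_bidegree (bidegree_harmonic_quotient d fxy)).
rewrite (pred_degree xyd d2) -natrD.
rewrite (@shifted_inverseK _ _ _ (x - 1) (y - 1)) ?subrr //.
- by rewrite addn_gt0 N0 orbT.
- exact: bidegree_laplacian.
- exact: pred_degree.
- lia.
Qed.

(** The polynomial [f] itself solves the equation defining the quotient of [r2 * f], and
    [shifted_laplacian_eq0] makes the solution unique. *)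
Lemma harmonic_part_sqnormM d x y f :
  bidegree x y f -> x + y = d%:R -> harmonic_part d.+2 (r2 * f) = 0.
Proof.
move=> fxy xyd; rewrite /harmonic_part.
suff -> : harmonic_quotient d.+2 (r2 * f) = f by rewrite subrr.
have dN0 : (0 < d + N)%N by rewrite addn_gt0 N0 orbT.
have qxy : bidegree x y (harmonic_quotient d.+2 (r2 * f)).
  by rewrite -[x](addrK 1) -[y](addrK 1); apply/bidegree_harmonic_quotient/bidegree_sqnorm.
apply/eqP; rewrite -subr_eq0; apply/eqP.
apply: (shifted_laplacian_eq0 dN0 _ xyd); first exact: bidegreeB.
rewrite (linearB Δ) /= mulrBr scalerBr addrACA -opprD.
rewrite /harmonic_quotient -[(d.+2 - 2)%N]/(d - 0)%N subn0.
rewrite (@shifted_inverseK _ _ _ x y) //; last lia.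
  by rewrite (laplacian_sqnorm_bidegree fxy) xyd natrD subrr.
by rewrite -[x](addrK 1) -[y](addrK 1); apply/bidegree_laplacian/bidegree_sqnorm.
Qed.

End HarmonicProjection.
End HarmonicProjection.
Import HarmonicProjection.

(** * Polynomial identities by restriction to lines *)

Section PolynomialIdentity.
Import mpoly.

Lemma poly_nat_eq0 (C : numDomainType) (p : {poly C}) :
  (forall t : nat, p.[t%:R] = 0) -> p = 0.
Proof.
move=> p0; apply/eqP; apply: contraT => pN0.
have := max_poly_roots pN0 (rs := [seq t%:R | t <- iota 0 (size p)]).
rewrite size_map size_iota ltnn; apply.
  by apply/allP => _ /mapP[t _ ->]; apply/rootP.
by rewrite map_inj_uniq ?iota_uniq // => a b /eqP; rewrite eqr_nat => /eqP.
Qed.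

Variables (C : numFieldType) (n : nat).
Implicit Types (f : {mpoly C[n]}) (v d : 'I_n -> C).

Definition mline v d f : {poly C} :=
  mmap (@polyC C) (fun k => (v k)%:P + d k *: 'X) f.
HB.instance Definition _ v d := GRing.RMorphism.copy (mline v d) (mline v d).

Lemma mlineC v d c : mline v d c%:MP = c%:P.
Proof. by rewrite /mline mmapC. Qed.

Lemma mlineX v d k : mline v d 'X_k = (v k)%:P + d k *: 'X.
Proof. by rewrite /mline mmapX mmap1U. Qed.

Lemma horner_mline v d f t : (mline v d f).[t] = meval (fun k => v k + d k * t) f.
Proof.
elim/mpoly_gen_ind: f => [c|k|f g Hf Hg|f g Hf Hg].
- by rewrite mlineC hornerC mevalC.
- by rewrite mlineX mevalXU !hornerE.
- by rewrite rmorphD hornerD mevalD Hf Hg.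
- by rewrite rmorphM hornerM mevalM Hf Hg.
Qed.

Lemma deriv_mline v d f :
  (mline v d f)^`() = \sum_k mline v d (mderiv k f) * (d k)%:P.
Proof.
pose D : {additive {mpoly C[n]} -> {poly C}} := @deriv C \o mline v d.
rewrite -[LHS]/(D f) (@mpoly_derivationE _ _ _ (mline v d) D).
- apply: eq_bigr => k _ /=.
  by rewrite mlineX derivD derivC add0r derivZ derivX alg_polyC.
- by move=> g h; rewrite /= rmorphM derivM addrC.
- by move=> c; rewrite /= mlineC derivC.
Qed.

(** Induction on the size: [f] vanishes on the lines in each coordinate direction, so its partial
    derivatives vanish everywhere and are zero by induction. In characteristic 0 this leaves a
    constant. *)
Lemma meval_eq0 f : (forall v, meval v f = 0) -> f = 0.
Proof.
have [k] := ubnP (msize f); elim: k f => // k IH f fk f0.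
have d0 i : mderiv i f = 0.
  have [c|f1] := leqP (msize f) 1; first by rewrite (msize1_polyC c) mderivC.
  apply: IH => [|v].
    apply: (@leq_trans (msize f)); last by rewrite -ltnS.
    rewrite -(prednK (ltnW f1)) ltnS [msize (mderiv i f)]msizeE.
    apply/bigmax_leqP_seq => m; rewrite mcoeff_msupp mcoeff_deriv => mN0 _.
    have := @msize_mdeg_lt _ _ f (m + U_(i))%MM.
    rewrite mcoeff_msupp mdegD mdeg1 addn1 -[X in (_ < X)%N](prednK (ltnW f1)) ltnS; apply.
    by apply: contraNN mN0 => /eqP ->; rewrite mul0rn.
  pose d (j : 'I_n) : C := (j == i)%:R.
  have l0 : mline v d f = 0.
    by apply: poly_nat_eq0 => t; rewrite horner_mline f0.
  have := congr1 (fun p => p^`().[0]) l0.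
  rewrite deriv_mline deriv0 horner0 horner_sum (bigD1 i) //= big1 => [|j ji].
    rewrite addr0 hornerM hornerC /d eqxx mulr1 horner_mline => <-.
    by apply: meval_eq => j; rewrite mulr0 addr0.
  by rewrite hornerM hornerC /d (negPf ji) mulr0.
have [c fc] : exists c, f = c%:MP.
  exists (f@_0%MM).
  apply/mpolyP => m; rewrite mcoeffC eq_sym; case: eqVneq => [->|mN0].
    by rewrite mulr1.
  have [i mi] : exists i, m i != 0%N.
    apply/existsP; apply: contraNT mN0; rewrite negb_exists => /forallP m0.
    by apply/eqP/mnmP => i; rewrite mnm0E; apply/esym/eqP; rewrite -[_ == _]negbK.
  have := congr1 (mcoeff (m - U_(i))%MM) (d0 i).
  rewrite mcoeff_deriv submK ?lep1mP // mcoeff0 mulr0 => /eqP.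
  by rewrite mulrn_eq0 /= => /eqP.
by have := f0 (fun=> 0); rewrite fc mevalC => ->; rewrite mpolyC0.
Qed.

End PolynomialIdentity.

(** * Unitary changes of variables *)

Module UnitarySubstitution.
Section UnitarySubstitution.
Import mpoly.
Variables (C : numClosedFieldType) (N : nat).
Local Notation zpoly := {mpoly C[N + N]}.
Implicit Types (f g h : zpoly) (x y a : C) (z w : 'cV[C]_N) (U : 'M[C]_N).
Local Notation "'Δ'" := (@laplacian C N).
Local Notation r2 := (@sqnorm_mpoly C N).

Definition conj_point z (k : 'I_(N + N)) : C :=
  match fintype.split k with inl j => z j ord0 | inr j => (z j ord0)^* end.

Lemma conj_pointl z j : conj_point z (lshift N j) = z j ord0.
Proof. by rewrite /conj_point (unsplitK (inl j)). Qed.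

Lemma conj_pointr z j : conj_point z (rshift N j) = (z j ord0)^*.
Proof. by rewrite /conj_point (unsplitK (inr j)). Qed.

(** The points [conj_point z] form a totally real subspace. Along [u + t w] the polynomial vanishes
    for natural [t], hence also for [t = 'i], and the points obtained in this way are all points of
    the doubled space. *)
Lemma zeval_eq0 f : (forall z, meval (conj_point z) f = 0) -> f = 0.
Proof.
move=> f0; apply: meval_eq0 => v.
pose a j := v (lshift N j); pose b j := v (rshift N j).
have l0 (u w : 'cV[C]_N) : mline (conj_point u) (conj_point w) f = 0.
  apply: poly_nat_eq0 => t; rewrite horner_mline -[RHS](f0 (u + t%:R *: w)).
  apply: meval_eq => k; have [j ->|j ->] := split_ordP k.
    by rewrite !conj_pointl !mxE mulrC.
  by rewrite !conj_pointr !mxE rmorphD rmorphM /= conjC_nat mulrC.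
(* These are chosen so that [u + 'i w] is [a], while ['i] times the conjugate of [w] added to the
   conjugate of [u] is [b]. *)
pose u : 'cV[C]_N := \col_j ((a j + (b j)^* ) / 2%:R).
pose w : 'cV[C]_N := \col_j ((a j - (b j)^* ) / (2%:R * 'i)).
have := congr1 (fun p => p.['i]) (l0 u w).
rewrite horner_mline horner0 => E; rewrite -[RHS]E.
have i0 : 'i != 0 :> C by rewrite neq0Ci.
have n2 : 2%:R != 0 :> C by rewrite pnatr_eq0.
apply: meval_eq => k; have [j ->|j ->] := split_ordP k.
  by rewrite !conj_pointl !mxE /a /b; field; rewrite i0.
rewrite !conj_pointr !mxE.
rewrite (fmorph_div Num.conj) rmorphD (fmorph_div Num.conj) rmorphB rmorphM /=.
by rewrite !conjCK !conjC_nat conjCi /b; field; rewrite i0.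
Qed.

Definition usubst U f : zpoly :=
  comp_mpoly [tuple match fintype.split k with
                    | inl j => \sum_i U j i *: zl C i
                    | inr j => \sum_i (U j i)^* *: zr C i
                    end | k < N + N] f.
HB.instance Definition _ U := GRing.LRMorphism.copy (usubst U) (usubst U).

Lemma usubst_zl U j : usubst U (zl C j) = \sum_i U j i *: zl C i.
Proof. by rewrite /usubst comp_mpolyXU -tnth_nth tnth_mktuple (unsplitK (inl j)). Qed.

Lemma usubst_zr U j : usubst U (zr C j) = \sum_i (U j i)^* *: zr C i.
Proof. by rewrite /usubst comp_mpolyXU -tnth_nth tnth_mktuple (unsplitK (inr j)). Qed.

Lemma zeval_usubst U f z :
  meval (conj_point z) (usubst U f) = meval (conj_point (U *m z)) f.
Proof.
rewrite comp_mpoly_meval; apply: meval_eq => k.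
rewrite tnth_mktuple; have [j ->|j ->] := split_ordP k.
  rewrite conj_pointl raddf_sum mxE; apply: eq_bigr => i _.
  by rewrite /= mevalZ mevalXU conj_pointl.
rewrite conj_pointr raddf_sum mxE rmorph_sum; apply: eq_bigr => i _.
by rewrite /= mevalZ mevalXU conj_pointr rmorphM.
Qed.

Lemma zeval_sqnorm z : meval (conj_point z) r2 = \sum_j `|z j ord0| ^+ 2.
Proof.
rewrite /r2 raddf_sum /=; apply: eq_bigr => j _.
by rewrite mevalM !mevalXU conj_pointl conj_pointr normCK.
Qed.

Lemma mderivl_usubst U j f : mderiv (lshift N j) (usubst U f) =
  \sum_i U i j *: usubst U (mderiv (lshift N i) f).
Proof.
pose D : {additive zpoly -> zpoly} := @mderiv _ _ (lshift N j) \o usubst U.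
rewrite -[LHS]/(D f) (@mpoly_derivationE _ _ _ (usubst U) D) => [||c].
- have D0 i : D (zr C i) = 0.
    rewrite /D /= usubst_zr linear_sum big1 // => k _.
    by rewrite linearZ /= mderivl_zr scaler0.
  have D1 i : D (zl C i) = (U i j)%:MP.
    rewrite /D /= usubst_zl linear_sum (bigD1 j) //= big1 => [|k kj].
      by rewrite linearZ /= mderivl_zl eqxx addr0 -mul_mpolyC mulr1.
    by rewrite linearZ /= mderivl_zl eq_sym (negPf kj) scaler0.
  rewrite big_split_ord /= [X in _ + X]big1 ?addr0 => [|i _]; last first.
    by rewrite -[RHS](mulr0 (usubst U (mderiv (rshift N i) f))); congr (_ * _); exact: D0.
  apply: eq_bigr => i _; rewrite -mul_mpolyC mulrC; congr (_ * _); exact: D1.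
- by move=> g h; rewrite /= rmorphM mderivM addrC.
- by rewrite /= /usubst comp_mpolyC mderivC.
Qed.

Lemma mderivr_usubst U j f : mderiv (rshift N j) (usubst U f) =
  \sum_i (U i j)^* *: usubst U (mderiv (rshift N i) f).
Proof.
pose D : {additive zpoly -> zpoly} := @mderiv _ _ (rshift N j) \o usubst U.
rewrite -[LHS]/(D f) (@mpoly_derivationE _ _ _ (usubst U) D) => [||c].
- have D0 i : D (zl C i) = 0.
    rewrite /D /= usubst_zl linear_sum big1 // => k _.
    by rewrite linearZ /= mderivr_zl scaler0.
  have D1 i : D (zr C i) = ((U i j)^*)%:MP.
    rewrite /D /= usubst_zr linear_sum (bigD1 j) //= big1 => [|k kj].
      by rewrite linearZ /= mderivr_zr eqxx addr0 -mul_mpolyC mulr1.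
    by rewrite linearZ /= mderivr_zr eq_sym (negPf kj) scaler0.
  rewrite big_split_ord /= [X in X + _]big1 ?add0r => [|i _]; last first.
    by rewrite -[RHS](mulr0 (usubst U (mderiv (lshift N i) f))); congr (_ * _); exact: D0.
  apply: eq_bigr => i _; rewrite -mul_mpolyC mulrC; congr (_ * _); exact: D1.
- by move=> g h; rewrite /= rmorphM mderivM addrC.
- by rewrite /= /usubst comp_mpolyC mderivC.
Qed.

Lemma unitary_rows U : U \is unitarymx ->
  forall i k, \sum_j U i j * (U k j)^* = (i == k)%:R.
Proof.
move=> /unitarymxP UU i k; have := congr1 (fun A : 'M_N => A i k) UU.
by rewrite !mxE => <-; apply: eq_bigr => j _; rewrite !mxE.
Qed.

(** By the chain rule the mixed second derivatives occur with the inner products of the rows of [U]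
    as coefficients; orthonormality leaves the diagonal ones. *)
Lemma laplacian_usubst U f : U \is unitarymx -> Δ (usubst U f) = usubst U (Δ f).
Proof.
move=> Uu; have key i k (g : zpoly) :
    \sum_j (U i j)^* *: (U k j *: g) = (k == i)%:R *: g.
  rewrite (eq_bigr (fun j => (U k j * (U i j)^* ) *: g)) => [|j _].
    by rewrite -scaler_suml unitary_rows.
  by rewrite scalerA mulrC.
rewrite /laplacian [in RHS]raddf_sum /=.
under eq_bigr do rewrite mderivr_usubst raddf_sum /=.
rewrite exchange_big /=; apply: eq_bigr => i _.
under eq_bigr do rewrite mderivZ mderivl_usubst scaler_sumr.
rewrite exchange_big /= (bigD1 i) //= key eqxx scale1r.
rewrite [X in _ + X]big1 ?addr0 // => k ki.
by rewrite key (negPf ki) scale0r.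
Qed.

Lemma sqnorm_usubst U : U \is unitarymx -> usubst U r2 = r2.
Proof.
move=> Uu; apply/eqP; rewrite -subr_eq0; apply/eqP; apply: zeval_eq0 => z.
rewrite mevalB zeval_usubst !zeval_sqnorm.
have E (v : 'cV[C]_N) : \sum_j `|v j ord0| ^+ 2 = (map_mx Num.conj v^T *m v) ord0 ord0.
  by rewrite mxE; apply: eq_bigr => j _; rewrite !mxE normCK mulrC.
rewrite !E trmx_mul map_mxM -mulmxA (mulmxA _ U).
by have /unitarymxP/mulmx1C -> := Uu; rewrite mul1mx subrr.
Qed.

(** The harmonic part is a formula in [Δ] and multiplication by r², both of which commute with
    unitary substitutions. *)
Lemma harmonic_part_usubst U d f : U \is unitarymx ->
  harmonic_part d (usubst U f) = usubst U (harmonic_part d f).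
Proof.
move=> Uu; have shifted k s e g :
    shifted_inverse k s e (usubst U g) = usubst U (shifted_inverse k s e g).
  elim: k s e g => [|k IH] s e g /=; first by rewrite (linearZ_LR (usubst U)).
  rewrite laplacian_usubst // IH (linearZ_LR (usubst U)) /= (rmorphB (usubst U)) /=.
  by rewrite (rmorphM (usubst U)) /= sqnorm_usubst.
rewrite /harmonic_part /harmonic_quotient laplacian_usubst // shifted.
by rewrite (rmorphB (usubst U)) (rmorphM (usubst U)) /= sqnorm_usubst.
Qed.

End UnitarySubstitution.
End UnitarySubstitution.
Import UnitarySubstitution.

(** * Bidegree and the action of scalars and diagonal matrices *)

Section Bidegree.
Import mpoly.
Variables (C : numClosedFieldType) (N : nat).
Local Notation zpoly := {mpoly C[N + N]}.
Implicit Types (f g h : zpoly) (a u : C) (z w : 'cV[C]_N) (U V : 'M[C]_N) (m : 'X_{1..N + N}).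

(** If [a < b], a root of order [b - a] of -1 lies on the circle and separates the two powers. *)
Lemma circle_exponents (a b : nat) :
  (forall u : C, u * u^* = 1 -> u ^+ a = u ^+ b) -> a = b.
Proof.
wlog ab : a b / (a <= b)%N => [H|] ucirc.
  have [|/ltnW] := leqP a b; first by move=> /H; apply.
  by move=> /H ba; apply/esym/ba => u /ucirc.
apply/eqP; rewrite eqn_leq ab leqNgt /=; apply/negP => ltab.
have k0 : (0 < b - a)%N by rewrite subn_gt0.
pose u : C := (b - a).-root (-1).
have uk : u ^+ (b - a) = -1 by rewrite rootCK.
have u1 : `|u| = 1.
  by apply/eqP; rewrite -(@pexpr_eq1 _ _ (b - a)) // -normrX uk normrN1.
have uN0 : u != 0 by rewrite -normr_eq0 u1 oner_eq0.
have := ucirc u; rewrite -normCK u1 expr1n => /(_ erefl).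
rewrite -(subnK ab) exprD uk => /eqP; rewrite -subr_eq0 mulN1r opprK -mulr2n.
by rewrite mulrn_eq0 expf_eq0 (negPf uN0) andbF.
Qed.

Lemma usubstM U V f : usubst U (usubst V f) = usubst (V *m U) f.
Proof.
apply/eqP; rewrite -subr_eq0; apply/eqP; apply: zeval_eq0 => z.
by rewrite mevalB !zeval_usubst mulmxA subrr.
Qed.

Lemma usubstX U m : usubst U 'X_[m] =
  (\prod_j usubst U (zl C j) ^+ m (lshift N j)) *
  (\prod_j usubst U (zr C j) ^+ m (rshift N j)).
Proof.
rewrite mpolyXE_id (rmorph_prod (usubst U)) big_split_ord /=.
by congr (_ * _); apply: eq_bigr => j _; rewrite rmorphXn.
Qed.

Lemma usubst_diagX (d : 'rV[C]_N) m : usubst (diag_mx d) 'X_[m] =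
  (\prod_j (d ord0 j ^+ m (lshift N j) * (d ord0 j)^* ^+ m (rshift N j))) *: 'X_[m].
Proof.
have El j : usubst (diag_mx d) (zl C j) = d ord0 j *: zl C j.
  rewrite usubst_zl (bigD1 j) //= big1 => [|i ij].
    by rewrite addr0 mxE eqxx mulr1n.
  by rewrite mxE eq_sym (negPf ij) scale0r.
have Er j : usubst (diag_mx d) (zr C j) = (d ord0 j)^* *: zr C j.
  rewrite usubst_zr (bigD1 j) //= big1 => [|i ij].
    by rewrite addr0 mxE eqxx mulr1n.
  by rewrite mxE eq_sym (negPf ij) conjC0 scale0r.
rewrite usubstX -mul_mpolyC rmorph_prod -big_split /= mpolyXE_id big_split_ord /= -!big_split /=.
apply: eq_bigr => j _; rewrite El Er !exprZn -!mul_mpolyC !rmorphM /=.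
by rewrite -/(zl C j) -/(zr C j); ring.
Qed.

Lemma usubst_scalarX a m :
  usubst a%:M 'X_[m] = (a ^+ mdegl m * a^* ^+ mdegr m) *: 'X_[m].
Proof.
rewrite -diag_const_mx usubst_diagX; congr (_ *: _).
rewrite (eq_bigr (fun j => a ^+ m (lshift N j) * a^* ^+ m (rshift N j))).
  by rewrite big_split /= /mdegl /mdegr !expr_sum.
by move=> j _; rewrite mxE.
Qed.

Lemma mcoeff_usubst_scalar a f m :
  (usubst a%:M f)@_m = (a ^+ mdegl m * a^* ^+ mdegr m) * f@_m.
Proof.
elim/mpolyind: f => [|c k p _ _ IH].
  by rewrite (raddf0 (usubst _)) mcoeff0 mulr0.
rewrite (linearD (usubst _)) (linearZ_LR (usubst _)) /= usubst_scalarX.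
rewrite !mcoeffD !mcoeffZ IH mcoeffX.
by case: eqVneq => [->|_] /=; ring.
Qed.

(** Scalars act diagonally on monomials, so each monomial of [f] scales as [f] does. The scalar 2
    then determines the sum of its two degrees and the scalars of modulus 1 their difference. *)
Lemma bihomogeneous_bidegree (p q : nat) f :
  (forall a z, meval (conj_point (a *: z)) f = a ^+ p * a^* ^+ q * meval (conj_point z) f) ->
  bidegree p%:R q%:R f.
Proof.
move=> fpq; suff degf m : f@_m != 0 -> mdegl m = p /\ mdegr m = q.
  split; apply/mpolyP => m; rewrite ?mcoeff_eulerl ?mcoeff_eulerr mcoeffZ;
  by have [->|/degf[lm rm]] := eqVneq (f@_m) 0; rewrite ?mulr0 ?lm ?rm.
move=> fm; have E a : a ^+ mdegl m * a^* ^+ mdegr m = a ^+ p * a^* ^+ q.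
  apply: (mulIf fm); rewrite -mcoeff_usubst_scalar -mcoeffZ; congr (_@__).
  apply/eqP; rewrite -subr_eq0; apply/eqP; apply: zeval_eq0 => z.
  by rewrite mevalB zeval_usubst mul_scalar_mx fpq mevalZ subrr.
have sumE : (mdegl m + mdegr m = p + q)%N.
  have := E 2%:R; rewrite conjC_nat -!exprD -!natrX => /eqP.
  by rewrite eqr_nat eqn_exp2l // => /eqP.
have difE : (mdegl m + q = p + mdegr m)%N.
  apply: circle_exponents => u uu; have := congr1 (fun x => x * (u ^+ mdegr m * u ^+ q)) (E u).
  have uk k : u ^+ k * u^* ^+ k = 1 by rewrite -exprMn uu expr1n.
  rewrite !exprD => H; transitivity (u ^+ mdegl m * u^* ^+ mdegr m * (u ^+ mdegr m * u ^+ q)).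
    by rewrite -[LHS]mul1r -(uk (mdegr m)); ring.
  by rewrite H -[RHS]mul1r -(uk q); ring.
by split; lia.
Qed.

Lemma bidegree_bihomogeneous (p q : nat) f a z : bidegree p%:R q%:R f ->
  meval (conj_point (a *: z)) f = a ^+ p * a^* ^+ q * meval (conj_point z) f.
Proof.
move=> fpq; rewrite -mul_scalar_mx -zeval_usubst -mevalZ; congr (meval _ _).
apply/mpolyP => m; rewrite mcoeff_usubst_scalar mcoeffZ.
have [->|fm] := eqVneq (f@_m) 0; first by rewrite !mulr0.
have [/eqP px /eqP qx] := bidegree_mcoeff fpq fm.
by move: px qx; rewrite !eqr_nat => /eqP -> /eqP ->.
Qed.

End Bidegree.

(** * Functionals invariant under the stabilizer of a point *)

Section PlaneRotation.
Variables (C : numClosedFieldType) (n : nat).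
Local Notation N := n.+1.
Variables (i j : 'I_N).
Hypothesis ij : i != j.

Let J : 'M[C]_N := delta_mx j i - delta_mx i j.
Let P : 'M[C]_N := delta_mx i i + delta_mx j j.

(* The rotation of angle [2 arctan t], scaled by [1 + t ^ 2] to make it      *)
(* polynomial in [t].                                                        *)
Definition plane_rotation (t : C) : 'M[C]_N :=
  1%:M + (t *+ 2) *: J + t ^+ 2 *: (1%:M - 2%:R *: P).

(** [P] projects onto the plane and [J] is a quarter turn in it, so [J] squared is [- P]. The matrix
    is [(1 - t^2) + 2 t J] on the plane and [1 + t^2] on its complement. *)
Lemma plane_rotation_mul (t : C) :
  plane_rotation t *m (plane_rotation t)^T = ((1 + t ^+ 2) ^+ 2)%:M.
Proof.
have ji : (j == i) = false by rewrite eq_sym (negPf ij).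
have JT : J^T = - J by rewrite /J raddfB /= !trmx_delta opprB.
have PT : P^T = P by rewrite /P raddfD /= !trmx_delta.
have mulE := (mulmxDl, mulmxDr, mulmxN, mulNmx, mul_delta_mx_cond, ji, negPf ij, eqxx).
have JJ : J *m J = - P.
  by rewrite /J /P !mulE /= ?mulr0n ?mulr1n; apply/matrixP => a b; rewrite !mxE; ring.
have JP : J *m P = J.
  by rewrite /J /P !mulE /= ?mulr0n ?mulr1n; apply/matrixP => a b; rewrite !mxE; ring.
have PJ : P *m J = J.
  by rewrite /J /P !mulE /= ?mulr0n ?mulr1n; apply/matrixP => a b; rewrite !mxE; ring.
have PP : P *m P = P.
  by rewrite /P !mulE /= ?mulr0n ?mulr1n; apply/matrixP => a b; rewrite !mxE; ring.
rewrite /plane_rotation; move: {mulE} J P JT PT JJ JP PJ PP => A B AT BT AA AB BA BB.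
rewrite !(linearD, linearN, linearZ) /= !(linearD, linearN, linearZ) /= AT BT !trmx1 scalerN.
rewrite !(mulmxDl, mulmxDr, mulmxBl, mulmxBr, mulmxN, mulNmx, =^~ scalemxAl, =^~ scalemxAr).
rewrite !(mul1mx, mulmx1, AA, AB, BA, BB).
by apply/matrixP => a b; rewrite !mxE; case: (a == b) => /=; ring.
Qed.

Lemma plane_rotation_real (t : nat) : map_mx Num.conj (plane_rotation t%:R) = plane_rotation t%:R.
Proof.
apply/matrixP => a b; rewrite !mxE.
by rewrite !(rmorphD, rmorphM, rmorphB, rmorphN, rmorphXn, rmorphMn, rmorph1).
Qed.

Lemma plane_rotation_fix (t : C) : i != ord0 -> j != ord0 ->
  plane_rotation t *m delta_mx ord0 ord0 = (1 + t ^+ 2) *: delta_mx ord0 ord0 :> 'cV[C]_N.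
Proof.
move=> i0 j0; rewrite /plane_rotation /J /P.
rewrite !(mulmxDl, mulmxBl, mulNmx, =^~ scalemxAl, mul1mx, mul_delta_mx_cond).
by rewrite (negPf i0) (negPf j0) !mulr0n !(subr0, addr0, scaler0) scalerDl scale1r.
Qed.

End PlaneRotation.

Module QuadraticCurve.
Section QuadraticCurve.
Import mpoly.
Variables (n : nat) (C : numFieldType) (Z : comNzRingType).
Variables (iota : {rmorphism C -> Z}) (mu : {additive Z -> C}).
Variables (P0 P1 P2 : 'I_n -> Z).
Implicit Types (f : {mpoly C[n]}).

Let curve : {mpoly C[n]} -> {poly Z} := mmap (@polyC Z \o iota)
  (fun k => (P0 k)%:P + P1 k *: 'X + P2 k *: 'X^2).
HB.instance Definition _ := GRing.RMorphism.copy curve curve.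

Let curveC c : curve c%:MP = (iota c)%:P.
Proof. by rewrite /curve mmapC. Qed.

Let curveX k : curve 'X_k = (P0 k)%:P + P1 k *: 'X + P2 k *: 'X^2.
Proof. by rewrite /curve mmapX mmap1U. Qed.

Let horner_curve (t : nat) f :
  (curve f).[t%:R] = mmap iota (fun k => P0 k + P1 k *+ t + P2 k *+ (t ^ 2)) f.
Proof.
pose s : {rmorphism {mpoly C[n]} -> Z} := horner_eval t%:R \o curve.
apply: (@mpoly_rmorph_eq _ _ _ s (mmap iota _)) => [c|k] /=.
  by rewrite /horner_eval curveC hornerC mmapC.
rewrite /horner_eval curveX mmapX mmap1U !hornerE /= !mulr_natr -mulrnA mulnn.
by [].
Qed.

(* Comparing the coefficients of [t] on both sides of the hypothesis.        *)
Lemma quadratic_curve_derivation f (d : nat) (v : C) :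
  (forall t : nat, mu (mmap iota (fun k => P0 k + P1 k *+ t + P2 k *+ (t ^ 2)) f) =
                   (1 + t%:R ^+ 2) ^+ d * v) ->
  mu (\sum_k mmap iota P0 (mderiv k f) * P1 k) = 0.
Proof.
move=> muf; have -> : \sum_k mmap iota P0 (mderiv k f) * P1 k = (curve f)`_1.
  have cC c : (curve c%:MP)`_1 = 0 by rewrite curveC coefC.
  have cX k : (curve 'X_k)`_1 = P1 k.
    by rewrite curveX !coefE /= ?(add0r, mulr1, mulr0, addr0).
  rewrite (coef1_rmorphE (c := curve) cC).
  apply: eq_bigr => k _; congr (_ * _); last exact: (esym (cX k)).
  apply: (etrans _ (esym (horner_curve 0 (mderiv k f)))).
  rewrite /mmap; apply: eq_bigr => m _; congr (_ * _); apply: mmap1_eq => l.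
  by rewrite exp0n // !mulr0n !addr0.
(* As [mu] is merely additive, it is applied to the coefficients of [p]. It commutes with
   multiplication by powers of a natural number [t], and natural values of [t] determine a
   polynomial. *)
set p := curve f; pose psi := \poly_(a < size p) mu p`_a.
have psiE : psi = (1 + 'X^2) ^+ d * v%:P.
  apply/eqP; rewrite -subr_eq0; apply/eqP; apply: poly_nat_eq0 => t.
  rewrite !hornerE -muf -horner_curve -/p horner_poly horner_coef raddf_sum /= -sumrB.
  apply: big1 => a _; apply/eqP; rewrite subr_eq0; apply/eqP.
  by rewrite -!natrX !mulr_natr raddfMn.
have -> : mu p`_1 = psi`_1.
  by rewrite coef_poly; case: ltnP => // ?; rewrite nth_default // raddf0.
(* [(1 + 'X^2) ^+ d] has no term of degree 1: its derivative vanishes at 0. *)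
rewrite psiE coefMC; apply/eqP; rewrite mulf_eq0; apply/orP; left.
have -> (q : {poly C}) : q`_1 = (q^`()).[0] by rewrite horner_coef0 coef_deriv mulr1n.
rewrite deriv_exp !derivE; move: (_ ^+ d.-1) => q.
by rewrite hornerMn hornerM !hornerE ?mul0r ?mul0rn.
Qed.

End QuadraticCurve.
End QuadraticCurve.
Import QuadraticCurve.

Section ZonalFunctional.
Import mpoly.
Variables (C : numClosedFieldType) (n : nat).
Local Notation N := n.+1.
Local Notation zpoly := {mpoly C[N + N]}.
Implicit Types (f g h : zpoly) (m : 'X_{1..N + N}) (U : 'M[C]_N).
Local Notation e0 := (delta_mx ord0 ord0 : 'cV[C]_N).

Variable mu : {scalar zpoly}.
Hypothesis mu_inv : forall U, U \is unitarymx -> U *m e0 = e0 ->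
  forall f, mu (usubst U f) = mu f.

(** The diagonal unitary with entry [u] at [i] and 1 elsewhere fixes the pole and multiplies the
    monomial by [u] to the difference of the two exponents. *)
Lemma zonal_unbalanced i m :
  i != ord0 -> m (lshift N i) != m (rshift N i) -> mu 'X_[m] = 0.
Proof.
move=> i0; apply: contraNeq => muN0; apply/eqP; apply: (@circle_exponents C) => u uu.
pose d : 'rV[C]_N := \row_a (if a == i then u else 1).
have Ud : diag_mx d \is unitarymx.
  apply/unitarymxP; rewrite tr_diag_mx map_diag_mx mulmx_diag -diag_const_mx.
  congr diag_mx; apply/rowP => a; rewrite !mxE; case: eqP => _ //.
  by rewrite rmorph1 mulr1.
have de0 : diag_mx d *m e0 = e0.
  apply/matrixP => a b; rewrite mul_diag_mx !mxE.
  by have [->|a0] := eqVneq a ord0; [rewrite eq_sym (negPf i0) mul1r|rewrite mulr0].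
have := mu_inv Ud de0 'X_[m]; rewrite usubst_diagX linearZ /=.
rewrite (bigD1 i) //= big1 ?mulr1 => [|a ai]; last first.
  by rewrite mxE (negPf ai) rmorph1 !expr1n mulr1.
rewrite mxE eqxx -[in RHS](mul1r (mu _)) => /(mulIf muN0) E.
rewrite -[LHS]mulr1 -(expr1n _ (m (rshift N i))) -uu exprMn mulrCA.
by rewrite E mulr1.
Qed.

Variables i j : 'I_N.
Hypotheses (ij : i != j) (i0 : i != ord0) (j0 : j != ord0).

Let A : 'M[C]_N := (delta_mx j i - delta_mx i j) *+ 2.
Let B : 'M[C]_N := 1%:M - 2%:R *: (delta_mx i i + delta_mx j j).

Let rotE (t : C) : plane_rotation i j t = 1%:M + t *: A + t ^+ 2 *: B.
Proof. by rewrite /plane_rotation -[(t *+ 2) *: _]scalerMnl scalerMnr. Qed.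

Let delta_real (a b : 'I_N) : map_mx Num.conj (delta_mx a b : 'M[C]_N) = delta_mx a b.
Proof. by rewrite map_delta_mx. Qed.

Let A_real : map_mx Num.conj A = A.
Proof. by rewrite /A mulr2n map_mxD map_mxB !delta_real. Qed.

Let B_real : map_mx Num.conj B = B.
Proof. by rewrite /B map_mxB map_mx1 map_mxZ map_mxD !delta_real /= conjC_nat. Qed.

(** Dividing the matrix by [1 + t^2] makes it unitary and lets it fix the pole; homogeneity of the
    monomial restores the factor. *)
Let rotation_mu (t : nat) m :
  mu (usubst (plane_rotation i j t%:R) 'X_[m]) = (1 + t%:R ^+ 2) ^+ mdeg m * mu 'X_[m].
Proof.
set W := plane_rotation _ _ _.
set c : C := 1 + _; have cN0 : c != 0 by rewrite /c -natrX -(natrD _ 1) pnatr_eq0.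
have c_real : c^* = c by rewrite /c rmorphD rmorphXn rmorph1 /= conjC_nat.
have -> : W = c%:M *m (c^-1 *: W).
  by rewrite mul_scalar_mx scalerA divff // scale1r.
rewrite -usubstM usubst_scalarX c_real -exprD -mdeg_mdeglr.
rewrite (linearZ_LR (usubst _)) linearZ /= mu_inv //.
  apply/unitarymxP; rewrite linearZ /= map_mxZ -scalemxAl -scalemxAr /=.
  rewrite fmorphV /= c_real -map_trmx plane_rotation_real plane_rotation_mul //.
  rewrite -/c scalerA scale_scalar_mx -invfM -expr2 mulVf //.
  by rewrite expf_neq0.
by rewrite -scalemxAl plane_rotation_fix // scalerA mulVf // scale1r.
Qed.

(** The same matrix acts on both halves of the variables, without conjugation, because it is used
    for the real matrices [A] and [B]. *)
Let lin_form (M : 'M[C]_N) (k : 'I_(N + N)) : zpoly :=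
  match fintype.split k with
  | inl a => \sum_b M a b *: zl C b
  | inr a => \sum_b M a b *: zr C b
  end.

Let lin_forml M a : lin_form M (lshift N a) = \sum_b M a b *: zl C b.
Proof. by rewrite /lin_form (unsplitK (inl a)). Qed.

Let lin_formr M a : lin_form M (rshift N a) = \sum_b M a b *: zr C b.
Proof. by rewrite /lin_form (unsplitK (inr a)). Qed.

Let lin_form1 k : lin_form 1%:M k = 'X_k.
Proof.
have [a ->|a ->] := split_ordP k; rewrite ?lin_forml ?lin_formr (bigD1 a) //= big1.
- by rewrite addr0 mxE eqxx scale1r.
- by move=> b ba; rewrite mxE eq_sym (negPf ba) scale0r.
- by rewrite addr0 mxE eqxx scale1r.
- by move=> b ba; rewrite mxE eq_sym (negPf ba) scale0r.
Qed.

Let usubst_rotation (t : nat) f : usubst (plane_rotation i j t%:R) f =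
  mmap (@mpolyC (N + N) C)
    (fun k => 'X_k + lin_form A k *+ t + lin_form B k *+ (t ^ 2)) f.
Proof.
have conjA a b : (A a b)^* = A a b by have := congr1 (fun M : 'M[C]_N => M a b) A_real; rewrite mxE.
have conjB a b : (B a b)^* = B a b by have := congr1 (fun M : 'M[C]_N => M a b) B_real; rewrite mxE.
have WE (M1 M2 : 'M[C]_N) (x : C) a b : (1%:M + x *: M1 + x ^+ 2 *: M2) a b =
    (1%:M : 'M[C]_N) a b + x * M1 a b + x ^+ 2 * M2 a b by rewrite !mxE.
have conj1 a b : ((1%:M : 'M[C]_N) a b)^* = (1%:M : 'M[C]_N) a b.
  by rewrite mxE conjC_nat.
rewrite rotE; apply: eq_bigr => m _; congr (_ * _); apply: mmap1_eq => k.
rewrite tnth_mktuple -lin_form1; have [a ->|a ->] := split_ordP k.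
  rewrite !lin_forml -!sumrMnl -!big_split /=; apply: eq_bigr => b _.
  by rewrite WE !scalerDl -!scaler_nat natrX !scalerA.
rewrite !lin_formr -!sumrMnl -!big_split /=; apply: eq_bigr => b _.
rewrite WE !rmorphD !rmorphM /= conjC_nat conj1 conjA conjB !scalerDl.
by rewrite -!scaler_nat natrX !scalerA.
Qed.

(** This is the infinitesimal invariance under plane rotations, the derivative of [rotation_mu] at
    [t = 0], where the factor [(1 + t^2)^d] is stationary. *)
Lemma zonal_rotation m : mu (\sum_k mderiv k 'X_[m] * lin_form A k) = 0.
Proof.
pose P0 (k : 'I_(N + N)) : zpoly := 'X_k.
have := @quadratic_curve_derivation _ _ zpoly (@mpolyC _ C) mu P0
  (lin_form A) (lin_form B) 'X_[m] (mdeg m) (mu 'X_[m]).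
have -> : \sum_k mmap (@mpolyC (N + N) C) P0 (mderiv k 'X_[m]) * lin_form A k =
          \sum_k mderiv k 'X_[m] * lin_form A k.
  apply: eq_bigr => k _; congr (_ * _); rewrite -[RHS]comp_mpoly_id.
  by apply: eq_bigr => l _; congr (_ * _); apply: mmap1_eq => a; rewrite tnth_mktuple.
by apply=> t; rewrite -usubst_rotation; exact: rotation_mu.
Qed.

Let lin_formA_l a : lin_form A (lshift N a) =
  ((a == j)%:R *+ 2) *: zl C i - ((a == i)%:R *+ 2) *: zl C j.
Proof.
rewrite lin_forml.
rewrite (eq_bigr (fun b => ((a == j)%:R *+ 2 * (b == i)%:R) *: zl C b -
   ((a == i)%:R *+ 2 * (b == j)%:R) *: zl C b)) => [|b _]; last first.
  by rewrite /A !mxE -scalerBl; congr (_ *: _); rewrite !mulrb; do 4!case: eqP => _ //=; ring.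
rewrite sumrB; congr (_ - _).
  rewrite (bigD1 i) //= eqxx mulr1 big1 ?addr0 // => b /negPf ->.
  by rewrite mulr0 scale0r.
rewrite (bigD1 j) //= eqxx mulr1 big1 ?addr0 // => b /negPf ->.
by rewrite mulr0 scale0r.
Qed.

Let lin_formA_r a : lin_form A (rshift N a) =
  ((a == j)%:R *+ 2) *: zr C i - ((a == i)%:R *+ 2) *: zr C j.
Proof.
rewrite lin_formr.
rewrite (eq_bigr (fun b => ((a == j)%:R *+ 2 * (b == i)%:R) *: zr C b -
   ((a == i)%:R *+ 2 * (b == j)%:R) *: zr C b)) => [|b _]; last first.
  by rewrite /A !mxE -scalerBl; congr (_ *: _); rewrite !mulrb; do 4!case: eqP => _ //=; ring.
rewrite sumrB; congr (_ - _).
  rewrite (bigD1 i) //= eqxx mulr1 big1 ?addr0 // => b /negPf ->.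
  by rewrite mulr0 scale0r.
rewrite (bigD1 j) //= eqxx mulr1 big1 ?addr0 // => b /negPf ->.
by rewrite mulr0 scale0r.
Qed.

Lemma zonal_rotation_monomial m :
  mu (zl C i * mderiv (lshift N j) 'X_[m] - zl C j * mderiv (lshift N i) 'X_[m] +
      (zr C i * mderiv (rshift N j) 'X_[m] - zr C j * mderiv (rshift N i) 'X_[m])) = 0.
Proof.
have := zonal_rotation m; rewrite big_split_ord /=.
have sumE (G : 'I_N -> zpoly) (P Q : zpoly) :
    \sum_a G a * (((a == j)%:R *+ 2) *: P - ((a == i)%:R *+ 2) *: Q) =
    2%:R *: (P * G j - Q * G i).
  rewrite (bigD1 j) //= (bigD1 i) //= big1 ?addr0 => [|a /andP[/negPf -> /negPf ->]].
    rewrite !eqxx eq_sym (negPf ij) !mul0rn !scale0r subr0 sub0r mulrN -!scalerAr.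
    by rewrite scalerBr [G j * _]mulrC [G i * _]mulrC.
  by rewrite !mul0rn !scale0r subr0 mulr0.
rewrite (eq_bigr _ (fun a _ => congr1 _ (lin_formA_l a))) sumE.
rewrite (eq_bigr _ (fun a _ => congr1 _ (lin_formA_r a))) sumE.
rewrite -scalerDr linearZ /= => /eqP; rewrite mulf_eq0 pnatr_eq0 /= => /eqP.
exact.
Qed.

End ZonalFunctional.

Section ZonalUniqueness.
Import mpoly.
Variables (C : numClosedFieldType) (n : nat).
Local Notation N := n.+1.
Local Notation zpoly := {mpoly C[N + N]}.
Implicit Types (f g h : zpoly) (m : 'X_{1..N + N}) (U : 'M[C]_N).
Local Notation e0 := (delta_mx ord0 ord0 : 'cV[C]_N).
Local Notation r2 := (@sqnorm_mpoly C N).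

Definition mpair (a : 'I_N) : 'X_{1..N + N} := (U_(lshift N a) + U_(rshift N a))%MM.

Lemma sqnormX m : r2 * 'X_[m] = \sum_a 'X_[m + mpair a] :> zpoly.
Proof.
rewrite /r2 mulr_suml; apply: eq_bigr => a _.
by rewrite -!mpolyXD addmC.
Qed.

Lemma mpair_l a b : mpair a (lshift N b) = (a == b).
Proof. by rewrite mnmDE !mnm1E (inj_eq (@lshift_inj _ _)) eq_rlshift addn0. Qed.

Lemma mpair_r a b : mpair a (rshift N b) = (a == b).
Proof. by rewrite mnmDE !mnm1E (inj_eq (@rshift_inj _ _)) eq_lrshift add0n. Qed.

Lemma mdegl_pair m a : mdegl (m + mpair a) = (mdegl m).+1.
Proof.
rewrite /mdegl; under eq_bigr do rewrite mnmDE mpair_l.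
rewrite big_split /= -[RHS]addn1; congr (_ + _)%N.
by rewrite (bigD1 a) //= eqxx big1 // => b /negPf; rewrite eq_sym => ->.
Qed.

Lemma mdegr_pair m a : mdegr (m + mpair a) = (mdegr m).+1.
Proof.
rewrite /mdegr; under eq_bigr do rewrite mnmDE mpair_r.
rewrite big_split /= -[RHS]addn1; congr (_ + _)%N.
by rewrite (bigD1 a) //= eqxx big1 // => b /negPf; rewrite eq_sym => ->.
Qed.

Variable mu : {scalar zpoly}.
Hypothesis mu_inv : forall U, U \is unitarymx -> U *m e0 = e0 ->
  forall f, mu (usubst U f) = mu f.

(** The infinitesimal rotation in the (i, j)-plane is applied to a monomial unbalanced at [i] and
    [j]. Of the four resulting monomials two are balanced there and give the relation; the other two
    are killed by [zonal_unbalanced]. *)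
Lemma zonal_exchange (i j : 'I_N) m : i != ord0 -> j != ord0 ->
  m (lshift N i) = m (rshift N i) -> m (lshift N j) = m (rshift N j) ->
  (m (lshift N j)).+1%:R * mu 'X_[m + mpair i] = (m (lshift N i)).+1%:R * mu 'X_[m + mpair j].
Proof.
move=> i0 j0 mi mj; have [->//|ij] := eqVneq i j.
pose M := (m + U_(lshift N j) + U_(rshift N i))%MM.
have lsh := inj_eq (@lshift_inj N N); have rsh := inj_eq (@rshift_inj N N).
have ji : (j == i) = false by rewrite eq_sym (negPf ij).
have := zonal_rotation_monomial mu_inv ij i0 j0 M.
have T a b k : M b = k.+1 -> mu ('X_a * mderiv b 'X_[M]) = k.+1%:R * mu 'X_[M - U_(b) + U_(a)].
  by move=> Mb; rewrite mderivX Mb -scalerAr linearZ /= -mpolyXD addmC.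
have T0 a b : (M b != 0%N -> mu 'X_[M - U_(b) + U_(a)] = 0) -> mu ('X_a * mderiv b 'X_[M]) = 0.
  move=> H; rewrite mderivX -scalerAr linearZ /= -mpolyXD addmC.
  by have [->|/H ->] := eqVneq (M b) 0%N; rewrite ?mul0r ?mulr0.
have T1 : mu (zl C i * mderiv (lshift N j) 'X_[M]) = (m (lshift N j)).+1%:R * mu 'X_[m + mpair i].
  rewrite (T _ _ (m (lshift N j))); last first.
    by rewrite /M !mnmDE !mnm1E eqxx eq_rlshift addn0 addn1.
  congr (_ * mu 'X_[_]); rewrite /M /mpair -[(m + _ + _)%MM]addmA [(U_(lshift N j) + _)%MM]addmC addmA addmK.
  by rewrite -addmA [(U_(rshift N i) + _)%MM]addmC.
have T4 : mu (zr C j * mderiv (rshift N i) 'X_[M]) = (m (lshift N i)).+1%:R * mu 'X_[m + mpair j].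
  rewrite (T _ _ (m (lshift N i))); last first.
    by rewrite /M !mnmDE !mnm1E eqxx eq_lrshift addn0 addn1 mi.
  by congr (_ * mu 'X_[_]); rewrite /M /mpair addmK addmA.
have T2 : mu (zl C j * mderiv (lshift N i) 'X_[M]) = 0.
  apply: T0 => Mi; apply: (zonal_unbalanced mu_inv i0).
  rewrite !(mnmDE, mnmBE, mnm1E) ?lsh ?rsh ?eq_lrshift ?eq_rlshift ?eqxx ?ji /= -mi.
  by move: Mi; rewrite /M !mnmDE !mnm1E lsh ji eq_rlshift; lia.
have T3 : mu (zr C i * mderiv (rshift N j) 'X_[M]) = 0.
  apply: T0 => Mj; apply: (zonal_unbalanced mu_inv j0).
  rewrite !(mnmDE, mnmBE, mnm1E) ?lsh ?rsh ?eq_lrshift ?eq_rlshift ?eqxx ?(negPf ij) /= -mj.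
  by move: Mj; rewrite /M !mnmDE !mnm1E rsh (negPf ij) eq_lrshift -mj; lia.
rewrite !linearD !linearN /= T1 T2 T3 T4 subr0 add0r => /eqP.
by rewrite subr_eq0 => /eqP.
Qed.

Variables p q : nat.
Hypothesis mu_r2 : forall m, (mdegl m).+1 = p -> (mdegr m).+1 = q -> mu (r2 * 'X_[m]) = 0.
Hypothesis mu_zonal : forall m, mdegl m = p -> mdegr m = q ->
  (forall i, i != ord0 -> m (lshift N i) = 0%N /\ m (rshift N i) = 0%N) -> mu 'X_[m] = 0.

(** Induction on the degree in the coordinates away from the pole. Unbalanced monomials vanish, and
    a balanced one involving such a coordinate [j] is reduced through the relation r² ~ 0. *)
Lemma zonal_monomial_eq0 m : mdegl m = p -> mdegr m = q -> mu 'X_[m] = 0.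
Proof.
have [k] := ubnP (\sum_(i | i != ord0) m (lshift N i)); elim: k m => // k IH m mk mp mq.
have [/forall_inP bal|] := boolP [forall (i | i != ord0), m (lshift N i) == m (rshift N i)]; last first.
  by rewrite negb_forall_in => /exists_inP[i i0]; exact: zonal_unbalanced.
have [/forall_inP m0|] := boolP [forall (i | i != ord0), m (lshift N i) == 0%N].
  apply: mu_zonal => // i i0; have /eqP mi := m0 _ i0.
  by split=> //; rewrite -(eqP (bal _ i0)).
rewrite negb_forall_in => /exists_inP[j j0 mj].
pose g := (m - mpair j)%MM.
have gm : (g + mpair j)%MM = m.
  apply: submK; apply/mnm_lepP => k'; have [a ->|a ->] := split_ordP k'.
    by rewrite mpair_l; case: eqP => // <-; rewrite lt0n.
  by rewrite mpair_r; case: eqP => // <-; rewrite -(eqP (bal _ j0)) lt0n.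
have gbal i : i != ord0 -> g (lshift N i) = g (rshift N i).
  by move=> i0; rewrite !mnmBE mpair_l mpair_r (eqP (bal _ i0)).
have gp : (mdegl g).+1 = p by rewrite -(mdegl_pair g j) gm.
have gq : (mdegr g).+1 = q by rewrite -(mdegr_pair g j) gm.
(* In the expansion of [r2 * 'X_[g]], the term at the pole has smaller degree away from it and
   vanishes by induction. By [zonal_exchange] the remaining terms are positive multiples of [mu
   'X_[m]], so they cannot cancel. *)
have := mu_r2 gp gq; rewrite sqnormX linear_sum (bigD1 ord0) //= IH; first last.
- by rewrite mdegr_pair.
- by rewrite mdegl_pair.
- rewrite -ltnS; apply: leq_trans mk; rewrite ltnS (bigD1 j) //= [X in (_ < X)%N](bigD1 j) //=.
  rewrite -[m in X in (_ < X)%N]gm !(mnmDE _ g) !mpair_l eqxx [ord0 == j]eq_sym (negPf j0) addn0 addn1 -addSn leq_add2l.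
  by apply: leq_sum => i /andP[i0 _]; rewrite !(mnmDE _ g) !mpair_l eq_sym (negPf i0) addn0 leq_addr.
rewrite add0r; set c : C := \sum_(i | i != ord0) (g (lshift N i)).+1%:R.
set d : C := (g (lshift N j)).+1%:R.
have dN0 : d != 0 by rewrite pnatr_eq0.
rewrite (eq_bigr (fun i => d^-1 * ((g (lshift N i)).+1%:R * mu 'X_[m]))) => [|i i0].
  rewrite -mulr_sumr -mulr_suml -/c => /eqP; rewrite !mulf_eq0 invr_eq0 (negPf dN0) /=.
  case/orP => [|/eqP //]; rewrite /c (bigD1 j) //= -natr_sum -natrD pnatr_eq0.
  by rewrite addSn.
by apply: (mulfI dN0); rewrite mulrA divff // mul1r (zonal_exchange i0 j0) ?gbal // gm.
Qed.

Lemma zonal_functional_eq0 f : bidegree p%:R q%:R f -> mu f = 0.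
Proof.
move=> fpq; rewrite (mpolyE f) linear_sum big_seq; apply: big1 => m.
rewrite mcoeff_msupp => fm; rewrite linearZ /= zonal_monomial_eq0 ?mulr0 //.
  by have [/eqP + _] := bidegree_mcoeff fpq fm; rewrite eqr_nat => /eqP.
by have [_ /eqP] := bidegree_mcoeff fpq fm; rewrite eqr_nat => /eqP.
Qed.

End ZonalUniqueness.

(** * Transitivity of the unitary group on spheres *)

Section Householder.
Variables (C : numClosedFieldType) (N : nat).
Implicit Types (z w v : 'cV[C]_N).

Definition hdot (v w : 'cV[C]_N) : C := \sum_j (v j ord0)^* * w j ord0.

Lemma hdotE v w : map_mx Num.conj v^T *m w = (hdot v w)%:M.
Proof. by rewrite [LHS]mx11_scalar mxE; congr _%:M; apply: eq_bigr => j _; rewrite !mxE. Qed.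

Lemma hdotBl u v w : hdot (u - v) w = hdot u w - hdot v w.
Proof. by rewrite -sumrB; apply: eq_bigr => j _; rewrite !mxE rmorphB mulrBl. Qed.

Lemma hdotBr u v w : hdot u (v - w) = hdot u v - hdot u w.
Proof. by rewrite -sumrB; apply: eq_bigr => j _; rewrite !mxE mulrBr. Qed.

Lemma hdotC v w : (hdot v w)^* = hdot w v.
Proof.
by rewrite rmorph_sum; apply: eq_bigr => j _; rewrite rmorphM /= conjCK mulrC.
Qed.

Lemma hdotvv v : hdot v v = \sum_j `|v j ord0| ^+ 2.
Proof. by apply: eq_bigr => j _; rewrite normCK mulrC. Qed.

Lemma hdotvv_eq0 v : hdot v v = 0 -> v = 0.
Proof.
rewrite hdotvv => /eqP; rewrite psumr_eq0 => [/allP v0|j _]; last exact: exprn_ge0.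
apply/colP => j; rewrite mxE; apply/eqP.
by have := v0 j (mem_index_enum _); rewrite expf_eq0 /= normr_eq0.
Qed.

(* The complex reflection [1 - v v^* / <v, z>] with [v = z - w].             *)
Lemma unitary_transitive z w : hdot z z = hdot w w ->
  exists2 U : 'M[C]_N, U \is unitarymx & U *m z = w.
Proof.
move=> zw; pose v := z - w; pose t := hdot v z.
(* Equality of the norms of [z] and [w] gives this identity, which is what unitarity of the
   reflection amounts to. *)
have ts : t + t^* = hdot v v.
  by rewrite /t hdotC /v !(hdotBl, hdotBr) zw; ring.
have [t0|tN0] := eqVneq t 0.
  have /hdotvv_eq0 /eqP : hdot v v = 0 by rewrite -ts t0 conjC0 addr0.
  rewrite subr_eq0 => /eqP ->; exists 1%:M; last by rewrite mul1mx.
  by apply/unitarymxP; rewrite trmx1 map_mx1 mulmx1.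
pose M := v *m map_mx Num.conj v^T.
have MM : M *m M = hdot v v *: M.
  by rewrite /M mulmxA -(mulmxA v) hdotE mul_mx_scalar -scalemxAl.
have Mt : map_mx Num.conj M^T = M.
  rewrite /M trmx_mul map_mxM; congr (_ *m _).
  by apply/matrixP => a b; rewrite !mxE; exact: conjCK.
exists (1%:M - t^-1 *: M); last first.
  rewrite mulmxBl mul1mx -scalemxAl /M -mulmxA hdotE -/t mul_mx_scalar scalerA mulVf //.
  by rewrite scale1r /v opprB addrC subrK.
have Ut : map_mx Num.conj (1%:M - t^-1 *: M)^T = 1%:M - t^-1^* *: M.
  rewrite -[in RHS]Mt; move: (M) => M'; apply/matrixP => a b.
  by rewrite !mxE rmorphB rmorphM /= conjC_nat eq_sym.
apply/unitarymxP; rewrite Ut.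
rewrite mulmxBl !mulmxBr !mul1mx mulmx1 -!scalemxAl -!scalemxAr MM fmorphV /=.
have tcN0 : t^* != 0 by rewrite conjC_eq0.
have -> : hdot v v = t + t^* by rewrite ts.
rewrite !scalerA; apply/matrixP => a b; rewrite !mxE.
by move: (M a b) => x; case: (a == b) => /=; field; rewrite tN0 tcN0.
Qed.

End Householder.

(** * Zonal harmonics and proportionality of invariant functionals *)

Module ZonalProportional.
Section ZonalProportional.
Import mpoly.
Variables (C : numClosedFieldType) (n : nat).
Local Notation N := n.+1.
Local Notation zpoly := {mpoly C[N + N]}.
Implicit Types (f g h : zpoly) (m : 'X_{1..N + N}) (U : 'M[C]_N).
Local Notation e0 := (delta_mx ord0 ord0 : 'cV[C]_N).
Local Notation "'Δ'" := (@laplacian C N).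

Definition zonal_invariant (mu : zpoly -> C) := forall U, U \is unitarymx ->
  U *m e0 = e0 -> forall f, mu (usubst U f) = mu f.

Definition polar_monomial (p q : nat) : zpoly := zl C ord0 ^+ p * zr C ord0 ^+ q.
(** This is a zonal harmonic of the pole: the stabilizer fixes the monomial and commutes with
    [harmonic_part]. *)
Definition polar_harmonic p q : zpoly := harmonic_part (p + q) (polar_monomial p q).

Lemma polar_monomialE m :
  (forall i, i != ord0 -> m (lshift N i) = 0%N /\ m (rshift N i) = 0%N) ->
  'X_[m] = polar_monomial (mdegl m) (mdegr m).
Proof.
move=> m0; rewrite mpolyXE_id big_split_ord /= (bigD1 ord0) //= big1 => [|i /m0[-> _]//].
rewrite [X in _ * X](bigD1 ord0) //= [X in _ * (_ * X)]big1 => [|i /m0[_ ->]//].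
rewrite !mulr1 /polar_monomial /mdegl /mdegr; congr (_ ^+ _ * _ ^+ _).
  by rewrite (bigD1 ord0) //= big1 ?addn0 // => i /m0[].
by rewrite (bigD1 ord0) //= big1 ?addn0 // => i /m0[].
Qed.

(** Composition with [harmonic_part] extends the functional from harmonic polynomials so that it
    stays invariant, kills the multiples of r² and vanishes on the polar monomial;
    [zonal_functional_eq0] then applies. *)
Lemma zonal_harmonic_eq0 (mu : {scalar zpoly}) p q : zonal_invariant mu ->
  mu (polar_harmonic p q) = 0 ->
  forall f, bidegree p%:R q%:R f -> Δ f = 0 -> mu f = 0.
Proof.
move=> mu_inv mu0 f fpq f0; pose nu f := mu (harmonic_part (p + q) f).
have nu_lin : scalar nu by move=> a g h; rewrite /nu !linearP.
pose nuL : {scalar zpoly} := HB.pack nu (GRing.isLinear.Build _ _ _ _ nu nu_lin).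
rewrite -(harmonic_part_id (p + q) f0) -[LHS]/(nuL f).
apply: (@zonal_functional_eq0 _ _ nuL _ p q) => // [U Uu Ue g|m mp mq|m mp mq m0].
- by rewrite /= /nu harmonic_part_usubst // mu_inv.
- have dE : (p + q)%N = (mdegl m + mdegr m).+2 by rewrite -mp -mq addSn addnS.
  rewrite /= /nu dE (harmonic_part_sqnormM (ltn0Sn n) (bidegreeX C m)) ?linear0 //.
  by rewrite natrD.
- by rewrite /= /nu (polar_monomialE m0) mp mq.
Qed.

(** The combination [ev h * lam - lam h * ev] is invariant and vanishes on the zonal harmonic
    [h]. *)
Lemma zonal_proportional (lam ev : {scalar zpoly}) p q f :
  zonal_invariant lam -> zonal_invariant ev -> bidegree p%:R q%:R f -> Δ f = 0 ->
  ev (polar_harmonic p q) * lam f = lam (polar_harmonic p q) * ev f.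
Proof.
move=> laminv evinv fpq f0; set h := polar_harmonic p q.
pose mu f := ev h * lam f - lam h * ev f.
have mu_lin : scalar mu by move=> a g k; rewrite /mu !linearP /=; ring.
pose muL : {scalar zpoly} := HB.pack mu (GRing.isLinear.Build _ _ _ _ mu mu_lin).
apply/eqP; rewrite -subr_eq0; apply/eqP; rewrite -[LHS]/(muL f).
apply: (@zonal_harmonic_eq0 muL p q) => // [U Uu Ue g|].
  by rewrite /= /mu laminv // evinv.
by rewrite /= /mu -/h; ring.
Qed.

(** For [j != ord0] this is the usual highest weight vector of H_(p,q), harmonic because no
    coordinate occurs together with its own conjugate. *)
Definition highest_monomial (j : 'I_N) (p q : nat) : 'X_{1..N + N} :=
  (U_(lshift N ord0) *+ p + U_(rshift N j) *+ q)%MM.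

Lemma laplacian_highest j p q : j != ord0 -> Δ 'X_[highest_monomial j p q] = 0.
Proof.
move=> j0; rewrite /laplacian big1 // => a _.
rewrite mderivX linearZ /= mderivX /highest_monomial !(mnmDE, mnmBE, mulmnE, mnm1E).
rewrite (inj_eq (@lshift_inj _ _)) (inj_eq (@rshift_inj _ _)) !eq_lrshift !eq_rlshift.
have [<-|ja] := eqVneq j a; last by rewrite mul0n scale0r.
by rewrite eq_sym (negPf j0) !mul0n subn0 scale0r scaler0.
Qed.

Lemma bidegree_highest j p q : bidegree p%:R q%:R ('X_[highest_monomial j p q] : zpoly).
Proof.
have := bidegreeX C (highest_monomial j p q); congr (bidegree _%:R _%:R _).
  rewrite /mdegl (bigD1 ord0) //= big1 => [|a a0].
    by rewrite mnmDE !mulmnE !mnm1E eqxx eq_rlshift mul1n mul0n !addn0.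
  by rewrite mnmDE !mulmnE !mnm1E (inj_eq (@lshift_inj _ _)) eq_sym (negPf a0) eq_rlshift.
rewrite /mdegr (bigD1 j) //= big1 => [|a a0].
  by rewrite mnmDE !mulmnE !mnm1E eqxx eq_lrshift mul1n mul0n addn0.
by rewrite mnmDE !mulmnE !mnm1E (inj_eq (@rshift_inj _ _)) eq_lrshift eq_sym (negPf a0).
Qed.

Lemma zeval_highest j p q (z : 'cV[C]_N) :
  meval (conj_point z) 'X_[highest_monomial j p q] = z ord0 ord0 ^+ p * (z j ord0)^* ^+ q.
Proof.
by rewrite mpolyXD -!mpolyXn mevalM !rmorphXn /= !mevalXU conj_pointl conj_pointr.
Qed.

Definition zeval_at (z : 'cV[C]_N) f : C := meval (conj_point z) f.
Lemma zeval_at_is_linear z : scalar (zeval_at z).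
Proof. by move=> a f g; rewrite /zeval_at mevalD mevalZ. Qed.
HB.instance Definition _ z :=
  GRing.isLinear.Build C zpoly C _ (zeval_at z) (zeval_at_is_linear z).

Lemma zonal_zeval_at : zonal_invariant (zeval_at e0).
Proof. by move=> U _ Ue f; rewrite /zeval_at zeval_usubst Ue. Qed.

(** Otherwise [zonal_harmonic_eq0], applied to evaluation at the pole, would make every harmonic of
    this bidegree vanish there; a suitably rotated [highest_monomial] does not. *)
Lemma polar_harmonic_neq0 p q : (0 < n)%N -> zeval_at e0 (polar_harmonic p q) != 0.
Proof.
move=> n0; apply/eqP => h0; pose j : 'I_N := ord_max.
have j0 : j != ord0 by rewrite -val_eqE /= -lt0n.
(* The triple 3, 4, 5 provides a unit vector whose coordinates at [ord0] and [j] are both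
   nonzero. *)
pose w : 'cV[C]_N := (3%:R / 5%:R) *: e0 + (4%:R / 5%:R) *: delta_mx j ord0.
have w0 : w ord0 ord0 = 3%:R / 5%:R.
  by rewrite !mxE !eqxx [ord0 == j]eq_sym (negPf j0) /= mulr0 addr0 mulr1.
have wj : w j ord0 = 4%:R / 5%:R.
  by rewrite !mxE (negPf j0) !eqxx /= mulr0 add0r mulr1.
have e0w : hdot e0 e0 = hdot w w.
  rewrite !hdotvv (bigD1 ord0) //= [in RHS](bigD1 ord0) //= [in RHS](bigD1 j) //=.
  rewrite big1 => [|i i0]; last by rewrite mxE (negPf i0) normr0 expr0n.
  rewrite big1 => [|i /andP[i0 ij]]; last first.
    by rewrite !mxE (negPf i0) (negPf ij) !mulr0 addr0 normr0 expr0n.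
  rewrite w0 wj mxE !eqxx /= !ger0_norm ?divr_ge0 ?ler0n // !addr0.
  by field.
have [U Uu Ue] := unitary_transitive e0w.
have := @zonal_harmonic_eq0 (zeval_at e0) p q zonal_zeval_at h0
  (usubst U 'X_[highest_monomial j p q]).
rewrite laplacian_usubst // laplacian_highest // (linear0 (usubst U)) => H.
have bU : bidegree p%:R q%:R (usubst U 'X_[highest_monomial j p q]).
  apply: bihomogeneous_bidegree => a z.
  by rewrite !zeval_usubst -scalemxAr (bidegree_bihomogeneous _ _ (bidegree_highest _ _ _)).
have := H bU erefl; rewrite /= /zeval_at zeval_usubst Ue zeval_highest w0 wj.
apply/eqP; rewrite mulf_neq0 // expf_neq0 ?conjC_eq0 // mulf_neq0 ?invr_eq0 ?pnatr_eq0 //.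
Qed.

End ZonalProportional.
End ZonalProportional.
Import ZonalProportional.

From mathcomp Require Import all_classical all_reals all_analysis.
From mathcomp Require Import measurable_realfun complex.
From mathcomp Require Import -(notations) mpoly.

Import numFieldNormedType.Exports.
Local Open Scope classical_set_scope.
Local Open Scope ring_scope.

(** * Topology and integration on the complex sphere *)

Section ComplexTopology.
Variable R : realType.
Local Notation C := R[i].
Local Notation Re := (@complex.Re R).
Local Notation Im := (@complex.Im R).

Lemma conj_conjc (z : C) : z^* = (z^*)%C.
Proof. by []. Qed.

Lemma Re_le_norm (z : C) : `|Re z| <= Re `|z|.
Proof. by have := normc_ge_Re z; rewrite normc_def lecR. Qed.

Lemma Im_le_norm (z : C) : `|Im z| <= Re `|z|.
Proof.
rewrite normc_def /= -sqrtr_sqr ler_sqrt ?lerDr ?sqr_ge0 //.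
by rewrite addr_ge0 ?sqr_ge0.
Qed.

Lemma RRe_norm (z : C) : (Re `|z|)%:C%C = `|z|.
Proof. by rewrite normc_def. Qed.

Lemma ReB (z w : C) : Re (z - w) = Re z - Re w.
Proof. by case: z; case: w. Qed.

Lemma ImB (z w : C) : Im (z - w) = Im z - Im w.
Proof. by case: z; case: w. Qed.

Lemma continuous_Re : continuous (Re : C -> R).
Proof.
move=> z; apply/(@cvgrPdist_lt _ R^o _ (nbhs z) (nbhs_filter z)) => e e0; near=> w.
rewrite -ReB; apply: le_lt_trans (Re_le_norm _) _.
suff : `|z - w| < e%:C%C by rewrite -RRe_norm ltcR.
by near: w; apply: (@nbhsx_ballx _ C^o z); rewrite ltcR.
Unshelve. all: by end_near. Qed.

Lemma continuous_Im : continuous (Im : C -> R).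
Proof.
move=> z; apply/(@cvgrPdist_lt _ R^o _ (nbhs z) (nbhs_filter z)) => e e0; near=> w.
rewrite -ImB; apply: le_lt_trans (Im_le_norm _) _.
suff : `|z - w| < e%:C%C by rewrite -RRe_norm ltcR.
by near: w; apply: (@nbhsx_ballx _ C^o z); rewrite ltcR.
Unshelve. all: by end_near. Qed.

Lemma continuous_real_complex : continuous (fun x : R => x%:C%C : C).
Proof.
move=> x; apply/(@cvgrPdist_lt _ C^o _ (nbhs x) (nbhs_filter x)) => e e0.
have er : e = (Re e)%:C%C by rewrite RRe_real // gtr0_real.
have e0' : 0 < Re e by rewrite -ltcR -er.
near=> y.
rewrite -(rmorphB (real_complex R)) /= normc_def /= expr0n addr0 sqrtr_sqr er ltcR.
by near: y; exact: (@nbhsx_ballx _ R^o x).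
Unshelve. all: by end_near. Qed.

Lemma continuous_conj : continuous (Num.conj : C -> C).
Proof.
move=> x; apply/(@cvgrPdist_lt _ C^o _ (nbhs x) (nbhs_filter x)) => e e0; near=> y.
rewrite -rmorphB /= norm_conjC.
by near: y; exact: (@nbhsx_ballx _ C^o x).
Unshelve. all: by end_near. Qed.

Lemma compact_disc : compact [set z : C | `|z| <= 1].
Proof.
pose K : set (R * R) := `[-1, 1] `*` `[-1, 1].
pose g (x : R * R) : C := x.1%:C%C + 'i * x.2%:C%C.
have cg : continuous g.
  move=> x; apply: cvgD.
    exact: (continuous_comp (@cvg_fst _ _ _ _ _) (@continuous_real_complex x.1)).
  apply: cvgM; first exact: cvg_cst.
  exact: (continuous_comp (@cvg_snd _ _ _ _ _) (@continuous_real_complex x.2)).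
have cK : compact (g @` K).
  apply: continuous_compact; first exact: continuous_subspaceT.
  by apply: compact_setX; exact: segment_compact.
apply: (subclosed_compact _ cK).
  have -> : [set z : C | `|z| <= 1] = (fun z : C => Re `|z|) @^-1` [set x | x <= 1].
    apply/seteqP; split=> z z1.
      by change (Re `|z| <= 1); rewrite -(lecR (Re `|z|)) RRe_norm.
    by change (`|z| <= 1); rewrite -RRe_norm lecR.
  apply: closed_comp => [z _|]; last exact: closed_le.
  exact: (continuous_comp (@norm_continuous _ C^o z) (@continuous_Re _)).
move=> z z1; have z1' : Re `|z| <= 1 by rewrite -(lecR (Re `|z|)) RRe_norm.
exists (Re z, Im z); last by rewrite /g /= [RHS]complexE complexiE.
by split=> /=; rewrite in_itv /= -ler_norml; apply: le_trans z1';
  [exact: Re_le_norm|exact: Im_le_norm].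
Qed.

End ComplexTopology.

Section SphereTopology.
Variables (R : realType) (n : nat).
Local Notation C := R[i].
Local Notation N := n.+1.
Local Notation S := (csphere R n).
Local Notation Re := (@complex.Re R).

Lemma l2norm1E (z : 'cV[C]_N) : (l2norm z = 1) <-> (hdot z z = 1).
Proof.
rewrite /l2norm -hdotvv; split=> [h|->]; last by rewrite sqrtC1.
by rewrite -[LHS]sqrtCK h expr1n.
Qed.

Lemma hdot_csphere (z : S) : hdot (\val z) (\val z) = 1.
Proof. by apply/l2norm1E; exact: csphereP. Qed.

Lemma csphere_coord_continuous j : continuous (fun z : S => (\val z : 'cV[C]_N) j ord0).
Proof.
move=> z; exact: (continuous_comp (@initial_continuous S 'cV[C]_n.+1 set_val z)
         (@coord_continuous C _ _ j ord0 _)).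
Qed.

Lemma continuous_sum_C (T : topologicalType) (I : Type) (r : seq I) (F : I -> T -> C) :
  (forall i, continuous (F i)) -> continuous (fun x => \sum_(i <- r) F i x).
Proof.
move=> cF x; apply: (@cvg_big C _ +%R 0 _ (@add_continuous C) T (nbhs x)) => i _.
exact: cF.
Qed.

Lemma continuous_mul_C (T : topologicalType) (F G : T -> C) :
  continuous F -> continuous G -> continuous (fun x => F x * G x).
Proof. by move=> cF cG x; apply: (@cvgM C T (nbhs x)); [exact: cF|exact: cG]. Qed.

Lemma continuous_conj_C (T : topologicalType) (F : T -> C) :
  continuous F -> continuous (fun x => (F x)^*).
Proof. by move=> cF x; apply: (continuous_comp (cF x)); exact: continuous_conj. Qed.

Lemma trmx_continuous (p q : nat) : continuous (@trmx C p q).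
Proof.
move=> z A [P hP PA]; exists (fun i j => P j i) => [i j|y hy].
  by have := hP j i; rewrite mxE.
by apply: PA => i j; rewrite mxE; exact: hy.
Qed.

Lemma compact_unit_vectors : compact [set z : 'cV[C]_N | l2norm z = 1].
Proof.
pose K : set 'rV[C]_N := [set v : 'rV[C]_N | forall i, [set x : C | `|x| <= 1] (v ord0 i)].
have cK : compact (@trmx C 1 N @` K).
  apply: continuous_compact; last first.
    exact: (@rV_compact C N (fun=> [set x : C | `|x| <= 1]) (fun=> @compact_disc R)).
  by apply: continuous_subspaceT; exact: trmx_continuous.
apply: (subclosed_compact _ cK).
  have -> : [set z : 'cV[C]_N | l2norm z = 1] =
      (fun z : 'cV[C]_N => Re (hdot z z)) @^-1` [set x | x = 1].
    apply/seteqP; split=> z /=; first by move=> /l2norm1E ->.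
    move=> h; apply/l2norm1E; rewrite -[LHS](@RRe_real R) ?h //.
    by rewrite hdotvv; apply: ger0_real; apply: sumr_ge0 => j _; exact: exprn_ge0.
  apply: closed_comp => [z _|]; last exact: closed_eq.
  have ch : continuous (fun z : 'cV[C]_N => hdot z z).
    apply: (@continuous_sum_C 'cV[C]_N _ (index_enum 'I_N)
      (fun j (z : 'cV[C]_N) => (z j ord0)^* * z j ord0)) => j.
    apply: continuous_mul_C; last exact: coord_continuous.
    by apply: continuous_conj_C; exact: coord_continuous.
  exact: (continuous_comp (ch z) (@continuous_Re _ _)).
move=> z /l2norm1E; rewrite hdotvv => z1; exists z^T; last by rewrite trmxK.
move=> i /=; rewrite mxE -(@ler_pXn2r _ 2) ?nnegrE // expr1n -z1 (bigD1 i) //=.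
by rewrite lerDl; apply: sumr_ge0 => j _; exact: exprn_ge0.
Qed.

Lemma compact_csphere : compact [set: S].
Proof.
move=> F FF _; have := compact_unit_vectors.
move=> /(_ (fmap (fun z : S => \val z : 'cV[C]_N) F)) [|z [/= z1 clz]].
  by apply: (@filterS _ F _ setT) => [z _|]; [exact: csphereP|exact: filterT].
exists (mk_csphere z1); split=> // A B FA.
case=> _ [] [] O oO <- Oz OB.
have FA' : fmap (fun z : S => \val z : 'cV[C]_N) F ((fun z : S => \val z : 'cV[C]_N) @` A).
  by apply: (@filterS _ F _ A) => // w Aw; exists w.
have := clz _ _ FA' (open_nbhs_nbhs (conj oO Oz)).
case=> _ [] [] w Aw <- Ow.
by exists w; split=> //; exact: OB.
Qed.

End SphereTopology.

(** * Invariant integration on the sphere *)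

Section SphereIntegral.
Variables (R : realType) (n : nat).
Local Notation S := (csphere R n).

Lemma csphere_continuous_measurable (g : S -> R) :
  continuous g -> measurable_fun setT g.
Proof.
move=> /continuousP cg; apply: (measurability _ (RGenOpens.measurableE R)) => _ [_ [x [y ->] <-]].
by rewrite setTI; apply: sub_sigma_algebra; apply: cg; exact: interval_open.
Qed.

Lemma csphere_continuous_bounded (g : S -> R) :
  continuous g -> exists2 M : R, 0 < M & forall z, `|g z| <= M.
Proof.
move=> cg; have cabs : {within [set: S], continuous (fun z => `|g z|)}.
  apply: continuous_subspaceT => z; exact: (continuous_comp (cg z) (@norm_continuous _ R^o _)).
have [c _ cM] := compact_EVT_max (ex_intro _ point I) (@compact_csphere R n) cabs.
exists (`|g c| + 1); first by rewrite ltr_pwDr.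
by move=> z; apply: le_trans (cM z (in_setT z)) _; rewrite lerDl.
Qed.

Lemma measurable_unitary_act (U : unitary_group R n) :
  measurable_fun [set: S] (unitary_act U).
Proof.
apply: (@measurability _ _ _ _ _ _ (@open S)) => // _ [P oP <-].
rewrite setTI; apply: sub_sigma_algebra.
by have /continuousP := @continuous_unitary_act R n U; apply.
Qed.

Variable sigma : probability S R.

Lemma csphere_continuous_integrable (g : S -> R) :
  continuous g -> sigma.-integrable setT (EFin \o g).
Proof.
move=> cg; apply: measurable_bounded_integrable => //.
- by rewrite [X in (X < _)%E](_ : _ = 1%E) ?ltry //; exact: probability_setT.
- exact: csphere_continuous_measurable.
- have [M M0 gM] := csphere_continuous_bounded cg.
  by exists M; split; rewrite ?num_real // => x Mx z _; apply: le_trans (gM z) (ltW Mx).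
Qed.

Lemma Rintegral_unitary (U : unitary_group R n) (g : S -> R) :
  rotation_invariant sigma -> continuous g ->
  \int[sigma]_z g (unitary_act U z) = \int[sigma]_z g z.
Proof.
move=> sinv cg; rewrite /Rintegral; congr fine.
have mU := measurable_unitary_act U.
transitivity (\int[pushforward sigma (unitary_act U)]_z (g z)%:E)%E.
  have := @integral_pushforward _ _ _ _ R _ mU sigma setT (EFin \o g).
  rewrite preimage_setT /= => -> //.
  - by apply/measurable_EFinP; exact: csphere_continuous_measurable.
  - apply: (csphere_continuous_integrable (g := g \o unitary_act U)) => z.
    exact: (continuous_comp (@continuous_unitary_act _ _ U z) (cg _)).
apply: eq_measure_integral => A mA _; rewrite /pushforward; exact: sinv.
Qed.

End SphereIntegral.

Section ComplexIntegral.
Variables (R : realType) (n : nat).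
Local Notation C := R[i].
Local Notation N := n.+1.
Local Notation S := (csphere R n).
Local Notation Re := (@complex.Re R).
Local Notation Im := (@complex.Im R).

Lemma csphere_transitive (z w : S) : exists U, unitary_act U z = w.
Proof.
have [|U Uu Uz] := @unitary_transitive C N (\val z) (\val w).
  by rewrite !hdot_csphere.
by exists (exist _ U Uu); apply: val_inj.
Qed.

Lemma continuous_sum_R (T : topologicalType) (I : Type) (r : seq I) (F : I -> T -> R) :
  (forall i, continuous (F i)) -> continuous (fun x => \sum_(i <- r) F i x).
Proof.
move=> cF x; apply: (@cvg_big R^o _ +%R 0 _ (@add_continuous R^o) T (nbhs x)) => i _.
exact: cF.
Qed.

Variable sigma : probability S R.
Implicit Types (g h : S -> R) (F G : S -> C).

Lemma Rintegral_sum (I : Type) (r : seq I) (g : I -> S -> R) :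
  (forall i, continuous (g i)) ->
  \int[sigma]_z (\sum_(i <- r) g i z) = \sum_(i <- r) \int[sigma]_z g i z.
Proof.
move=> cg; elim: r => [|i r IH].
  rewrite big_nil; transitivity (\int[sigma]_z (0 : R)); last by rewrite Rintegral_cst ?mul0r.
  by apply: eq_Rintegral => z _; rewrite big_nil.
rewrite big_cons -IH -RintegralD //.
- by apply: eq_Rintegral => z _; rewrite big_cons.
- exact: csphere_continuous_integrable.
- by apply: csphere_continuous_integrable; exact: continuous_sum_R.
Qed.

Lemma Rintegral_csphere_cst (r : R) : \int[sigma]_z r = r.
Proof.
by rewrite Rintegral_cst // [X in fine X](_ : _ = 1%E) ?mulr1 //; exact: probability_setT.
Qed.

(** An invariant [sigma] has full support. If [g z0 > 0], then by transitivity and compactness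
    finitely many translates of the set where [g > g z0 / 2] cover the sphere. The sum of the
    corresponding translates of [g] is at least [g z0 / 2] everywhere, yet its integral is 0. *)
Lemma Rintegral_eq0 g : rotation_invariant sigma -> continuous g ->
  (forall z, 0 <= g z) -> \int[sigma]_z g z = 0 -> forall z, g z = 0.
Proof.
move=> sinv cg g0 ig0 z0; apply/eqP; rewrite eq_le g0 andbT leNgt; apply/negP => gz0.
have cgU (U : unitary_group R n) : continuous (fun z => g (unitary_act U z)).
  by move=> z; exact: (continuous_comp (@continuous_unitary_act _ _ U z) (cg _)).
pose f (U : unitary_group R n) := [set z : S | g z0 / 2%:R < g (unitary_act U z)].
have := @compact_csphere R n; rewrite compact_cover => /(_ _ setT f) [U _||D _ Dcov].
- have /continuousP/(_ [set x | g z0 / 2%:R < x]) := cgU U; apply; exact: open_gt.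
- move=> z _; have [U Uz] := csphere_transitive z z0; exists U => //=.
  by rewrite /f /= Uz ltr_pdivrMr // ltr_pMr // ltr1n.
have int0 : \int[sigma]_z (\sum_(U <- D) g (unitary_act U z)) = 0.
  by rewrite Rintegral_sum // big1 // => U _; rewrite Rintegral_unitary.
have : g z0 / 2%:R <= 0.
  rewrite -int0 -[leLHS]Rintegral_csphere_cst; apply: le_Rintegral => //.
  - by apply: csphere_continuous_integrable; exact: cst_continuous.
  - by apply: csphere_continuous_integrable; exact: continuous_sum_R.
  - move=> z _; have [U /= UD Uz] := Dcov z I.
    apply: le_trans (ltW Uz) _; rewrite (big_fsetD1 U) //= lerDl.
    by apply: sumr_ge0 => V _; exact: g0.
by apply/negP; rewrite -ltNge divr_gt0.
Qed.

Local Notation cint := (cintegral sigma).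

Lemma continuous_ReF F : continuous F -> continuous (fun z => Re (F z)).
Proof. by move=> cF z; exact: (continuous_comp (cF z) (@continuous_Re _ _)). Qed.

Lemma continuous_ImF F : continuous F -> continuous (fun z => Im (F z)).
Proof. by move=> cF z; exact: (continuous_comp (cF z) (@continuous_Im _ _)). Qed.

Lemma eq_cintegral F G : F =1 G -> cint F = cint G.
Proof. by move=> /funext ->. Qed.

Lemma cintegralD F G : continuous F -> continuous G ->
  cint (fun z => F z + G z) = cint F + cint G.
Proof.
move=> cF cG; rewrite /cintegral; apply/eqP; rewrite eq_complex /=; apply/andP; split; apply/eqP.
  rewrite -RintegralD //; try (apply: csphere_continuous_integrable; exact: continuous_ReF).
  by apply: eq_Rintegral => z _; case: (F z) (G z) => [? ?] [].
rewrite -RintegralD //; try (apply: csphere_continuous_integrable; exact: continuous_ImF).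
by apply: eq_Rintegral => z _; case: (F z) (G z) => [? ?] [].
Qed.

Lemma cintegralZ (c : C) F : continuous F -> cint (fun z => c * F z) = c * cint F.
Proof.
move=> cF; have iR := csphere_continuous_integrable sigma (continuous_ReF cF).
have iI := csphere_continuous_integrable sigma (continuous_ImF cF).
have cR (r : R) : continuous (fun z => r * Re (F z)).
  by move=> z; apply: (@cvgM R S (nbhs z) _ (fun=> r)); [exact: cvg_cst|exact: continuous_ReF].
have cI (r : R) : continuous (fun z => r * Im (F z)).
  by move=> z; apply: (@cvgM R S (nbhs z) _ (fun=> r)); [exact: cvg_cst|exact: continuous_ImF].
case: c => a b; rewrite /cintegral; apply/eqP; rewrite eq_complex /=; apply/andP; split; apply/eqP.
  rewrite -!RintegralZl // -RintegralB //; try exact: csphere_continuous_integrable.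
  by apply: eq_Rintegral => z _; case: (F z).
rewrite -!RintegralZl // -RintegralD //; try exact: csphere_continuous_integrable.
by apply: eq_Rintegral => z _; case: (F z) => x y /=; rewrite addrC.
Qed.

Lemma cintegral_conj F : continuous F -> cint (fun z => (F z)^*) = (cint F)^*.
Proof.
move=> cF; rewrite /cintegral conj_conjc; apply/eqP; rewrite eq_complex /=; apply/andP; split; apply/eqP.
  by apply: eq_Rintegral => z _; case: (F z).
rewrite -mulN1r -RintegralZl //; last by apply: csphere_continuous_integrable; exact: continuous_ImF.
by apply: eq_Rintegral => z _; rewrite mulN1r; case: (F z).
Qed.

Lemma cintegral_real g : cint (fun z => (g z)%:C%C) = (\int[sigma]_z g z)%:C%C.
Proof.
rewrite /cintegral /=; apply/eqP; rewrite eq_complex /= eqxx /=.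
by apply/eqP; rewrite Rintegral_csphere_cst.
Qed.

Lemma cintegral_unitary (U : unitary_group R n) F : rotation_invariant sigma ->
  continuous F -> cint (fun z => F (unitary_act U z)) = cint F.
Proof.
move=> sinv cF; rewrite /cintegral; congr Complex.
  by rewrite (Rintegral_unitary U sinv (continuous_ReF cF)).
by rewrite (Rintegral_unitary U sinv (continuous_ImF cF)).
Qed.

(** The factor 2 comes from bounding the real and imaginary parts separately. *)
Lemma cintegral_le F g : continuous F -> continuous g ->
  (forall z, Re `|F z| <= g z) -> Re `|cint F| <= 2%:R * \int[sigma]_z g z.
Proof.
move=> cF cg Fg; have ig := csphere_continuous_integrable sigma cg.
have bnd (h : S -> R) : continuous h -> (forall z, `|h z| <= g z) ->
    `|\int[sigma]_z h z| <= \int[sigma]_z g z.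
  move=> ch hg; have ih := csphere_continuous_integrable sigma ch.
  apply: le_trans (le_normr_Rintegral measurableT ih) _.
  apply: le_Rintegral => //.
  apply: csphere_continuous_integrable => z.
  exact: (continuous_comp (ch z) (@norm_continuous _ R^o _)).
have normle (c : C) : Re `|c| <= `|Re c| + `|Im c|.
  rewrite -lecR RRe_norm rmorphD /=; case: c => a b /=.
  have -> : (a +i* b)%C = a%:C%C + 'i%C * b%:C%C by rewrite [LHS]complexE.
  apply: le_trans (ler_normD _ _) _; rewrite normrM !normc_def /=.
  by rewrite expr0n expr1n add0r sqrtr1 mul1r !addr0 !sqrtr_sqr.
apply: le_trans (normle _) _; rewrite mulr_natl mulr2n lerD //; apply: bnd.
- exact: continuous_ReF.
- by move=> z; apply: le_trans (Re_le_norm _) _.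
- exact: continuous_ImF.
- by move=> z; apply: le_trans (Im_le_norm _) _.
Qed.

End ComplexIntegral.

(** * Density of the polynomials *)

Module SphereKernel.
Section SphereKernel.
Variables (R : realType) (n : nat).
Local Notation C := R[i].
Local Notation N := n.+1.
Local Notation S := (csphere R n).
Local Notation Re := (@complex.Re R).
Local Notation zpoly := (mpoly (N + N) C).

Lemma eq_continuous_C (T : topologicalType) (F G : T -> C) :
  F =1 G -> continuous F -> continuous G.
Proof. by move=> /funext ->. Qed.

Lemma continuous_zeval (P : zpoly) : continuous (fun z : S => zeval P (\val z)).
Proof.
elim/mpoly_gen_ind: P => [c|k|P Q cP cQ|P Q cP cQ].
- apply: (@eq_continuous_C _ (fun=> c)); last exact: cst_continuous.
  by move=> z; rewrite /zeval mevalC.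
- have [j ->|j ->] := split_ordP k.
    apply: (@eq_continuous_C _ (fun z : S => (\val z : 'cV[C]_N) j ord0)).
      by move=> z; rewrite /zeval mevalXU -/(conj_point _ _) conj_pointl.
    exact: csphere_coord_continuous.
  apply: (@eq_continuous_C _ (fun z : S => ((\val z : 'cV[C]_N) j ord0)^*)).
    by move=> z; rewrite /zeval mevalXU -/(conj_point _ _) conj_pointr.
  by apply: continuous_conj_C; exact: csphere_coord_continuous.
- apply: (@eq_continuous_C _ (fun z : S => zeval P (\val z) + zeval Q (\val z))).
    by move=> z; rewrite /zeval mevalD.
  by move=> z; apply: (@cvgD C _ S (nbhs z)); [exact: cP|exact: cQ].
- apply: (@eq_continuous_C _ (fun z : S => zeval P (\val z) * zeval Q (\val z))).
    by move=> z; rewrite /zeval mevalM.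
  exact: (continuous_mul_C cP cQ).
Qed.

Definition zrestrict (P : zpoly) : CS R n := mkcts (@continuous_zeval P).

Lemma zrestrictE P z : zrestrict P z = zeval P (\val z).
Proof. by []. Qed.

Lemma zrestrict_is_linear : linear zrestrict.
Proof.
by move=> a P Q; apply/continuousEP => z; rewrite -[LHS]/(zeval _ _) /zeval mevalD mevalZ.
Qed.
HB.instance Definition _ := GRing.isLinear.Build C zpoly (CS R n) _ zrestrict zrestrict_is_linear.

Definition cts_const (c : C) : CS R n := mkcts (@cst_continuous S C c).

Definition cts_mul (f g : CS R n) : CS R n :=
  mkcts (continuous_mul_C (@cts_fun _ _ f) (@cts_fun _ _ g)).

(** Integrating a function of [w] against such a kernel gives the restriction of a polynomial in [z]
    and its conjugate. *)
Definition separable_kernel (F : S -> S -> C) :=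
  exists l : seq (CS R n * zpoly),
    forall z w, F z w = \sum_(x <- l) x.1 w * zeval x.2 (\val z).

Lemma separable_prod (g : CS R n) P : separable_kernel (fun z w => g w * zeval P (\val z)).
Proof. by exists [:: (g, P)] => z w; rewrite big_seq1. Qed.

Lemma separableD F G : separable_kernel F -> separable_kernel G ->
  separable_kernel (fun z w => F z w + G z w).
Proof. by move=> [l Fl] [k Gk]; exists (l ++ k) => z w; rewrite big_cat /= Fl Gk. Qed.

Lemma separable_sum (I : Type) (r : seq I) (F : I -> S -> S -> C) :
  (forall i, separable_kernel (F i)) -> separable_kernel (fun z w => \sum_(i <- r) F i z w).
Proof.
move=> sF; elim: r => [|i r IH].
  by exists [::] => z w; rewrite !big_nil.
have [l ml] := separableD (sF i) IH.
by exists l => z w; rewrite big_cons ml.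
Qed.

Lemma separableM F G : separable_kernel F -> separable_kernel G ->
  separable_kernel (fun z w => F z w * G z w).
Proof.
move=> [l Fl] [k Gk]; exists [seq (cts_mul x.1 y.1, x.2 * y.2) | x <- l, y <- k] => z w.
rewrite Fl Gk big_allpairs_dep mulr_suml; apply: eq_bigr => x _.
rewrite mulr_sumr; apply: eq_bigr => y _.
rewrite -[RHS]/(x.1 w * y.1 w * zeval (x.2 * y.2) (\val z)).
by rewrite /zeval mevalM; ring.
Qed.

Lemma separableX F m : separable_kernel F -> separable_kernel (fun z w => F z w ^+ m).
Proof.
move=> sF; elim: m => [|m IH].
  exists [:: (cts_const 1, mpolyC _ 1)] => z w.
  by rewrite big_seq1 -[RHS]/(1 * zeval _ _) /zeval mevalC mulr1.
by have [l ml] := separableM sF IH; exists l => z w; rewrite exprS ml.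
Qed.

(** It equals [1 - |z - w|^2 / 4] on the sphere: its values lie in [0, 1] and it is 1 only for
    [z = w], so its powers concentrate near the diagonal. *)
Definition cap_kernel (z w : S) : R := (1 + Re (hdot (\val w) (\val z))) / 2%:R.

Lemma separable_cap_kernel : separable_kernel (fun z w => (cap_kernel z w)%:C%C).
Proof.
have e1 z w : (cap_kernel z w)%:C%C = 2%:R^-1 * 1 +
    \sum_j ((4%:R^-1 * (\val w j ord0)^*) * \val z j ord0 +
            (4%:R^-1 * \val w j ord0) * (\val z j ord0)^*).
  rewrite big_split /=; pose h := hdot (\val w : 'cV[C]_N) (\val z).
  have -> : \sum_i 4%:R^-1 * (\val w i ord0)^* * \val z i ord0 = 4%:R^-1 * h.
    by rewrite /h mulr_sumr; apply: eq_bigr => i _; rewrite mulrA.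
  have -> : \sum_i 4%:R^-1 * \val w i ord0 * (\val z i ord0)^* = 4%:R^-1 * h^*.
    by rewrite /h hdotC mulr_sumr; apply: eq_bigr => i _; rewrite -mulrA [_ * _^*]mulrC.
  rewrite /cap_kernel -/h rmorphM fmorphV rmorphD rmorph1 rmorph_nat /= ReJ_add -conj_conjc.
  by field.
suff [l ml] : separable_kernel (fun z w => 2%:R^-1 * 1 +
    \sum_j ((4%:R^-1 * (\val w j ord0)^*) * \val z j ord0 +
            (4%:R^-1 * \val w j ord0) * (\val z j ord0)^*)).
  by exists l => z w; rewrite e1 ml.
apply: separableD.
  have [l ml] := separable_prod (cts_const 2%:R^-1) (mpolyC _ 1).
  by exists l => z w; rewrite -ml /zeval mevalC.
apply: separable_sum => j; apply: separableD.
  have cw : continuous (fun w : S => 4%:R^-1 * (\val w j ord0)^*).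
    apply: continuous_mul_C; first exact: cst_continuous.
    by apply: continuous_conj_C; exact: csphere_coord_continuous.
  have [l ml] := separable_prod (mkcts cw) (zl C j).
  by exists l => z w; rewrite -ml /zeval mevalXU -/(conj_point _ _) conj_pointl.
have cw : continuous (fun w : S => 4%:R^-1 * \val w j ord0).
  by apply: continuous_mul_C; [exact: cst_continuous|exact: csphere_coord_continuous].
have [l ml] := separable_prod (mkcts cw) (zr C j).
by exists l => z w; rewrite -ml /zeval mevalXU -/(conj_point _ _) conj_pointr.
Qed.

End SphereKernel.
End SphereKernel.
Import SphereKernel.

Section CapKernel.
Variables (R : realType) (n : nat).
Local Notation C := R[i].
Local Notation N := n.+1.
Local Notation S := (csphere R n).
Local Notation Re := (@complex.Re R).

Lemma continuous_Re_norm (T : topologicalType) (F : T -> C) :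
  continuous F -> continuous (fun x => Re `|F x|).
Proof.
move=> cF x.
have cN : {for x, continuous (fun x => `|F x|)}.
  exact: (continuous_comp (cF x) (@norm_continuous C C^o (F x))).
exact: (@continuous_comp T C R (fun x => `|F x|) Re x cN (@continuous_Re R _)).
Qed.

Lemma hdot_unitary (U : unitary_group R n) (z w : 'cV[C]_N) :
  hdot (val U *m z) (val U *m w) = hdot z w.
Proof.
have : (hdot (val U *m z) (val U *m w))%:M = (hdot z w)%:M :> 'M[C]_1.
  rewrite -!hdotE trmx_mul map_mxM -mulmxA (mulmxA _ (val U)).
  by have /unitarymxP/mulmx1C -> := valP U; rewrite mul1mx.
by move=> /matrixP/(_ ord0 ord0); rewrite !mxE eqxx !mulr1n.
Qed.

Lemma cap_kernel_unitary (U : unitary_group R n) (z w : S) :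
  cap_kernel (unitary_act U z) (unitary_act U w) = cap_kernel z w.
Proof. by rewrite /cap_kernel hdot_unitary. Qed.

Lemma hdot_ge0 (v : 'cV[C]_N) : 0 <= Re (hdot v v).
Proof.
rewrite hdotvv; have : 0 <= \sum_j `|v j ord0| ^+ 2.
  by apply: sumr_ge0 => j _; exact: exprn_ge0.
by rewrite lecE => /andP[].
Qed.

Lemma Re_hdotC (v w : 'cV[C]_N) : Re (hdot v w) = Re (hdot w v).
Proof. by rewrite -hdotC; case: (hdot w v). Qed.

Lemma Re_hdot_sphereB (z w : S) :
  Re (hdot (\val z - \val w) (\val z - \val w)) = 4%:R * (1 - cap_kernel z w).
Proof.
rewrite hdotBl !hdotBr !ReB !hdot_csphere /= (Re_hdotC (\val z)) /cap_kernel.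
by field.
Qed.

Lemma hdotNl (v w : 'cV[C]_N) : hdot (- v) w = - hdot v w.
Proof. by rewrite -sumrN; apply: eq_bigr => j _; rewrite !mxE rmorphN mulNr. Qed.

Lemma hdotNr (v w : 'cV[C]_N) : hdot v (- w) = - hdot v w.
Proof. by rewrite -sumrN; apply: eq_bigr => j _; rewrite !mxE mulrN. Qed.

Lemma Re_hdot_sphereD (z w : S) :
  Re (hdot (\val z - - \val w) (\val z - - \val w)) = 4%:R * cap_kernel z w.
Proof.
have ReN (c : C) : Re (- c) = - Re c by case: c.
rewrite hdotBl !hdotBr !hdotNl !hdotNr !(ReB, ReN) !hdot_csphere /= (Re_hdotC (\val z)) /cap_kernel.
by field.
Qed.

Lemma cap_kernel_le1 (z w : S) : cap_kernel z w <= 1.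
Proof.
by rewrite -subr_ge0 -(@pmulr_rge0 _ 4%:R) // -Re_hdot_sphereB hdot_ge0.
Qed.

Lemma cap_kernel_ge0 (z w : S) : 0 <= cap_kernel z w.
Proof. by rewrite -(@pmulr_rge0 _ 4%:R) // -Re_hdot_sphereD hdot_ge0. Qed.

Lemma cap_kernel_diag (z : S) : cap_kernel z z = 1.
Proof. by rewrite /cap_kernel hdot_csphere /=; field. Qed.

Lemma cap_kernel_eq1 (z w : S) : cap_kernel z w = 1 -> z = w.
Proof.
move=> k1; have := Re_hdot_sphereB z w; rewrite k1 subrr mulr0 => h0.
have : hdot (\val z - \val w) (\val z - \val w) = 0.
  rewrite -[LHS](@RRe_real R) ?h0 // hdotvv; apply: ger0_real.
  by apply: sumr_ge0 => j _; exact: exprn_ge0.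
by move=> /hdotvv_eq0 /eqP; rewrite subr_eq0 => /eqP /val_inj.
Qed.

Lemma continuous_cap_kernel : continuous (fun x : S * S => cap_kernel x.1 x.2).
Proof.
pose F (x : S * S) : C := \sum_j (\val x.2 j ord0)^* * \val x.1 j ord0.
have cF : continuous F.
  apply: (@continuous_sum_C R _ _ (index_enum 'I_N)
    (fun j (x : S * S) => (\val x.2 j ord0)^* * \val x.1 j ord0)) => j.
  apply: (@continuous_mul_C R _ (fun x : S * S => (\val x.2 j ord0)^*)
    (fun x : S * S => \val x.1 j ord0)).
    apply: (@continuous_conj_C R _ (fun x : S * S => \val x.2 j ord0)) => x.
    exact: (continuous_comp (@cvg_snd _ _ _ _ _) (@csphere_coord_continuous R n j x.2)).
  move=> x.
  exact: (continuous_comp (@cvg_fst _ _ _ _ _) (@csphere_coord_continuous R n j x.1)).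
move=> x; apply: (@cvgM R _ (nbhs x) _ (fun x => 1 + Re (F x)) (fun=> 2%:R^-1)); last exact: cvg_cst.
apply: (@cvgD R R^o _ (nbhs x) _ (fun=> 1)); first exact: cvg_cst.
exact: (continuous_comp (cF x) (@continuous_Re R (F x))).
Qed.

(** This is uniform continuity with nearness measured by the kernel. The bad pairs form a compact
    set off the diagonal, where the kernel attains a maximum smaller than 1. *)
Lemma uniform_cap (f : S -> C) (e : R) : continuous f -> 0 < e ->
  exists r : R, [/\ 0 <= r, r < 1 & forall z w, r < cap_kernel z w -> Re `|f z - f w| < e].
Proof.
move=> cf e0; pose g (x : S * S) : R := Re `|f x.1 - f x.2|.
have cg : continuous g.
  apply: (@continuous_Re_norm _ (fun x : S * S => f x.1 - f x.2)) => x.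
  apply: (@cvgB C C^o _ (nbhs x)).
    exact: (continuous_comp (@cvg_fst _ _ _ _ _) (cf x.1)).
  exact: (continuous_comp (@cvg_snd _ _ _ _ _) (cf x.2)).
pose Bad : set (S * S) := g @^-1` [set t | e <= t].
have [[x0 Bx0]|nBad] := pselect (Bad !=set0); last first.
  exists 0; split=> // z w _; rewrite ltNge; apply/negP => egt.
  by apply: nBad; exists (z, w).
have cBad : compact Bad.
  apply: (@subclosed_compact _ _ ([set: S] `*` [set: S])) => //.
    by apply: closed_comp => [x _|]; [exact: cg|exact: closed_ge].
  by apply: compact_setX; exact: compact_csphere.
have cK : {within Bad, continuous (fun x : S * S => cap_kernel x.1 x.2)}.
  by apply: continuous_subspaceT; exact: continuous_cap_kernel.
have [c /set_mem cB cmax] := compact_EVT_max (ex_intro _ x0 Bx0) cBad cK.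
exists (cap_kernel c.1 c.2); split.
- exact: cap_kernel_ge0.
- rewrite lt_neqAle cap_kernel_le1 andbT; apply/eqP => /cap_kernel_eq1 c12.
  by move: cB; rewrite /Bad /= /g c12 subrr normr0 leNgt /= e0.
- move=> z w rk; rewrite ltNge; apply/negP => egt.
  have /= := cmax (z, w) (mem_set (egt : Bad (z, w))).
  by rewrite leNgt rk.
Qed.

End CapKernel.

Section Density.
Variables (R : realType) (n : nat) (sigma : probability (csphere R n) R).
Hypothesis sigma_inv : rotation_invariant sigma.
Local Notation C := R[i].
Local Notation N := n.+1.
Local Notation S := (csphere R n).
Local Notation Re := (@complex.Re R).
Local Notation zpoly := (mpoly (N + N) C).
Local Notation cint := (cintegral sigma).

Lemma Re_normM_real (x : C) (a : R) : 0 <= a -> Re `|x * a%:C%C| = Re `|x| * a.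
Proof.
move=> a0; apply: (@complexI R); rewrite RRe_norm normrM rmorphM /= RRe_norm.
by congr (_ * _); rewrite ger0_norm // ler0c.
Qed.

Lemma continuous_cap_kernel_r (z : S) m : continuous (fun w => cap_kernel z w ^+ m).
Proof.
have ck : continuous (fun w : S => cap_kernel z w).
  move=> w; have cp : {for w, continuous (fun w : S => (z, w))}.
    exact: (@cvg_pair _ _ _ (nbhs w) (nbhs z) (nbhs w) _ _ _ (fun=> z) id (cvg_cst z) cvg_id).
  exact: (continuous_comp cp (@continuous_cap_kernel R n (z, w))).
by move=> w; exact: (continuous_comp (ck w) (@exprn_continuous R m _)).
Qed.

(** A unitary map moves one centre to the other and preserves the kernel and [sigma], so one
    normalizing constant serves all centres. *)
Lemma cap_mass_const (z w : S) m :
  \int[sigma]_x (cap_kernel z x ^+ m) = \int[sigma]_x (cap_kernel w x ^+ m).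
Proof.
have [U <-] := csphere_transitive w z.
rewrite -(Rintegral_unitary U sigma_inv (@continuous_cap_kernel_r (unitary_act U w) m)).
by apply: eq_Rintegral => x _; rewrite cap_kernel_unitary.
Qed.

Lemma cintegral_separable (f : CS R n) (l : seq (CS R n * zpoly)) (a : zpoly -> C) :
  cint (fun w => f w * \sum_(x <- l) x.1 w * a x.2) =
  \sum_(x <- l) cint (fun w => f w * x.1 w) * a x.2.
Proof.
have cfg (g : CS R n) : continuous (fun w => f w * g w).
  exact: (continuous_mul_C (@cts_fun _ _ f) (@cts_fun _ _ g)).
have cl (k : seq (CS R n * zpoly)) : continuous (fun w => f w * \sum_(x <- k) x.1 w * a x.2).
  have cs : continuous (fun w => \sum_(x <- k) x.1 w * a x.2).
    apply: (@continuous_sum_C R S _ k (fun x w => x.1 w * a x.2)) => x.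
    exact: (continuous_mul_C (@cts_fun _ _ x.1) (@cst_continuous S C (a x.2))).
  exact: (continuous_mul_C (@cts_fun _ _ f) cs).
elim: l => [|x l IH].
  rewrite big_nil -[RHS](mul0r (cint (fun w => f w))) -cintegralZ; last exact: cts_fun.
  by apply: eq_cintegral => w; rewrite big_nil mulr0 mul0r.
rewrite big_cons -IH mulrC -cintegralZ; last exact: cfg.
rewrite -cintegralD; last exact: cl.
  by apply: eq_cintegral => w; rewrite big_cons; ring.
exact: (continuous_mul_C (@cst_continuous S C (a x.2)) (cfg x.1)).
Qed.

(** The powers of the kernel, divided by their mass [c], form an approximate identity. Where the
    kernel exceeds [r], [f] varies by less than [e / 4]; elsewhere the weight is at most [r ^+ m],
    which is negligible against [c >= s ^+ m * eta] because [r < s]. *)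
Lemma zpoly_dense (f : CS R n) (e : R) : 0 < e ->
  exists P : zpoly, forall z, Re `|f z - zrestrict P z| <= e.
Proof.
move=> e0; have cf : continuous f by exact: cts_fun.
have [r [r0 r1 fr]] := @uniform_cap R n f (e / 4%:R) cf (divr_gt0 e0 (ltr0n _ 4)).
have cNf := continuous_Re_norm cf.
have [M M0 fM'] := csphere_continuous_bounded cNf.
have fM z : Re `|f z| <= M by apply: le_trans (ler_norm _) (fM' z).
pose s := (1 + r) / 2%:R.
have s0 : 0 < s by rewrite divr_gt0 // ltr_pwDl.
have s1 : s < 1 by rewrite ltr_pdivrMr // mul1r ltrD2l.
have rs : r < s by rewrite ltr_pdivlMr // mulr_natr mulr2n ltrD2r.
pose p : S := point.
pose x (w : S) := cap_kernel p w - s.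
have half (t : R) : (t + t) / 2%:R = t by field.
(* The positive part of [x] is a continuous function below the indicator of the cap
   [cap_kernel p w > s]; it bounds [c] from below. *)
pose bump (w : S) := (`|x w| + x w) / 2%:R.
have cx : continuous x.
  move=> w; apply: (@cvgB R R^o _ (nbhs w)); last exact: cvg_cst.
  exact: (@continuous_cap_kernel_r p 1 w).
have cbump : continuous bump.
  move=> w; apply: (@cvgM R _ (nbhs w) _ (fun w => `|x w| + x w) (fun=> 2%:R^-1)); last exact: cvg_cst.
  apply: (@cvgD R R^o _ (nbhs w)); last exact: cx.
  exact: (continuous_comp (cx w) (@norm_continuous R R^o _)).
have bump0 w : 0 <= bump w by rewrite divr_ge0 // -lerBlDr sub0r ler_normr lexx orbT.
have bumpE w : bump w <= if s < cap_kernel p w then 1 else 0.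
  rewrite /bump /x; case: ltP => h.
    rewrite ger0_norm ?subr_ge0 ?(ltW h) // half.
    by rewrite lerBlDr ler_wpDr ?cap_kernel_le1 // ltW.
  by rewrite ler0_norm ?subr_le0 // addNr mul0r.
pose eta := \int[sigma]_w bump w.
have eta0 : 0 < eta.
  rewrite lt_neqAle Rintegral_ge0 ?andbT //; apply/eqP => h.
  have := Rintegral_eq0 sigma_inv cbump bump0 (esym h) p.
  rewrite /bump /x cap_kernel_diag ger0_norm ?subr_ge0 ?(ltW s1) // half.
  by move=> /eqP; rewrite subr_eq0 eq_sym (lt_eqF s1).
(* The constants are such that the far part, at most [4 M r^m] after the factor 2 of [cintegral_le],
   is at most [e c / 2], as is the near part. *)
have [m mE] : exists m : nat, (r / s) ^+ m <= e * eta / (8%:R * M).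
  have rs0 : 0 <= r / s by rewrite divr_ge0 // ltW.
  have rs1 : `|r / s| < 1 by rewrite ger0_norm // ltr_pdivrMr // mul1r.
  have t0 : 0 < e * eta / (8%:R * M) by rewrite divr_gt0 ?mulr_gt0.
  have /cvgr_dist_lt/(_ _ t0) [m _ /(_ m (leqnn m))] := cvg_expr rs1.
  rewrite /= sub0r normrN ger0_norm ?exprn_ge0 // => /ltW h.
  by exists m.
pose c := \int[sigma]_w (cap_kernel p w ^+ m).
have ig z := csphere_continuous_integrable sigma (@continuous_cap_kernel_r z m).
have ceta : s ^+ m * eta <= c.
  rewrite /eta -RintegralZl //; last exact: csphere_continuous_integrable.
  apply: le_Rintegral => //.
    apply: (@csphere_continuous_integrable R n sigma (fun w => s ^+ m * bump w)) => w.
    by apply: (@cvgM R _ (nbhs w) _ (fun=> s ^+ m)); [exact: cvg_cst|exact: cbump].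
  move=> w _; apply: le_trans (ler_wpM2l (exprn_ge0 _ (ltW s0)) (bumpE w)) _.
  case: ifP => sk; rewrite ?mulr1 ?mulr0 ?exprn_ge0 ?cap_kernel_ge0 //.
  by rewrite lerXn2r // ?nnegrE ?cap_kernel_ge0 // ltW.
have c0 : 0 < c by apply: lt_le_trans ceta; rewrite mulr_gt0 // exprn_gt0.
have [l lE] := separableX m (@separable_cap_kernel R n).
exists (\sum_(y <- l) ((c^-1)%:C%C * cint (fun w => f w * y.1 w)) *: y.2) => z.
have ckC : continuous (fun w => (cap_kernel z w ^+ m)%:C%C : C).
  move=> w.
  exact: (continuous_comp (@continuous_cap_kernel_r z m w) (@continuous_real_complex R _)).
have cfk : continuous (fun w => f w * (cap_kernel z w ^+ m)%:C%C).
  exact: (continuous_mul_C cf ckC).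
set P := \sum_(y <- l) _.
have PE : zrestrict P z * c%:C%C = cint (fun w => f w * (cap_kernel z w ^+ m)%:C%C).
  have -> : cint (fun w => f w * (cap_kernel z w ^+ m)%:C%C) =
      cint (fun w => f w * \sum_(y <- l) y.1 w * zeval y.2 (\val z)).
    by apply: eq_cintegral => w; rewrite -lE rmorphXn.
  rewrite (cintegral_separable f l (fun P => zeval P (\val z))).
  rewrite zrestrictE /zeval /P raddf_sum /= mulr_suml; apply: eq_bigr => y _.
  rewrite mevalZ mulrAC; congr (_ * _).
  by rewrite mulrAC -rmorphM /= mulVf ?mul1r // gt_eqF.
have fE : f z * c%:C%C = cint (fun w => f z * (cap_kernel z w ^+ m)%:C%C).
  rewrite (cintegralZ sigma (f z) ckC) (cintegral_real sigma (fun w => cap_kernel z w ^+ m)).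
  by rewrite (cap_mass_const z p).
rewrite -(ler_pM2r c0) -Re_normM_real ?(ltW c0) // mulrBl PE fE.
pose F w := (f z - f w) * (cap_kernel z w ^+ m)%:C%C.
have cF : continuous F.
  have cB : continuous (fun w => f z - f w).
    by move=> w; apply: (@cvgB C C^o _ (nbhs w) _ (fun=> f z)); [exact: cvg_cst|exact: cf].
  exact: (continuous_mul_C cB ckC).
have -> : cint (fun w => f z * (cap_kernel z w ^+ m)%:C%C) -
    cint (fun w => f w * (cap_kernel z w ^+ m)%:C%C) = cint F.
  apply/eqP; rewrite subr_eq -(cintegralD sigma cF cfk); apply/eqP; apply: eq_cintegral => w.
  by rewrite /F mulrBl subrK.
pose g w := e / 4%:R * cap_kernel z w ^+ m + 2%:R * M * r ^+ m.
have ckz : continuous (fun w => e / 4%:R * cap_kernel z w ^+ m).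
  move=> w; apply: (@cvgM R _ (nbhs w) _ (fun=> e / 4%:R)); first exact: cvg_cst.
  exact: (@continuous_cap_kernel_r z m w).
have cg : continuous g.
  by move=> w; apply: (@cvgD R R^o _ (nbhs w)); [exact: ckz|exact: cvg_cst].
apply: le_trans (cintegral_le sigma cF cg _) _.
  move=> w; rewrite /F Re_normM_real ?exprn_ge0 ?cap_kernel_ge0 // /g.
  have [rk|kr] := ltP r (cap_kernel z w).
    apply: ler_wpDr; first by rewrite !mulr_ge0 ?exprn_ge0 // ltW.
    by rewrite ler_wpM2r ?exprn_ge0 ?cap_kernel_ge0 // ltW // fr.
  apply: ler_wpDl; first by rewrite mulr_ge0 ?exprn_ge0 ?cap_kernel_ge0 // divr_ge0 // ltW.
  have nle : Re `|f z - f w| <= 2%:R * M.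
    apply: le_trans (_ : Re `|f z| + Re `|f w| <= _); last by rewrite mulr_natl mulr2n lerD.
    by rewrite -lecR rmorphD /= !RRe_norm ler_normB.
  apply: ler_pM => //; rewrite ?exprn_ge0 ?cap_kernel_ge0 //.
    exact: le_trans (normr_ge0 _) (Re_le_norm _).
  by rewrite lerXn2r ?nnegrE ?cap_kernel_ge0.
rewrite /g RintegralD //; last 2 first.
- exact: (@csphere_continuous_integrable R n sigma (fun w => e / 4%:R * cap_kernel z w ^+ m) ckz).
- by apply: csphere_continuous_integrable; exact: cst_continuous.
rewrite RintegralZl // Rintegral_csphere_cst (cap_mass_const z p) -/c mulrDr.
have h : r ^+ m <= e / (8%:R * M) * c.
  have sm0 : 0 < s ^+ m by rewrite exprn_gt0.
  move: mE; rewrite exprMn exprVn ler_pdivrMr // => /le_trans; apply.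
  apply: le_trans (_ : e / (8%:R * M) * (s ^+ m * eta) <= _).
    by rewrite le_eqVlt; apply/orP; left; apply/eqP; ring.
  by rewrite ler_wpM2l // divr_ge0 ?mulr_ge0 // ltW.
have M80 : M != 0 by rewrite gt_eqF.
apply: le_trans (_ : 2%:R * (e / 4%:R * c) + 2%:R * (2%:R * M * (e / (8%:R * M) * c)) <= _).
  by rewrite lerD2l ler_pM2l // ler_wpM2l // mulr_ge0 // ltW.
by rewrite le_eqVlt; apply/orP; left; apply/eqP; field.
Qed.

End Density.

(** * Invariant subspaces and equivariant projections *)

Section HermitianProjection.
Variables (C : numClosedFieldType) (V : lmodType C) (dot : V -> V -> C).
Hypothesis dot_linear : forall w, scalar (dot^~ w).
Hypothesis dotC : forall v w, dot w v = (dot v w)^*.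
Hypothesis dot_ge0 : forall v, 0 <= dot v v.
Hypothesis dot_eq0 : forall v, dot v v = 0 -> v = 0.

Let dot0 w : dot 0 w = 0.
Proof. by have := dot_linear w 1 0 0; rewrite scaler0 addr0 mul1r => /eqP; rewrite eq_sym -subr_eq0 addrK => /eqP. Qed.

Let dotD u v w : dot (u + v) w = dot u w + dot v w.
Proof. by have := dot_linear w 1 u v; rewrite scale1r mul1r. Qed.

Let dotZ a u w : dot (a *: u) w = a * dot u w.
Proof. by have := dot_linear w a u 0; rewrite addr0 dot0 addr0. Qed.

Let dotN u w : dot (- u) w = - dot u w.
Proof. by rewrite -scaleN1r dotZ mulN1r. Qed.

Let dot_sum I (r : seq I) (F : I -> V) w : dot (\sum_(i <- r) F i) w = \sum_(i <- r) dot (F i) w.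
Proof. by elim: r => [|i r IH]; rewrite ?big_nil ?dot0 // !big_cons dotD IH. Qed.

Let dotZr a u w : dot w (a *: u) = a^* * dot w u.
Proof. by rewrite dotC dotZ rmorphM /= -dotC. Qed.

Definition orthonormal k (c : 'I_k -> V) := forall i j, dot (c i) (c j) = (i == j)%:R.

Definition linear_subspace (B : set V) :=
  B 0 /\ forall a u v, B u -> B v -> B (a *: u + v).

Lemma linear_subspace_sum (B : set V) (I : eqType) (r : seq I) (a : I -> C) (F : I -> V) :
  linear_subspace B -> (forall i, i \in r -> B (F i)) -> B (\sum_(i <- r) a i *: F i).
Proof.
move=> [B0 BL]; elim: r => [|i r IH] BF; first by rewrite big_nil.
rewrite big_cons; apply: BL; first by apply: BF; rewrite mem_head.
by apply: IH => j jr; apply: BF; rewrite in_cons jr orbT.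
Qed.

Definition expansion k (c : 'I_k -> V) v := \sum_i dot v (c i) *: c i.

Lemma dot_expansion k (c : 'I_k -> V) v j : orthonormal c ->
  dot (expansion c v) (c j) = dot v (c j).
Proof.
move=> oc; rewrite dot_sum (bigD1 j) //= dotZ oc eqxx mulr1 big1 ?addr0 // => i ij.
by rewrite dotZ oc (negPf ij) mulr0.
Qed.

(** With [k > m] the coefficient matrix has a nonzero left kernel vector, a linear relation that
    pairing with each [c i] makes trivial. *)
Lemma orthonormal_bound k m (c : 'I_k -> V) (b : 'I_m -> V) : orthonormal c ->
  (forall i, range (fun x : 'I_m -> C => \sum_j x j *: b j) (c i)) -> (k <= m)%N.
Proof.
move=> oc cb; rewrite leqNgt; apply/negP => mk.
pose x i := sval (cid2 (cb i)).
have cE i : c i = \sum_j x i j *: b j by rewrite /x; case: cid2.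
pose M : 'M[C]_(k, m) := \matrix_(i, j) x i j.
have : kermx M != 0.
  by rewrite kermx_eq0 /row_free neq_ltn (leq_ltn_trans (rank_leq_col M) mk).
case/rowV0Pn => v /sub_kermxP vM /eqP; apply; apply/rowP => i; rewrite mxE.
have s0 : \sum_i v ord0 i *: c i = 0.
  under eq_bigr do rewrite cE scaler_sumr.
  rewrite exchange_big big1 //= => j _; under eq_bigr do rewrite scalerA.
  rewrite -scaler_suml; have := congr1 (fun A : 'rV_m => A ord0 j) vM.
  rewrite !mxE => E; rewrite (eq_bigr (fun i => v ord0 i * M i j)) ?E ?scale0r // => i' _.
  by rewrite mxE.
have := congr1 (dot^~ (c i)) s0; rewrite /= dot0 dot_sum (bigD1 i) //= dotZ oc eqxx mulr1.
by rewrite big1 ?addr0 // => j ji; rewrite dotZ oc (negPf ji) mulr0.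
Qed.

Lemma orthonormal_extend k (c : 'I_k -> V) w : orthonormal c -> w != 0 ->
  (forall i, dot w (c i) = 0) ->
  exists a : C, orthonormal (fun i : 'I_k.+1 => oapp c (a *: w) (unlift ord_max i)).
Proof.
move=> oc w0 wc; pose s := dot w w; pose a := (sqrtC s)^-1; exists a => i j.
have s0 : s != 0 by apply: contraNneq w0 => /dot_eq0 ->.
have areal : a^* = a by rewrite /a conj_Creal // realV ger0_real // sqrtC_ge0 dot_ge0.
case: (unliftP ord_max i) => [i' ->|->]; case: (unliftP ord_max j) => [j' ->|->] /=.
- by rewrite oc (inj_eq (@lift_inj _ ord_max)).
- by rewrite dotZr dotC wc conjC0 mulr0 eq_sym (negPf (neq_lift _ _)).
- by rewrite dotZ wc mulr0 (negPf (neq_lift _ _)).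
- rewrite dotZ dotZr areal eqxx mulrA -/s -[X in _ * X](sqrtCK s) /a expr2 mulrACA.
  by rewrite !mulVf ?mulr1 // sqrtC_eq0.
Qed.

(** By [orthonormal_bound] there is an orthonormal family in [B] of maximal size; a vector different
    from its expansion would extend it. *)
Lemma orthonormal_basis m (b : 'I_m -> V) (B : set V) : linear_subspace B ->
  B `<=` range (fun x : 'I_m -> C => \sum_j x j *: b j) ->
  exists (k : nat) (c : 'I_k -> V),
    [/\ orthonormal c, forall i, B (c i) & forall v, B v -> expansion c v = v].
Proof.
move=> Bsub Bb.
pose P k := `[< exists c : 'I_k -> V, orthonormal c /\ forall i, B (c i) >].
have P0 : exists k, P k.
  by exists 0%N; apply/asboolP; exists (fun=> 0); split; case.
have Pm k : P k -> (k <= m)%N.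
  by move=> /asboolP[c [oc Bc]]; apply: (orthonormal_bound oc) => i; exact: Bb.
case: (ex_maxnP P0 Pm) => k /asboolP[c [oc Bc]] kmax.
exists k, c; split=> // v Bv; pose w := v - expansion c v.
have Bw : B w.
  have [_ BL] := Bsub; rewrite /w addrC -scaleN1r; apply: BL => //.
  by apply: linear_subspace_sum => // i _; exact: Bc.
have wc i : dot w (c i) = 0 by rewrite /w dotD dotN dot_expansion // subrr.
have [/eqP|w0] := eqVneq w 0; first by rewrite subr_eq0 eq_sym => /eqP.
have [a oc'] := orthonormal_extend oc w0 wc.
suff : P k.+1 by move=> /kmax; rewrite ltnn.
apply/asboolP; exists (fun i => oapp c (a *: w) (unlift ord_max i)); split=> // i.
case: unliftP => [j _|_] /=; first exact: Bc.
by have [B0 BL] := Bsub; rewrite -[_ *: _]addr0; apply: BL.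
Qed.

Lemma hermitian_projection m (b : 'I_m -> V) (B : set V) : linear_subspace B ->
  B `<=` range (fun x : 'I_m -> C => \sum_j x j *: b j) ->
  exists P : {linear V -> V}, [/\ forall v, B (P v), forall v, B v -> P v = v &
    forall v w, B w -> dot (v - P v) w = 0].
Proof.
move=> Bsub Bb; have [k [c [oc Bc cB]]] := orthonormal_basis Bsub Bb.
have lin : linear (expansion c).
  move=> a u v; rewrite /expansion scaler_sumr -big_split /=; apply: eq_bigr => i _.
  by rewrite dot_linear scalerDl scalerA.
pose P : {linear V -> V} := HB.pack (expansion c) (GRing.isLinear.Build _ _ _ _ _ lin).
exists P; split=> [v|//|v w Bw].
  by apply: linear_subspace_sum => // i _; exact: Bc.
rewrite -(cB w Bw) dotC dot_sum big1 ?conjC0 // => i _.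
by rewrite dotZ [dot (c i) _]dotC dotD dotN dot_expansion // subrr conjC0 mulr0.
Qed.

End HermitianProjection.

(** * Bidegrees of harmonic polynomials are visible on the sphere *)

Section SphereUniqueness.
Variables (C : numClosedFieldType) (n : nat).
Local Notation N := n.+1.
Local Notation zpoly := (mpoly (N + N) C).
Implicit Types (P Q : zpoly) (z w : 'cV[C]_N).
Local Notation e0 := (delta_mx ord0 ord0 : 'cV[C]_N).
Local Notation r2 := (@sqnorm_mpoly C N).
Local Notation "'Δ'" := (@laplacian C N).

Lemma zeval_atM z P Q : zeval_at z (P * Q) = zeval_at z P * zeval_at z Q.
Proof. exact: mevalM. Qed.

Lemma zeval_at_bidegree (p q : nat) P (a : C) z : bidegree p%:R q%:R P ->
  zeval_at (a *: z) P = a ^+ p * a^* ^+ q * zeval_at z P.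
Proof. exact: bidegree_bihomogeneous. Qed.

Lemma hdot_e0 : hdot e0 e0 = 1.
Proof.
rewrite /hdot (bigD1 ord0) //= big1 => [|j /negPf j0].
  by rewrite mxE eqxx /= rmorph1 mulr1 addr0.
by rewrite mxE j0 rmorph0 mul0r.
Qed.

Lemma zeval_at_sqnorm z : zeval_at z r2 = hdot z z.
Proof. by rewrite /zeval_at zeval_sqnorm hdotvv. Qed.

Lemma polar_decomposition z : exists a w, z = a *: w /\ hdot w w = 1.
Proof.
have [->|z0] := eqVneq z 0; first by exists 0, e0; rewrite scale0r hdot_e0.
have s0 : hdot z z != 0 by apply: contraNneq z0 => /hdotvv_eq0 ->.
have sge0 : 0 <= hdot z z.
  by rewrite hdotvv; apply: sumr_ge0 => j _; exact: exprn_ge0.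
pose a := sqrtC (hdot z z); have a0 : a != 0 by rewrite sqrtC_eq0.
have areal : a^* = a by rewrite conj_Creal // ger0_real // sqrtC_ge0.
exists a, (a^-1 *: z); split; first by rewrite scalerA divff // scale1r.
rewrite /hdot (eq_bigr (fun j => a^-1 ^+ 2 * ((z j ord0)^* * z j ord0))) => [|j _].
  by rewrite -mulr_sumr -/(hdot z z) -(sqrtCK (hdot z z)) -/a -exprMn mulVf // expr1n.
by rewrite !mxE rmorphM fmorphV /= areal; ring.
Qed.

Lemma sqnorm_mpoly_neq0 : r2 != 0.
Proof.
apply/eqP => r0; have := zeval_at_sqnorm e0; rewrite r0 hdot_e0 linear0 => /eqP.
by rewrite eq_sym oner_eq0.
Qed.

Lemma bidegree_sqnormX k (x y : C) P : bidegree x y P ->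
  bidegree (x + k%:R) (y + k%:R) (r2 ^+ k * P).
Proof.
move=> Pxy; elim: k => [|k IH]; first by rewrite !addr0 expr0 mul1r.
by rewrite exprS -mulrA -natr1 !addrA; exact: bidegree_sqnorm.
Qed.

(** Homogeneity extends the equality on the sphere to [Q = r2 ^+ k * P]. For [k > 0] this is r²
    times a nonzero polynomial, which cannot be harmonic by [laplacian_sqnorm_eq0]. *)
Lemma sphere_harmonic_shift p q k P Q : P != 0 ->
  bidegree p%:R q%:R P -> bidegree (p + k)%:R (q + k)%:R Q -> Δ Q = 0 ->
  (forall z, hdot z z = 1 -> zeval_at z P = zeval_at z Q) -> k = 0%N.
Proof.
move=> P0 Ppq Qpq Q0 PQ.
have QE : Q = r2 ^+ k * P.
  apply/eqP; rewrite -subr_eq0; apply/eqP; apply: zeval_eq0 => z.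
  rewrite -/(zeval_at z _) linearB /= zeval_atM.
  have -> : zeval_at z (r2 ^+ k) = hdot z z ^+ k.
    by rewrite -zeval_at_sqnorm /zeval_at rmorphXn.
  have [a [w [-> w1]]] := polar_decomposition z.
  rewrite !(zeval_at_bidegree _ _ Ppq) !(zeval_at_bidegree _ _ Qpq) PQ //.
  have -> : hdot (a *: w) (a *: w) = a^* * a.
    rewrite -[RHS]mulr1 -w1 /hdot mulr_sumr; apply: eq_bigr => j _.
    by rewrite !mxE rmorphM /=; ring.
  by rewrite !exprD exprMn; ring.
case: k Qpq QE => // k Qpq QE; case/eqP: P0.
have := Q0; rewrite QE exprS -mulrA.
have := @laplacian_sqnorm_eq0 C N (p + k + (q + k))%N (p%:R + k%:R) (q%:R + k%:R) (r2 ^+ k * P).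
move=> H /H {H} H; have /eqP : r2 ^+ k * P = 0.
  by apply: H => //; [exact: bidegree_sqnormX|rewrite !natrD].
by rewrite mulf_eq0 expf_eq0 (negPf sqnorm_mpoly_neq0) andbF => /eqP.
Qed.

(** Multiplying a point by scalars of modulus 1 reveals the difference of the two degrees;
    [sphere_harmonic_shift] then excludes a common shift. *)
Lemma sphere_harmonic_unique p q p' q' P Q : P != 0 ->
  bidegree p%:R q%:R P -> bidegree p'%:R q'%:R Q -> Δ P = 0 -> Δ Q = 0 ->
  (forall z, hdot z z = 1 -> zeval_at z P = zeval_at z Q) -> p = p' /\ q = q'.
Proof.
move=> P0 Ppq Qpq DP DQ PQ.
have [w w1 Pw] : exists2 w, hdot w w = 1 & zeval_at w P != 0.
  apply: contrapT => nw; case/eqP: P0; apply: zeval_eq0 => z.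
  have [a [w [-> w1]]] := polar_decomposition z.
  rewrite -/(zeval_at _ _) (zeval_at_bidegree _ _ Ppq).
  have [->|Pw] := eqVneq (zeval_at w P) 0; first by rewrite mulr0.
  by case: nw; exists w.
have Q0 : Q != 0.
  by apply: contraNneq Pw => Q0; rewrite PQ // Q0 linear0.
have pq : (p + q' = p' + q)%N.
  apply: (@circle_exponents C) => u uu.
  have uk k : u ^+ k * u^* ^+ k = 1 by rewrite -exprMn uu expr1n.
  have uw : hdot (u *: w) (u *: w) = 1.
    transitivity (u * u^* * hdot w w); last by rewrite uu w1 mulr1.
    by rewrite /hdot mulr_sumr; apply: eq_bigr => j _; rewrite !mxE rmorphM /=; ring.
  have := PQ _ uw; rewrite (zeval_at_bidegree _ _ Ppq) (zeval_at_bidegree _ _ Qpq) -PQ //.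
  move=> /(mulIf Pw) E; rewrite !exprD.
  transitivity (u ^+ p * u^* ^+ q * (u ^+ q * u ^+ q')).
    by rewrite -[LHS]mul1r -(uk q); ring.
  by rewrite E -[RHS]mul1r -(uk q'); ring.
have [pp|pp] := leqP p p'.
  have k0 : (p' - p = 0)%N.
    apply: (@sphere_harmonic_shift p q (p' - p) P Q) => //.
    by rewrite subnKC //; have -> : (q + (p' - p) = q')%N by lia.
  by split; lia.
have k0 : (p - p' = 0)%N.
  apply: (@sphere_harmonic_shift p' q' (p - p') Q P) => // [|z z1]; last by rewrite PQ.
  by rewrite subnKC 1?ltnW //; have -> : (q' + (p - p') = q)%N by lia.
by split; lia.
Qed.

End SphereUniqueness.

(** * The spaces H_(p,q) and equivariant operators on them *)

Module HarmonicSpaces.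
Section HarmonicSpaces.
Variables (R : realType) (n : nat).
Local Notation C := R[i].
Local Notation N := n.+1.
Local Notation S := (csphere R n).
Local Notation zpoly := (mpoly (N + N) C).
Local Notation CSn := (CS R n).
Implicit Types (f g : CSn) (U : unitary_group R n) (P : zpoly).

Lemma ltransE U f z : ltrans U f z = f (unitary_act (unitary_inv U) z).
Proof. by []. Qed.

Lemma ltrans_is_linear U : linear (@ltrans R n U).
Proof. by move=> a f g; apply/continuousEP. Qed.
HB.instance Definition _ U :=
  GRing.isLinear.Build C CSn CSn _ (@ltrans R n U) (@ltrans_is_linear U).

Lemma unitary_invK U z : unitary_act (unitary_inv (unitary_inv U)) z = unitary_act U z.
Proof. by apply: val_inj; rewrite /= invmxK. Qed.

Lemma ltrans_invE U f z : ltrans (unitary_inv U) f z = f (unitary_act U z).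
Proof. by rewrite ltransE unitary_invK. Qed.

Lemma unitary_actK U z : unitary_act (unitary_inv U) (unitary_act U z) = z.
Proof.
apply: val_inj; rewrite /= mulmxA mulVmx ?mul1mx //.
exact: unitarymx_unit (valP U).
Qed.

Lemma ltransK U f : ltrans (unitary_inv U) (ltrans U f) = f.
Proof. by apply/continuousEP => z; rewrite ltrans_invE ltransE unitary_actK. Qed.

Lemma zrestrict_usubst U P :
  zrestrict (usubst (val U) P) = ltrans (unitary_inv U) (zrestrict P).
Proof.
apply/continuousEP => z; rewrite ltrans_invE; exact: zeval_usubst.
Qed.

Lemma HpqP pq f : Hpq pq f <-> exists P : zpoly,
  [/\ bidegree pq.1%:R pq.2%:R P, laplacian P = 0 & f = zrestrict P].
Proof.
split=> [[P [Pb Ph Pf]]|[P [Pb Ph ->]]]; exists P.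
  split=> //; last by apply/continuousEP.
  by apply: bihomogeneous_bidegree => a z; exact: Pb.
by split=> // a z; exact: bidegree_bihomogeneous.
Qed.

Lemma Hpq_subspace pq : linear_subspace (@Hpq R n pq).
Proof.
split; first by apply/HpqP; exists 0; rewrite !linear0; split=> //; exact: bidegree0.
move=> a u v /HpqP[P [Pb Ph ->]] /HpqP[Q [Qb Qh ->]]; apply/HpqP.
exists (a *: P + Q); split; last by rewrite linearP.
  by apply: bidegreeD => //; exact: bidegreeZ.
by rewrite linearP /= Ph Qh scaler0 addr0.
Qed.

Lemma Hpq_invariant pq : unitary_invariant (@Hpq R n pq).
Proof.
move=> U f /HpqP[P [Pb Ph ->]]; apply/HpqP.
exists (usubst (val (unitary_inv U)) P); split.
- apply: bihomogeneous_bidegree => a z.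
  by rewrite !zeval_usubst -scalemxAr; exact: bidegree_bihomogeneous.
- rewrite laplacian_usubst ?Ph ?(linear0 (usubst _)) //; exact: valP (unitary_inv U).
- by apply/continuousEP => z; rewrite zrestrict_usubst ltrans_invE ltransE.
Qed.

Lemma zrestrict_sqnormM P : zrestrict (sqnorm_mpoly C N * P) = zrestrict P.
Proof.
apply/continuousEP => z.
rewrite -[LHS]/(zeval_at (\val z) _) zeval_atM zeval_at_sqnorm hdot_csphere mul1r.
by [].
Qed.

(** A bihomogeneous polynomial is its harmonic part plus r² times a quotient. On the sphere r² = 1,
    so the latter restricts like the quotient, whose bidegree is lower, and induction applies. *)
Lemma subspace_zrestrict (B : set CSn) : linear_subspace B ->
  (forall pq, @Hpq R n pq `<=` B) -> forall P, B (zrestrict P).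
Proof.
move=> Bsub HB; have BD u v : B u -> B v -> B (u + v).
  by move=> Bu Bv; rewrite -[u]scale1r; exact: Bsub.2.
have bid p q P : bidegree p%:R q%:R P -> B (zrestrict P).
  elim: p q P => [|p IH] q P Pb.
    (* A polynomial free of [z] is harmonic, since its Laplacian has a negative degree in [z]; the
       same holds below with the conjugates. *)
    have P0 : laplacian P = 0.
      apply: (bidegree_eq0 (bidegree_laplacian Pb)); apply/negP => /andP[+ _].
      by rewrite sub0r oppr_ge0 ler10.
    by apply: (HB (0%N, q)); apply/HpqP; exists P.
  case: q Pb => [|q] Pb.
    have P0 : laplacian P = 0.
      apply: (bidegree_eq0 (bidegree_laplacian Pb)); apply/negP => /andP[_].
      by rewrite sub0r oppr_ge0 ler10.
    by apply: (HB (p.+1, 0%N)); apply/HpqP; exists P.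
  pose d := (p.+1 + q.+1)%N.
  rewrite -[P](subrK (sqnorm_mpoly C N * harmonic_quotient d P)) linearD /=.
  apply: BD.
    apply: (HB (p.+1, q.+1)); apply/HpqP; exists (harmonic_part d P); split=> //.
      exact: bidegree_harmonic_part.
    by apply: (laplacian_harmonic_part (ltn0Sn n) Pb); rewrite -natrD.
  rewrite zrestrict_sqnormM; apply: (IH q).
  have := bidegree_harmonic_quotient d Pb.
  by rewrite -!natr1 !addrK.
move=> P; rewrite (mpolyE P) linear_sum /=.
have := @linear_subspace_sum C CSn B _ (msupp P) (fun m => @mcoeff _ C m P) (fun m => zrestrict (@mpolyX _ C m)) Bsub.
rewrite (eq_bigr (fun m => zrestrict (@mcoeff _ C m P *: @mpolyX _ C m))) => [|m _]; last by rewrite linearZ.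
apply=> m _; exact: bid (bidegreeX C m).
Qed.

(* The value of [Q f] at the pole is a functional on polynomials invariant   *)
(* under the stabilizer of the pole, and such functionals on harmonic        *)
(* polynomials of a given bidegree are proportional.                         *)
Lemma equivariant_Hpq_scalar (Q : {linear CSn -> CSn}) pq : (0 < n)%N ->
  equivariant Q -> exists c : C, forall f, @Hpq R n pq f -> Q f = c *: f.
Proof.
case: pq => p q n0 Qeq; pose p0 : S := point.
have p0E : \val p0 = delta_mx ord0 ord0 :> 'cV[C]_N by [].
pose lam P : C := Q (zrestrict P) p0.
have lam_lin : scalar lam by move=> a P P'; rewrite /lam !linearP.
pose lamL : {scalar zpoly} := HB.pack lam (GRing.isLinear.Build _ _ _ _ lam lam_lin).
have lam_inv : zonal_invariant lamL.
  move=> U Uu Ue P; pose V : unitary_group R n := exist _ U Uu.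
  rewrite /= /lam -[U]/(val V) zrestrict_usubst Qeq ltrans_invE; congr (Q _ _).
  by apply: val_inj; exact: Ue.
pose k := zeval_at (delta_mx ord0 ord0) (polar_harmonic C n p q).
have k0 : k != 0 by exact: polar_harmonic_neq0.
exists (lam (polar_harmonic C n p q) / k).
have atp0 f : Hpq (p, q) f -> Q f p0 = lam (polar_harmonic C n p q) / k * f p0.
  move=> /HpqP[P [/= Pb Ph ->]].
  have := zonal_proportional lam_inv (@zonal_zeval_at C n) Pb Ph.
  rewrite -/k [lamL _]/(lam _) -[lamL _]/(lam _) => E.
  rewrite -[LHS]/(lam P) -[zrestrict P p0]/(zeval_at (delta_mx ord0 ord0) P).
  by apply: (mulfI k0); rewrite E; field.
(* A translation brings any [z] to the pole. The translate of [f] stays in H_(p,q), so the same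
   scalar applies. *)
move=> f fH; apply/continuousEP => z; have [U Uz] := csphere_transitive p0 z.
rewrite -Uz -ltrans_invE -Qeq atp0; last exact: Hpq_invariant.
by rewrite ltrans_invE.
Qed.

(** The restriction of [highest_monomial] lies in both spaces, and a nonzero harmonic function on
    the sphere determines its bidegree. *)
Lemma Hpq_subset_eq pq pq' : (0 < n)%N -> @Hpq R n pq `<=` @Hpq R n pq' -> pq = pq'.
Proof.
case: pq pq' => [p q] [p' q'] n0 sub; pose j : 'I_N := ord_max.
have j0 : j != ord0 by rewrite -val_eqE /= -lt0n.
pose P : zpoly := @mpolyX _ C (highest_monomial j p q).
have PH : Hpq (p, q) (zrestrict P).
  apply/HpqP; exists P; split=> //; first exact: bidegree_highest.
  exact: laplacian_highest.
have /HpqP[P' [/= P'b P'h PP']] := sub _ PH.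
have P0 : P != 0 by rewrite -msize_poly_eq0 msizeX.
have PQ z : hdot z z = 1 -> zeval_at z P = zeval_at z P'.
  move=> z1; have zS : l2norm z = 1 by apply/l2norm1E.
  exact: (congr1 (fun g : CSn => g (mk_csphere zS)) PP').
by have [-> ->] := sphere_harmonic_unique P0 (bidegree_highest C j p q) P'b
  (laplacian_highest C p q j0) P'h PQ.
Qed.

(** A zero space would be contained in the one of bidegree (p + 1, q), against [Hpq_subset_eq]. *)
Lemma Hpq_neq0 pq : (0 < n)%N -> exists2 f : CSn, @Hpq R n pq f & f != 0.
Proof.
move=> n0; apply: contrapT => H0.
have sub pq' : @Hpq R n pq `<=` @Hpq R n pq'.
  move=> f fH; have [->|f0] := eqVneq f 0; first exact: (Hpq_subspace pq').1.
  by case: H0; exists f.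
have := Hpq_subset_eq n0 (sub (pq.1.+1, pq.2)).
by case: pq {H0 sub} => p q [] /eqP; rewrite -[X in X == _]addn0 -addn1 eqn_add2l.
Qed.

End HarmonicSpaces.
End HarmonicSpaces.
Import HarmonicSpaces.

(** * Accessibility and decomposition of invariant subspaces *)

Section Accessible.
Variables (R : realType) (n : nat) (sigma : probability (csphere R n) R).
Hypothesis sigma_inv : rotation_invariant sigma.
Hypothesis n_gt0 : (0 < n)%N.
Local Notation C := R[i].
Local Notation N := n.+1.
Local Notation S := (csphere R n).
Local Notation Re := (@complex.Re R).
Local Notation CSn := (CS R n).
Implicit Types (f g h u v w : CSn) (U : unitary_group R n) (A B : set CSn).

Lemma continuous_mulJ f g : continuous (fun z => f z * (g z)^*).
Proof.
exact: (continuous_mul_C (@cts_fun _ _ f) (continuous_conj_C (@cts_fun _ _ g))).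
Qed.

Arguments continuous_mulJ : clear implicits.

Lemma l2dot_linear g : scalar (fun f : CSn => l2dot sigma f g).
Proof.
move=> a u v; rewrite /l2dot -(cintegralZ sigma a (continuous_mulJ u g)).
rewrite -(cintegralD sigma _ (continuous_mulJ v g)).
  by apply: eq_cintegral => z /=; rewrite mulrDl mulrA.
exact: (continuous_mul_C (@cst_continuous S C a) (continuous_mulJ u g)).
Qed.

Lemma l2dotC f g : l2dot sigma g f = (l2dot sigma f g)^*.
Proof.
rewrite /l2dot -(cintegral_conj sigma (continuous_mulJ f g)).
by apply: eq_cintegral => z; rewrite rmorphM /= conjCK mulrC.
Qed.

Lemma l2dotvv f : l2dot sigma f f = (\int[sigma]_z (Re `|f z| ^+ 2))%:C%C.
Proof.
rewrite -cintegral_real; apply: eq_cintegral => z.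
by rewrite rmorphXn /= RRe_norm normCK.
Qed.

Lemma l2dot_ge0 f : 0 <= l2dot sigma f f.
Proof. by rewrite l2dotvv ler0c; apply: Rintegral_ge0 => z _; exact: sqr_ge0. Qed.

Lemma l2dot_eq0 f : l2dot sigma f f = 0 -> f = 0.
Proof.
rewrite l2dotvv => /(@complexI R) f0.
have cN : continuous (fun z => Re `|f z| ^+ 2).
  move=> z; have cR := @continuous_Re_norm R S f (@cts_fun _ _ f) z.
  exact: (continuous_comp cR (@exprn_continuous R 2 _)).
apply/continuousEP => z.
have /eqP := Rintegral_eq0 sigma_inv cN (fun z => sqr_ge0 _) f0 z.
rewrite expf_eq0 => /andP[_ /eqP fz]; apply/eqP; rewrite -normr_eq0 -(RRe_norm (f z)) fz.
exact: eqxx.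
Qed.

Lemma l2dot_ltrans U f g : l2dot sigma (ltrans U f) (ltrans U g) = l2dot sigma f g.
Proof. exact: (cintegral_unitary (unitary_inv U) sigma_inv (continuous_mulJ f g)). Qed.

Lemma l2dot_bound h : exists2 K : R, 0 <= K &
  forall (g : CSn) (e : R), 0 <= e -> (forall z, Re `|g z| <= e) -> Re `|l2dot sigma g h| <= K * e.
Proof.
have ch := @continuous_Re_norm R S h (@cts_fun _ _ h).
have [M M0 hM] := csphere_continuous_bounded ch.
exists (2%:R * M) => [|g e e0 ge]; first by rewrite mulr_ge0 // ltW.
apply: le_trans (cintegral_le sigma (continuous_mulJ g h) (@cst_continuous S R (e * M)) _) _.
  move=> z; rewrite -lecR RRe_norm normrM norm_conjC rmorphM /=.
  apply: ler_pM => //; rewrite -RRe_norm lecR //.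
  exact: le_trans (ler_norm _) (hM z).
by rewrite Rintegral_csphere_cst [e * M]mulrC mulrA.
Qed.

(** The kernel of [L] contains all restrictions of polynomials, and the bound carries this to their
    uniform closure, which is everything. *)
Lemma functional_eq0 (L : CSn -> C) (K : R) : scalar L -> 0 <= K ->
  (forall (g : CSn) (e : R), 0 <= e -> (forall z, Re `|g z| <= e) -> Re `|L g| <= K * e) ->
  (forall pq f, @Hpq R n pq f -> L f = 0) -> forall f, L f = 0.
Proof.
move=> Llin K0 Lbound LH f.
have L0 : L 0 = 0.
  by have := Llin 1 0 0; rewrite scaler0 addr0 mul1r => /eqP; rewrite eq_sym -subr_eq0 addrK => /eqP.
have LP P : L (zrestrict P) = 0.
  apply: (@subspace_zrestrict R n [set g | L g = 0]) => [|pq g /=]; last exact: LH.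
  by split=> [//|a u v /= Lu Lv]; rewrite Llin Lu Lv mulr0 addr0.
apply/eqP; rewrite -normr_eq0 -(@RRe_norm R).
suff -> : Re `|L f| = 0 by [].
apply/eqP; rewrite eq_le; apply/andP; split; last exact: le_trans (normr_ge0 _) (Re_le_norm _).
apply/ler_addgt0Pr => e e0; rewrite add0r.
have K1 : 0 < K + 1 by rewrite ltr_wpDl.
have [P fP] := zpoly_dense sigma_inv f (divr_gt0 e0 K1).
have -> : L f = L (f - zrestrict P).
  by rewrite addrC -scaleN1r Llin LP mulr0 add0r.
have eK0 : 0 <= e / (K + 1) by rewrite divr_ge0 // ltW.
apply: le_trans (Lbound (f - zrestrict P) _ eK0 fP) _.
by rewrite mulrA ler_pdivrMr // mulrC ler_pM2l // lerDl.
Qed.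

Lemma fin_dim_linear_subspace A : fin_dim_subspace A -> linear_subspace A.
Proof.
move=> [m [b ->]]; split.
  by exists (fun=> 0) => //; apply: big1 => i _; rewrite scale0r.
move=> a _ _ [x _ <-] [y _ <-]; exists (fun i => a * x i + y i) => //.
rewrite scaler_sumr -big_split /=; apply: eq_bigr => i _.
by rewrite scalerDl scalerA.
Qed.

Lemma l2_projection_exists A B : fin_dim_subspace A -> linear_subspace B -> B `<=` A ->
  exists P : {linear CSn -> CSn}, [/\ forall v, B (P v), forall v, B v -> P v = v &
    forall v w, B w -> l2dot sigma (v - P v) w = 0].
Proof.
move=> [m [b ->]] Bsub BA.
exact: (hermitian_projection l2dot_linear l2dotC l2dot_ge0 l2dot_eq0 Bsub BA).
Qed.

(** The difference [d] of the two sides lies in [B] and is orthogonal to [B], since translation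
    preserves both [B] and the inner product; so [<d, d> = 0]. *)
Lemma l2_projection_equivariant B (P : CSn -> CSn) : linear_subspace B ->
  unitary_invariant B -> (forall v, B (P v)) ->
  (forall v w, B w -> l2dot sigma (v - P v) w = 0) -> equivariant P.
Proof.
move=> [B0 BL] Binv BP Pdot U f; pose d := P (ltrans U f) - ltrans U (P f).
have Bd : B d by rewrite /d addrC -scaleN1r; apply: BL => //; exact: Binv.
apply/eqP; rewrite -subr_eq0 -/d; apply/eqP/l2dot_eq0.
have lB : ltrans U (f - P f) = ltrans U f - ltrans U (P f) by exact: linearB.
have dE : d = -1 *: (ltrans U f - P (ltrans U f)) + ltrans U (f - P f).
  by rewrite lB scaleN1r opprB addrA subrK.
rewrite {1}dE l2dot_linear Pdot // mulr0 add0r.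
rewrite -(l2dot_ltrans (unitary_inv U)) ltransK.
by apply: Pdot; exact: Binv.
Qed.

(** [Q] acts on H_(p,q) as a scalar; if it is nonzero, every element is a multiple of a value of
    [Q]. *)
Lemma Hpq_dichotomy A (Q : {linear CSn -> CSn}) pq : linear_subspace A ->
  equivariant Q -> (forall f, A (Q f)) ->
  @Hpq R n pq `<=` A \/ forall f, @Hpq R n pq f -> Q f = 0.
Proof.
move=> [A0 AL] Qeq QA; have [c Qc] := equivariant_Hpq_scalar pq n_gt0 Qeq.
have [c0|c0] := eqVneq c 0.
  by right=> f fH; rewrite Qc // c0 scale0r.
left=> f fH; have -> : f = c^-1 *: Q f by rewrite Qc // scalerA mulVf // scale1r.
by rewrite -[_ *: _]addr0; exact: AL.
Qed.

Lemma l2dot0 h : l2dot sigma 0 h = 0.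
Proof.
have := l2dot_linear h 1 0 0; rewrite scaler0 addr0 mul1r => /eqP.
by rewrite eq_sym -subr_eq0 addrK => /eqP.
Qed.

Lemma supnorm_bound (Q : CSn -> CSn) : bounded_op Q -> exists2 K : R, 0 <= K &
  forall (g : CSn) (e : R), 0 <= e -> (forall z, Re `|g z| <= e) ->
    forall z, Re `|Q g z| <= K * e.
Proof.
(* The absolute value is taken because [bounded_op] does not fix the sign of [M]. *)
move=> [M QM]; exists `|M| => [//|g e e0 ge z].
have cQ := @continuous_Re_norm R S (Q g) (@cts_fun _ _ (Q g)).
have [M' M'0 QM'] := csphere_continuous_bounded cQ.
have Qsup : Re `|Q g z| <= supnorm (Q g).
  apply: ub_le_sup; last by exists z.
  by exists M' => _ [w _ <-]; exact: le_trans (ler_norm _) (QM' w).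
have gsup : supnorm g <= e.
  apply: ge_sup; first by exists (Re `|g point|); exists point.
  by move=> _ [w _ <-].
have gsup0 : 0 <= supnorm g.
  have cg := @continuous_Re_norm R S g (@cts_fun _ _ g).
  have [M2 M20 gM2] := csphere_continuous_bounded cg.
  apply: le_trans (_ : Re `|g point| <= _).
    exact: le_trans (normr_ge0 _) (Re_le_norm _).
  apply: ub_le_sup; last by exists point.
  by exists M2 => _ [w _ <-]; exact: le_trans (ler_norm _) (gM2 w).
apply: le_trans Qsup _; apply: le_trans (QM g) _.
apply: le_trans (_ : `|M| * supnorm g <= _); first by rewrite ler_wpM2r // ler_norm.
by rewrite ler_wpM2l.
Qed.

(** The functional [g |-> <g - Q g, h>] is bounded. On H_(p,q) inside [A] it vanishes since [Q] is
    the identity there. Otherwise both [Q] and the orthogonal projection onto [A] kill H_(p,q), the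
    latter saying that H_(p,q) is orthogonal to [h]. *)
Lemma invariant_accessible A : fin_dim_subspace A -> unitary_invariant A ->
  unitary_accessible sigma A.
Proof.
move=> Afin Ainv; split=> // Q [Qbd QA Qid] Qeq f; split=> // h Ah.
have Asub := fin_dim_linear_subspace Afin.
have [P [PA Pid Pdot]] := l2_projection_exists Afin Asub (@subset_refl _ A).
have Peq := l2_projection_equivariant Asub Ainv PA Pdot.
have [K K0 hK] := l2dot_bound h.
have [K' K'0 QK'] := supnorm_bound Qbd.
pose L (g : CSn) := l2dot sigma (g - Q g) h.
apply: (@functional_eq0 L (K * (1 + K'))) => [a u v| |g e e0 ge|pq g gH].
- rewrite /L; have -> : a *: u + v - Q (a *: u + v) = a *: (u - Q u) + (v - Q v).
    by rewrite (linearP Q) scalerBr opprD addrACA.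
  exact: l2dot_linear.
- by rewrite mulr_ge0 // addr_ge0.
- rewrite -mulrA; apply: (hK (g - Q g)); first by rewrite mulr_ge0 // addr_ge0.
  move=> z; apply: le_trans (_ : Re `|g z| + Re `|Q g z| <= _).
    by rewrite -lecR rmorphD /= !RRe_norm; exact: ler_normB.
  by rewrite mulrDl mul1r lerD //; exact: QK'.
have HA0 : @Hpq R n pq `<=` A -> L g = 0.
  by move=> HA; rewrite /L (Qid g (HA _ gH)) subrr l2dot0.
have [/HA0 //|Q0] := Hpq_dichotomy pq Asub Qeq QA.
have [/HA0 //|P0] := Hpq_dichotomy pq Asub Peq PA.
by have := Pdot g h Ah; rewrite /L (Q0 g gH) (P0 g gH).
Qed.

(** The orthogonal projection onto the second space is equivariant. By the dichotomy it kills the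
    first space, the alternative being an inclusion, which [Hpq_subset_eq] excludes. The ambient [A]
    supplies the finite dimension behind the projection. *)
Lemma Hpq_orthogonal A pq pq' f g : fin_dim_subspace A ->
  @Hpq R n pq `<=` A -> @Hpq R n pq' `<=` A -> pq != pq' ->
  Hpq pq f -> Hpq pq' g -> l2dot sigma f g = 0.
Proof.
move=> Afin HA HA' pqN fH gH; have Hsub := @Hpq_subspace R n pq' : linear_subspace (@Hpq R n pq').
have [P [PH Pid Pdot]] := l2_projection_exists Afin Hsub HA'.
have Peq := l2_projection_equivariant Hsub (@Hpq_invariant R n pq') PH Pdot.
have [sub|P0] := Hpq_dichotomy pq Hsub Peq PH.
  by move: pqN; rewrite (Hpq_subset_eq n_gt0 sub) eqxx.
by have := Pdot f g gH; rewrite P0 // subr0.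
Qed.

(** Otherwise [m + 1] of these spaces would give as many orthonormal vectors in a span of [m]
    vectors. *)
Lemma finite_Hpq A : fin_dim_subspace A -> finite_set [set pq | @Hpq R n pq `<=` A].
Proof.
move=> Afin; apply: contrapT => inf; have [m [b Ab]] := Afin.
have [F FA Fm] := infinite_set_fset m.+1 inf.
pose x (i : 'I_#|`F|) := nth (0%N, 0%N) F i.
have xF i : x i \in F by exact: mem_nth.
have xA i : @Hpq R n (x i) `<=` A by exact: (FA _ (xF i)).
pose u i := sval (cid2 (@Hpq_neq0 R n (x i) n_gt0)).
have uH i : Hpq (x i) (u i) by rewrite /u; case: cid2.
have u0 i : u i != 0 by rewrite /u; case: cid2.
have unz i : l2dot sigma (u i) (u i) != 0.
  by apply: contraNneq (u0 i) => /l2dot_eq0 ->.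
pose a i := (sqrtC (l2dot sigma (u i) (u i)))^-1.
pose c i := a i *: u i.
have cH i : Hpq (x i) (c i).
  by have [H0 HL] := @Hpq_subspace R n (x i); rewrite /c -[_ *: _]addr0; exact: HL.
have oc : orthonormal (fun f g => l2dot sigma f g) c.
  move=> i j; have [->|ij] := eqVneq i j; last first.
    apply: (Hpq_orthogonal Afin (xA i) (xA j) _ (cH i) (cH j)).
    by apply: contraNneq ij => /eqP; rewrite (nth_uniq _ _ _ (fset_uniq F)) // => /eqP/val_inj ->.
  have dZ (k : C) (f g : CSn) : l2dot sigma (k *: f) g = k * l2dot sigma f g.
    by rewrite -[k *: f]addr0 l2dot_linear l2dot0 addr0.
  rewrite /c dZ l2dotC dZ rmorphM /= -l2dotC.
  have areal : (a j)^* = a j.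
    by rewrite /a conj_Creal // realV ger0_real // sqrtC_ge0 l2dot_ge0.
  rewrite areal -[X in _ * (_ * X)]sqrtCK /a expr2.
  by rewrite mulrA mulrACA !mulVf ?mulr1 // sqrtC_eq0.
have cA i : range (fun x : 'I_m -> C => \sum_j x j *: b j) (c i).
  by rewrite -Ab; exact: (xA i).
by have := orthonormal_bound l2dot_linear oc cA; rewrite leqNgt Fm.
Qed.

Lemma direct_sum_orthogonal A (F : {fset nat * nat}) (h : nat * nat -> CSn) :
  fin_dim_subspace A -> (forall pq, pq \in F -> @Hpq R n pq `<=` A) ->
  (forall pq, pq \in F -> Hpq pq (h pq)) ->
  \sum_(pq <- F) h pq = 0 -> forall pq, pq \in F -> h pq = 0.
Proof.
move=> Afin FA hH h0 pq pqF; apply: l2dot_eq0.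
have dD (f g k : CSn) : l2dot sigma (f + g) k = l2dot sigma f k + l2dot sigma g k.
  by rewrite -[f]scale1r l2dot_linear mul1r scale1r.
have dsum (r : seq (nat * nat)) : l2dot sigma (\sum_(x <- r) h x) (h pq) =
    \sum_(x <- r) l2dot sigma (h x) (h pq).
  by elim: r => [|x r IH]; rewrite ?big_nil ?l2dot0 // !big_cons dD IH.
have := dsum F; rewrite h0 l2dot0 (big_fsetD1 pq) //= big_seq big1 ?addr0 // => x.
rewrite !inE => /andP[xpq xF].
exact: (Hpq_orthogonal Afin (FA _ xF) (FA _ pqF) xpq (hH _ xF) (hH _ pqF)).
Qed.

(** Let [B] be the sum of the H_(p,q) inside [A]. The component [g] of an [f] in [A] orthogonal to
    [B] is shown to be orthogonal to every H_(p,q), hence to itself by density. *)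
Lemma invariant_direct_sum A : fin_dim_subspace A -> unitary_invariant A ->
  exists F : {fset nat * nat}, direct_sum F (@Hpq R n) A.
Proof.
move=> Afin Ainv; have Asub := fin_dim_linear_subspace Afin.
have /finite_fsetP[F FE] := finite_Hpq Afin.
have FA pq : pq \in F -> @Hpq R n pq `<=` A.
  by move=> pqF; have : [set` F] pq := pqF; rewrite -FE.
exists F; split; last first.
  by move=> h hH h0 pq pqF; exact: (direct_sum_orthogonal Afin FA hH h0 pqF).
pose B : set CSn := [set f | exists h : nat * nat -> CSn,
  (forall pq, pq \in F -> Hpq pq (h pq)) /\ f = \sum_(pq <- F) h pq].
rewrite -/B; have BA : B `<=` A.
  move=> _ [h [hH ->]].
  have := @linear_subspace_sum C CSn A _ F (fun=> 1) h Asub.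
  rewrite (eq_bigr h) => [|i _]; last by rewrite scale1r.
  by apply=> pq pqF; apply: (FA _ pqF); exact: hH.
have Bsub : linear_subspace B.
  split.
    exists (fun=> 0); split; last by rewrite big1.
    by move=> pq _; exact: (@Hpq_subspace R n pq).1.
  move=> a _ _ [h [hH ->]] [k [kH ->]]; exists (fun pq => a *: h pq + k pq); split.
    by move=> pq pqF; apply: (@Hpq_subspace R n pq).2; [exact: hH|exact: kH].
  by rewrite scaler_sumr big_split.
have HB pq : pq \in F -> @Hpq R n pq `<=` B.
  move=> pqF f fH; exists (fun x => if x == pq then f else 0); split.
    move=> x _; case: eqP => [->//|_]; exact: (@Hpq_subspace R n x).1.
  rewrite (big_fsetD1 pq) //= eqxx big_seq big1 ?addr0 // => x.
  by rewrite !inE => /andP[/negPf -> _].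
have [PB [PBB PBid PBdot]] := l2_projection_exists Afin Bsub BA.
have [PA [PAA PAid PAdot]] := l2_projection_exists Afin Asub (@subset_refl _ A).
have PAeq := l2_projection_equivariant Asub Ainv PAA PAdot.
apply/seteqP; split=> [f Af|]; last exact: BA.
pose g := f - PB f.
have Ag : A g by rewrite /g addrC -scaleN1r; apply: Asub.2 => //; apply: BA; exact: PBB.
suff : g = 0 by move=> /eqP; rewrite subr_eq0 => /eqP ->; exact: PBB.
apply: l2dot_eq0; have [K K0 hK] := l2dot_bound g.
apply: (functional_eq0 (l2dot_linear g) K0 hK) => pq u uH.
(* Either H_(p,q) is one of the summands of [B], to which [g] is orthogonal, or the projection onto
   [A] kills it, so that it is orthogonal to [A] and in particular to [g]. *)
have [HA|P0] := Hpq_dichotomy pq Asub PAeq PAA.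
  have pqF : pq \in F by have : [set` F] pq by rewrite -FE.
  by rewrite l2dotC (PBdot f u (HB _ pqF _ uH)) conjC0.
by have := PAdot u g Ag; rewrite P0 // subr0.
Qed.

Lemma direct_sum_invariant A (F : {fset nat * nat}) :
  direct_sum F (@Hpq R n) A -> unitary_invariant A.
Proof.
move=> [-> _] U _ [h [hH ->]]; exists (fun pq => ltrans U (h pq)); split.
  by move=> pq pqF; apply: Hpq_invariant; exact: hH.
by rewrite (linear_sum (@ltrans R n U)).
Qed.

End Accessible.

Theorem theorem2p17 (R : realType) (n : nat)
    (sigma : probability (csphere R n) R)
    (A : set (CS R n)) :
  (2 <= n.+1)%N ->
  rotation_invariant sigma ->
  fin_dim_subspace A ->
  (unitary_invariant A <-> unitary_accessible sigma A) /\
  (unitary_accessible sigma A <->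
   exists F : {fset nat * nat}, direct_sum F (@Hpq R n) A).
Proof.
(* The hypothesis [2 <= n.+1] is convertible to [0 < n], the form in which the second coordinate is
   used above. *)
move=> n_gt0 sinv Afin; have inv_acc := invariant_accessible sinv n_gt0 Afin.
split; split=> //; first by case.
  by case=> _ Ainv _; exact: (invariant_direct_sum sinv n_gt0 Afin Ainv).
by case=> F /direct_sum_invariant /inv_acc.
Qed.
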